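(* Fix $c>0$. There are constants $c_1,c_2>0$ such that the following holds for every $k\in\mathbb{N}$, every $i<k\le d$, every $\varepsilon>0$, and every $d$-uniform $c$-nice simplicial complex $X$: the inclusion graph $(X(k),X(i))$ is an $(\varepsilon,\beta)$-function additive sampler, where \begin{enumerate} \item $\beta=\frac{c_1}{\varepsilon}\exp\left(-c_2\varepsilon^2\frac{k}{i}\right)$ if $X$ is $c$-nice via condition (1) or condition (3) below (the non-partite cases); \item $\beta=\frac{c_1}{\varepsilon}\exp\left(-c_2\varepsilon^8\frac{k}{i}\right)$ if $X$ is $c$-nice via condition (2) below (the partite case). \end{enumerate} Moreover, if $X$ is $k$-uniform and is the $k$-skeleton of a $d'$-uniform complex $Y$ (with the induced distribution), then for every $k<k'\le d'$ the inclusion graph $(Y(k'),Y(i))$ is an $(\varepsilon,O(\beta))$-function additive sampler.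
   Context: A $d$-uniform simplicial complex $X$ is a finite downward-closed family of sets all of whose maximal sets have size $d$; $X(j)$ denotes its faces of size $j$. It carries a full-support probability distribution $\pi_d$ on $X(d)$, which induces $\pi_j$ on $X(j)$ by drawing $s\sim\pi_d$ and a uniformly random $j$-subset of $s$. The link of a face $s$ is $X_s=\{t\setminus s: s\subseteq t\in X\}$, with top faces weighted proportionally to $\pi_d(t)$. The graph underlying $X_s$ has vertices $X_s(1)$, edges $X_s(2)$, weighted by the induced distribution; a weighted graph is a $\lambda$-one-sided expander if the second largest eigenvalue of its normalized (random-walk) adjacency operator is at most $\lambda$, and a $\lambda$-two-sided expander if moreover all nontrivial eigenvalues lie in $[-\lambda,\lambda]$. $X$ is a $\lambda$-one-sided (resp. two-sided) local-spectral expander if for every face $s$ with $|s|\le d-2$ (including $s=\emptyset$) the graph underlying $X_s$ is a $\lambda$-one-sided (resp. two-sided) expander. $X$ is $d$-partite if $X(1)$ is partitioned into $d$ parts such that every top face has one vertex in each part. The $k$-skeleton of $X$ is the $k$-uniform complex of faces of size at most $k$ with distribution $\pi_k$. The down-up walk $U_{m-1}D_m$ on $X(m)$ moves from $s$ to $s'$ by deleting a uniformly random vertex of $s$ and then choosing $s'\supseteq$ the resulting $(m-1)$-face with probability proportional to $\pi_m(s')$. An $m$-uniform complex $X$ is $c$-nice if one of: (1) $X$ is a $2^{-cm}$-two-sided local-spectral expander; (2) $X$ is an $m$-partite $2^{-cm}$-one-sided local-spectral expander (or a skeleton thereof); (3) $X$ is the $m$-skeleton of a $D$-uniform complex $Y$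 whose down-up walk $U_{D-1}D_D$ has second largest eigenvalue at most $1-\frac{c}{D}$, with $D\ge 2m^2$. The inclusion graph $(X(k),X(i))$ is the bipartite graph with left side $X(k)$, right side $X(i)$, whose edges $(s,t)$ with $t\subseteq s$ are sampled by $s\sim\pi_k$ and $t$ a uniformly random $i$-subset of $s$. A bipartite graph $(L,R,E)$ is an $(\varepsilon,\beta)$-function additive sampler if for every $f:R\to[0,1]$ with $\mu=\mathbb{E}_{u\in R}[f(u)]$, $\Pr_{v\in L}\left[\left|\mathbb{E}_{u\sim v}[f(u)]-\mu\right|>\varepsilon\right]<\beta$, where probabilities and expectations are with respect to the edge distribution and its marginals. *)

(* Defs.v *)
From HB Require Import structures.
From mathcomp Require Import all_boot all_order all_algebra.
From mathcomp Require Import all_classical all_reals all_analysis.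
Set Implicit Arguments. Unset Strict Implicit. Unset Printing Implicit Defensive.
Import Order.TTheory GRing.Theory Num.Theory.
Local Open Scope ring_scope.

Section Complexes.
Variables (R : realType) (V : finType).

(* A d-uniform weighted simplicial complex on the vertex type V is given by
   its top-face distribution pi : {set V} -> R.  The top faces X(d) are the
   sets with pi s > 0 (so pi has full support on X(d) by construction); the
   complex X is the downward closure of X(d). *)
Definition is_complex (d : nat) (pi : {set V} -> R) : Prop :=
  (forall s, 0 <= pi s) /\ (forall s, 0 < pi s -> #|s| = d) /\
  \sum_(s : {set V}) pi s = 1.

Definition face (pi : {set V} -> R) (t : {set V}) : bool :=
  [exists s : {set V}, (0 < pi s) && (t \subset s)].

(* induced distribution pi_j on X(j): draw s ~ pi_d, then a uniform j-subset *)
Definition pij (d : nat) (pi : {set V} -> R) (j : nat) (t : {set V}) : R :=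
  if #|t| == j then (\sum_(s : {set V} | t \subset s) pi s) / ('C(d, j))%:R
  else 0.

(* "the second largest eigenvalue of M is at most lam": at most one
   eigenvalue (counted with multiplicity as root of the characteristic
   polynomial) is > lam *)
Definition second_eig_le (n : nat) (M : 'M[R]_n) (lam : R) : Prop :=
  forall s : seq R, uniq s -> all (fun mu => lam < mu) s ->
    (\sum_(mu <- s) mup mu (char_poly M) <= 1)%N.

(* "all nontrivial eigenvalues lie in [-lam, lam]": at most one eigenvalue
   (with multiplicity; the trivial one) has absolute value > lam *)
Definition two_sided_eig_le (n : nat) (M : 'M[R]_n) (lam : R) : Prop :=
  forall s : seq R, uniq s -> all (fun mu => lam < `|mu|) s ->
    (\sum_(mu <- s) mup mu (char_poly M) <= 1)%N.

(* Graph underlying the link X_s: vertices X_s(1), edge weights proportional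
   to the induced distribution on X_s(2), i.e. to the pi-mass of the top
   faces containing s together with the edge. *)
Definition link_verts (pi : {set V} -> R) (s : {set V}) : {set V} :=
  [set v | (v \notin s) && face pi (v |: s)].

Definition link_weight (pi : {set V} -> R) (s : {set V}) (u v : V) : R :=
  if (u != v) && (u \notin s) && (v \notin s) then
    \sum_(t : {set V} | (u |: (v |: s)) \subset t) pi t
  else 0.

Definition link_walk (pi : {set V} -> R) (s : {set V}) :
    'M[R]_(#|link_verts pi s|) :=
  \matrix_(a, b)
    (link_weight pi s (enum_val a) (enum_val b) /
     \sum_(w in link_verts pi s) link_weight pi s (enum_val a) w).

Definition one_sided_lse (d : nat) (pi : {set V} -> R) (lam : R) : Prop :=
  forall s : {set V}, face pi s -> (#|s|.+2 <= d)%N ->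
    second_eig_le (link_walk pi s) lam.

Definition two_sided_lse (d : nat) (pi : {set V} -> R) (lam : R) : Prop :=
  forall s : {set V}, face pi s -> (#|s|.+2 <= d)%N ->
    two_sided_eig_le (link_walk pi s) lam.

(* d-partite: a partition of the vertices into d parts such that every top
   face has exactly one vertex in each part *)
Definition partite (d : nat) (pi : {set V} -> R) : Prop :=
  exists col : V -> 'I_d, forall t, 0 < pi t -> {in t &, injective col}.

Definition is_skeleton (m : nat) (piX : {set V} -> R)
    (D : nat) (piY : {set V} -> R) : Prop :=
  is_complex D piY /\ (m <= D)%N /\ forall t, piX t = pij D piY m t.

Definition top_faces (pi : {set V} -> R) : {set {set V}} :=
  [set t | 0 < pi t].

Definition downup_walk (D : nat) (pi : {set V} -> R) :
    'M[R]_(#|top_faces pi|) :=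
  \matrix_(a, b)
    (let sa : {set V} := enum_val a in let sb : {set V} := enum_val b in
     \sum_(v in sa)
       (if (sa :\ v) \subset sb then
          (D%:R)^-1 * (pi sb / \sum_(t : {set V} | (sa :\ v) \subset t) pi t)
        else 0)).

Definition nice1 (c : R) (m : nat) (pi : {set V} -> R) : Prop :=
  two_sided_lse m pi (2 `^ (- (c * m%:R))).

(* c-nice, condition (2): m-partite one-sided expander, or a skeleton of one *)
Definition nice2 (c : R) (m : nat) (pi : {set V} -> R) : Prop :=
  exists (D : nat) (piY : {set V} -> R),
    is_skeleton m pi D piY /\ partite D piY /\
    one_sided_lse D piY (2 `^ (- (c * m%:R))).

Definition nice3 (c : R) (m : nat) (pi : {set V} -> R) : Prop :=
  exists (D : nat) (piY : {set V} -> R),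
    (2 * m ^ 2 <= D)%N /\ is_skeleton m pi D piY /\
    second_eig_le (downup_walk D piY) (1 - c / D%:R).

(* The inclusion graph (X(k), X(i)) is an (eps, beta)-function additive
   sampler.  Left marginal pi_k, right marginal pi_i; the neighbourhood of s
   is the uniform distribution on the i-subsets of s. *)
Definition incl_sampler (d : nat) (pi : {set V} -> R) (k i : nat)
    (eps beta : R) : Prop :=
  forall f : {set V} -> R, (forall t, 0 <= f t <= 1) ->
    let mu := \sum_(t : {set V}) pij d pi i t * f t in
    let avg (s : {set V}) :=
      (\sum_(t : {set V} | (t \subset s) && (#|t| == i)) f t) / ('C(k, i))%:R in
    \sum_(s : {set V} | eps < `|avg s - mu|) pij d pi k s < beta.

End Complexes.

(* Main.v *)
Require Import Defs.
From HB Require Import structures.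
From mathcomp Require Import all_boot all_order all_algebra.
From mathcomp Require Import all_classical all_reals all_analysis.
From mathcomp Require Import fintype finset fingroup perm spectral complex.
From mathcomp Require Import ring lra zify.
Import Order.TTheory GRing.Theory Num.Theory.
Set Implicit Arguments.
Unset Strict Implicit.
Unset Printing Implicit Defensive.
Local Open Scope ring_scope.

(**
Write m = k / i.  In all cases one bounds the moment generating function of
avg_s f - mu under pi_k by B exp(O(m th^2)) at the parameter m th, for |th| at
most a constant depending on c.  Optimizing over th gives the sampler, with
exponent eps^2 even in the partite case; and since avg_{s'} f is the mean of
avg_s f over the k-subsets s of s', Jensen's inequality transfers the bound
from k to every k' > k.

Cases (1) and (2).  View the random top face as a family of random vertices
(w_c): a random ordering of the face, or, in the partite case, its vertex of
each color.  If, given any few coordinates, functions of two further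
coordinates have covariance at most gam, then peeling off coordinates with the
law of total covariance bounds the covariance of functions of disjoint blocks A
and B by |A||B| gam.  Jensen's inequality over random partitions of a k-set K
into m blocks of size i then reduces the moment generating function to a
product of m almost independent factors, the errors being harmless because gam
is exponentially small in d.  The remaining dependence on K is handled by
comparison with m independent i-subsets of the index set.
For two-sided expanders gam is read off the links.  For a one-sided D-partite
expander with D large compared with 2^(cd/2), the least eigenvalue of a link is
at least -1/(D - |s| - 1), so orderings still work; for smaller D one uses
colors, where testing the Rayleigh quotient on functions supported on two color
classes costs only a factor D.

Case (3).  The gap c/D is a Poincare inequality on Y(D), and S |-> avg_S f is
(i/D)-Lipschitz for the down-up walk.  Applying it to exp(lam avg_S f / 2) and
halving lam repeatedly bounds the moment generating function of avg_S f as long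
as lam = O(sqrt(D) / i), a range which contains m th because D >= 2 d^2.
Passing from S to its k-subsets is the same comparison with independent
i-subsets.
*)

(** * Exponential inequalities *)

(** Since [1 - x <= expR (- x)], the exponential is at most [1 / (1 - x)], and [(1 - x) (1 + x + 2
    x^2) = 1 + x^2 (1 - 2 x)]. *)
Lemma expR_le_quadratic (R : realType) (x : R) :
  x <= 2^-1 -> expR x <= 1 + x + 2 * x ^+ 2.
Proof.
move=> x_le; have x1 : 0 < 1 - x by lra.
have e1 := expR_ge1Dx (- x).
rewrite -[x in expR x]opprK expRN.
apply: (@le_trans _ _ (1 - x)^-1); first by rewrite lef_pV2 ?posrE ?expR_gt0.
rewrite -[_^-1]mul1r ler_pdivrMr //.
have : 0 <= x ^+ 2 * (1 - 2 * x) by rewrite mulr_ge0 ?sqr_ge0 //; lra.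
nra.
Qed.

(** Follows from [1 + (y - x) <= expR (y - x)] with [x] the larger argument. It will bound the
    Dirichlet form of an exponential. *)
Lemma sqr_expRB_le (R : realType) (x y : R) :
  (expR x - expR y) ^+ 2 <= (x - y) ^+ 2 * (expR (2 * x) + expR (2 * y)).
Proof.
wlog yx : x y / y <= x.
  move=> H; case: (leP y x) => [|/ltW] h; first exact: H.
  have := H y x h; rewrite -sqrrN opprB -[(y - x) ^+ 2]sqrrN opprB.
  by rewrite [expR (2 * y) + _]addrC.
have sq z : expR (2 * z) = expR z ^+ 2 by rewrite mulrC expRM_natr.
rewrite !sq; have ex := expR_gt0 x; have ey := expR_gt0 y.
have : expR x - expR y <= (x - y) * expR x.
  have := expR_ge1Dx (y - x); rewrite expRD expRN => h.
  have : (1 + (y - x)) * expR x <= expR y.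
    by rewrite -ler_pdivlMr.
  by lra.
have : 0 <= expR x - expR y by rewrite subr_ge0 ler_expR.
move=> h0 h1.
have h2 : (expR x - expR y) ^+ 2 <= ((x - y) * expR x) ^+ 2.
  by rewrite lerXn2r ?nnegrE // (le_trans h0).
apply: (le_trans h2); rewrite exprMn ler_wpM2l ?sqr_ge0 //.
by rewrite lerDl sqr_ge0.
Qed.

Section WeightedAverages.
Variables (R : realType) (J : finType) (p : J -> R).
Hypothesis p_ge0 : forall j, 0 <= p j.
Hypothesis p_sum1 : \sum_j p j = 1.

(** The tangent line of the exponential at the mean lies below the graph, and its linear part
    averages to zero. *)
Lemma jensen_expR (x : J -> R) :
  expR (\sum_j p j * x j) <= \sum_j p j * expR (x j).
Proof.
set y := \sum_j _.
have -> : expR y = \sum_j p j * (expR y * (1 + (x j - y))).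
  under eq_bigr => j _ do rewrite mulrCA.
  rewrite -mulr_sumr -[LHS]mulr1; congr (_ * _).
  under eq_bigr => j _ do rewrite mulrDr mulr1 mulrBr.
  by rewrite big_split /= sumrB -mulr_suml p_sum1 mul1r subrr addr0.
apply: ler_sum => j _; apply: ler_wpM2l => //.
have -> : expR (x j) = expR y * expR (x j - y) by rewrite -expRD addrC subrK.
by rewrite ler_wpM2l ?expR_ge0 // expR_ge1Dx.
Qed.

(** In the quadratic bound on the exponential the linear term has mean zero. The restriction on [th]
    keeps every exponent at most 1/2. *)
Lemma hoeffding_expR (h : J -> R) (th : R) :
  let mu := \sum_j p j * h j in
  (forall j, `|h j - mu| <= 1) -> `|th| <= 2^-1 ->
  \sum_j p j * expR (th * (h j - mu)) <= expR (2 * th ^+ 2).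
Proof.
move=> mu hmu th_le; have muE : mu = \sum_j p j * h j by [].
clearbody mu.
apply: (@le_trans _ _ (1 + 2 * th ^+ 2)); last exact: expR_ge1Dx.
have -> : 1 + 2 * th ^+ 2
    = \sum_j p j * (1 + th * (h j - mu) + 2 * th ^+ 2).
  transitivity ((1 + 2 * th ^+ 2 - th * mu) * (\sum_j p j)
    + th * \sum_j p j * h j); first by rewrite p_sum1 -muE mulr1 subrK.
  rewrite !mulr_sumr -big_split; apply: eq_bigr => j _ /=; ring.
apply: ler_sum => j _; apply: ler_wpM2l => //.
have tj : `|th * (h j - mu)| <= `|th|.
  by rewrite normrM ler_piMr.
apply: le_trans (expR_le_quadratic _) _.
  by apply: le_trans (ler_norm _) _; apply: le_trans tj _.
rewrite lerD2l ler_wpM2l // -[X in X <= _]real_normK ?num_real //.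
by rewrite -[X in _ <= X]real_normK ?num_real // lerXn2r ?nnegrE.
Qed.

End WeightedAverages.

(** * Averages over subsets of a fixed size *)

Section SubsetAverage.
Variables (R : realType) (T : finType).
Implicit Types (K A : {set T}) (psi : {set T} -> R).

(** If [K] has fewer than [i] elements, the value is 0 by the convention for division. *)
Definition subset_avg (i : nat) K psi : R :=
  (\sum_(A : {set T} | (A \subset K) && (#|A| == i)) psi A) / 'C(#|K|, i)%:R.

Lemma eq_subset_avg i K psi psi' :
  (forall A, A \subset K -> #|A| = i -> psi A = psi' A) ->
  subset_avg i K psi = subset_avg i K psi'.
Proof.
move=> e; congr (_ / _); apply: eq_bigr => A /andP[AK /eqP Ai]; exact: e.
Qed.

Lemma le_subset_avg i K psi psi' :
  (forall A, A \subset K -> #|A| = i -> psi A <= psi' A) ->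
  subset_avg i K psi <= subset_avg i K psi'.
Proof.
move=> e; rewrite ler_wpM2r ?invr_ge0 //.
by apply: ler_sum => A /andP[AK /eqP Ai]; exact: e.
Qed.

Lemma subset_avg_cst i K (x : R) : (i <= #|K|)%N ->
  subset_avg i K (fun=> x) = x.
Proof.
move=> iK; rewrite /subset_avg sumr_const.
have -> : #|[pred A : {set T} | (A \subset K) && (#|A| == i)]| = 'C(#|K|, i).
  by rewrite -cards_draws cardsE.
by rewrite -[_ *+ _]mulr_natr mulfK // pnatr_eq0 -lt0n bin_gt0.
Qed.

Lemma subset_avgM i K (x : R) psi :
  subset_avg i K (fun A => x * psi A) = x * subset_avg i K psi.
Proof. by rewrite /subset_avg -mulr_sumr mulrA. Qed.

Lemma subset_avgB i K psi psi' :
  subset_avg i K (fun A => psi A - psi' A)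
  = subset_avg i K psi - subset_avg i K psi'.
Proof. by rewrite /subset_avg sumrB mulrBl. Qed.

Lemma subset_avg_sum (J : finType) i K (F : J -> {set T} -> R) :
  subset_avg i K (fun A => \sum_j F j A) = \sum_j subset_avg i K (F j).
Proof. by rewrite /subset_avg exchange_big mulr_suml. Qed.

Lemma subset_avg01 i K psi : (forall A, 0 <= psi A <= 1) ->
  0 <= subset_avg i K psi <= 1.
Proof.
move=> psi01; case: (leqP i #|K|) => [iK|Ki]; last first.
  by rewrite /subset_avg bin_small // invr0 mulr0 lexx ler01.
apply/andP; split.
  rewrite -[X in X <= _](subset_avg_cst 0 iK).
  by apply: le_subset_avg => A _ _; case/andP: (psi01 A).
rewrite -[X in _ <= X](subset_avg_cst 1 iK).
by apply: le_subset_avg => A _ _; case/andP: (psi01 A).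
Qed.

(** The form required by the lemmas on weighted averages: weights on all subsets of [T]. *)
Lemma subset_avg_weights i K psi :
  subset_avg i K psi = \sum_(A : {set T})
    (((A \subset K) && (#|A| == i))%:R / 'C(#|K|, i)%:R) * psi A.
Proof.
rewrite /subset_avg mulr_suml big_mkcond; apply: eq_bigr => A _.
by case: ifP => _; rewrite ?mul0r // mul1r mulrC.
Qed.

Lemma subset_avg_weights_sum1 i K : (i <= #|K|)%N ->
  \sum_(A : {set T}) (((A \subset K) && (#|A| == i))%:R / 'C(#|K|, i)%:R)
    = 1 :> R.
Proof.
move=> iK; rewrite -[RHS](subset_avg_cst 1 iK) subset_avg_weights.
by apply: eq_bigr => A _; rewrite mulr1.
Qed.

Lemma jensen_subset_avg i K psi : (i <= #|K|)%N ->
  expR (subset_avg i K psi) <= subset_avg i K (fun A => expR (psi A)).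
Proof.
move=> iK; rewrite !subset_avg_weights; apply: jensen_expR.
  by move=> A; rewrite divr_ge0.
exact: subset_avg_weights_sum1.
Qed.

Lemma hoeffding_subset_avg i K psi (th : R) : (i <= #|K|)%N ->
  (forall A, 0 <= psi A <= 1) -> `|th| <= 2^-1 ->
  subset_avg i K (fun A => expR (th * (psi A - subset_avg i K psi)))
    <= expR (2 * th ^+ 2).
Proof.
move=> iK psi01 th_le; have := subset_avg01 i K psi01.
rewrite !subset_avg_weights => /andP[m0 m1]; apply: hoeffding_expR => //.
- exact: subset_avg_weights_sum1.
- move=> A; have /andP[a0 a1] := psi01 A; rewrite ler_norml.
  by apply/andP; split; lra.
Qed.

(** Such a [B] is the union of [A] and a subset of [K :\: A] of size [k - #|A|]. *)
Lemma card_between (A K : {set T}) k : A \subset K -> (#|A| <= k)%N ->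
  #|[set B : {set T} | [&& A \subset B, B \subset K & #|B| == k]]|
  = 'C(#|K| - #|A|, k - #|A|).
Proof.
move=> AK Ak; rewrite -[(#|K| - #|A|)%N]cardsDS // -cards_draws.
rewrite -[RHS](card_in_imset (f := fun B => A :|: B)).
  apply: eq_card => B; rewrite !inE; apply/and3P/imsetP.
    case=> AB BK /eqP Bk; exists (B :\: A); last first.
      apply/setP => x; rewrite !inE; by case: (boolP (x \in A)) => [/(subsetP AB)->|].
    by rewrite inE setSD //= cardsDS // Bk.
  case=> B'; rewrite inE subsetD => /andP[/andP[B'K B'A] /eqP B'k] ->.
  rewrite subsetUl subUset AK B'K; split=> //; rewrite cardsU.
  move: B'A; rewrite disjoint_sym => /disjoint_setI0->.
  by rewrite cards0 subn0 B'k subnKC.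
move=> B B'; rewrite !inE !subsetD => /andP[/andP[_ BA] _] /andP[/andP[_ B'A] _] e.
have := congr1 (fun X => X :\: A) e.
rewrite !setDUl setDv !set0U.
by rewrite (setDidPl BA) (setDidPl B'A).
Qed.

(** Double counting: every [i]-subset [A] of [K] lies in the same number ['C(#|K| - i, k - i)] of
    [k]-subsets of [K]. *)
Lemma subset_avg_subset_avg i k K psi : (i <= k)%N -> (k <= #|K|)%N ->
  subset_avg k K (fun B => subset_avg i B psi) = subset_avg i K psi.
Proof.
move=> ik kK; rewrite /subset_avg.
transitivity ((\sum_(A : {set T} | (A \subset K) && (#|A| == i))
   'C(#|K| - i, k - i)%:R * psi A) / ('C(k, i)%:R * 'C(#|K|, k)%:R)).
  rewrite invfM mulrA; congr (_ / _).
  rewrite (eq_bigr (fun B : {set T} => (\sum_(A : {set T} | (A \subset B) && (#|A| == i)) psi A)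
     / 'C(k, i)%:R)); last by move=> B /andP[_ /eqP->].
  rewrite -mulr_suml; congr (_ / _).
  rewrite (exchange_big_dep (fun A : {set T} => (A \subset K) && (#|A| == i))) /=; last first.
    move=> B A /andP[BK _] /andP[AB ->]; rewrite andbT; exact: subset_trans BK.
  apply: eq_bigr => A /andP[AK /eqP Ai]; rewrite sumr_const -[_ *+ _]mulr_natl.
  have := card_between (k := k) AK; rewrite Ai => /(_ ik) <-.
  congr (_%:R * _); rewrite cardsE; apply: eq_card => B.
  by rewrite !unfold_in eqxx andbT [RHS]andbC.
rewrite -mulr_sumr mulrC mulrA [RHS]mulrC; congr (_ * _).
have pos a b : (b <= a)%N -> 'C(a, b)%:R != 0 :> R.
  by move=> ab; rewrite pnatr_eq0 -lt0n bin_gt0.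
have iK := leq_trans ik kK.
rewrite -[LHS]mulrC -[_^-1 in RHS]mul1r; apply/eqP.
rewrite eqr_div ?mulf_neq0 ?pos // mul1r -!natrM eqr_nat; apply/eqP.
have f n : (0 < n`!)%N := fact_gt0 n.
(* Multiplied by [i! (k - i)! (#|K| - k)!], both products of binomial coefficients become
   [#|K|!]. *)
apply/eqP; rewrite -(eqn_pmul2r (f i)) -(eqn_pmul2r (f (k - i)%N)).
rewrite -(eqn_pmul2r (f (#|K| - k)%N)).
have e1 := bin_fact iK; have e2 := bin_fact kK; have e3 := bin_fact ik.
have le4 : (k - i <= #|K| - i)%N by rewrite leq_sub2r.
have e4 := bin_fact le4.
have e5 : (#|K| - i - (k - i) = #|K| - k)%N by rewrite subnBA // subnK.
rewrite e5 in e4.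
have -> : ('C(#|K| - i, k - i) * 'C(#|K|, i) * i`! * (k - i)`! * (#|K| - k)`!
  = 'C(#|K|, i) * (i`! * ('C(#|K| - i, k - i) * ((k - i)`! * (#|K| - k)`!))))%N.
  by ring.
rewrite e4 e1.
have -> : ('C(k, i) * 'C(#|K|, k) * i`! * (k - i)`! * (#|K| - k)`!
  = 'C(#|K|, k) * ('C(k, i) * (i`! * (k - i)`!) * (#|K| - k)`!))%N.
  by ring.
by rewrite e3 e2.
Qed.

End SubsetAverage.

(** Taking images under [w] is a bijection between the [i]-subsets, with inverse
    [B |-> K :&: w @^-1: B]. *)
Lemma subset_avg_imset (R : realType) (T U : finType) (w : T -> U) (K : {set T})
    i (psi : {set U} -> R) : {in K &, injective w} ->
  subset_avg i (w @: K) psi = subset_avg i K (fun A => psi (w @: A)).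
Proof.
move=> w_inj; rewrite /subset_avg card_in_imset //; congr (_ / _).
have imI : {in powerset K &, injective (fun A : {set T} => w @: A)}.
  move=> A B; rewrite !inE => AK BK e; apply/setP => x.
  apply/idP/idP => xA.
    have : w x \in w @: B by rewrite -e imset_f.
    case/imsetP => y yB /w_inj-> //; [exact: subsetP xA | exact: subsetP yB].
  have : w x \in w @: A by rewrite e imset_f.
  case/imsetP => y yB /w_inj-> //; [exact: subsetP xA | exact: subsetP yB].
pose KI := [set A : {set T} | (A \subset K) && (#|A| == i)].
transitivity (\sum_(B in (fun A : {set T} => w @: A) @: KI) psi B).
  apply: eq_bigl => B; apply/andP/imsetP.
    case=> BK /eqP Bi; exists (K :&: w @^-1: B).
      rewrite inE subsetIl /=.
      rewrite -(card_in_imset (f := w)); last first.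
        by move=> x y; rewrite !inE => /andP[xK _] /andP[yK _]; apply: w_inj.
      rewrite -Bi; apply/eqP; congr #|pred_of_set _|; apply/setP => y.
      apply/imsetP/idP => [[x]|yB]; first by rewrite !inE => /andP[_ ?] ->.
      have /imsetP[x xK yE] := subsetP BK _ yB.
      by exists x => //; rewrite !inE xK -yE.
    apply/setP => y; apply/idP/imsetP => [yB|[x]].
      have /imsetP[x xK yE] := subsetP BK _ yB.
      by exists x => //; rewrite !inE xK -yE.
    by rewrite !inE => /andP[_ ?] ->.
  case=> A; rewrite inE => /andP[AK /eqP Ai] ->; split; first exact: imsetS.
  rewrite card_in_imset ?Ai // => x y xA yA; apply: w_inj; exact: (subsetP AK).
rewrite big_imset /=; last first.
  by move=> A B; rewrite !inE => /andP[AK _] /andP[BK _]; apply: imI; rewrite inE.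
by apply: eq_bigl => A; rewrite inE.
Qed.

(** * Random permutations preserving a set *)

Section Stabilizer.
Variables (R : realType) (C : finType).
Implicit Types (K A B X Y : {set C}) (psi : {set C} -> R) (s : {perm C}).

Definition set_stab K : {set {perm C}} := [set s : {perm C} | s @: K == K].

(** List [C] as [A], then the rest of [K], then the complement of [K], and likewise for [B]; the
    permutation matches entries in equal positions. *)
Lemma set_stab_transitive K A B : A \subset K -> B \subset K -> #|A| = #|B| ->
  exists2 s, s \in set_stab K & s @: A = B.
Proof.
move=> AK BK AB.
pose q A := enum A ++ enum (K :\: A) ++ enum (~: K).
have mem_q X : X \subset K -> forall x, x \in q X.
  move=> XK x; rewrite !mem_cat !mem_enum !inE.
  by case: (x \in X) => //=; case: (x \in K).
have size_q X : X \subset K -> size (q X) = (#|K| + #|~: K|)%N.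
  move=> XK; rewrite !size_cat -!cardE addnA; congr (_ + _)%N.
  by rewrite cardsDS // subnKC // subset_leq_card.
have uniq_q X : X \subset K -> uniq (q X).
  move=> XK; rewrite !cat_uniq !enum_uniq /= andbT.
  apply/andP; split; apply/hasPn => x; rewrite ?mem_cat !mem_enum !inE.
    by case/orP => [/andP[]//|]; apply: contra => /(subsetP XK).
  by move/negbTE->; rewrite andbF.
pose f x := nth x (q B) (index x (q A)).
have f_inj : injective f.
  move=> x y; rewrite /f.
  have szx z : (index z (q A) < size (q B))%N.
    by rewrite size_q // -(size_q A) // index_mem mem_q.
  rewrite (set_nth_default y x) // => /eqP.
  rewrite nth_uniq ?uniq_q // => /eqP /(congr1 (nth x (q A))).
  by rewrite !nth_index ?mem_q.
have fA : f @: A \subset B.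
  apply/subsetP => _ /imsetP[x xA ->].
  have ix : (index x (q A) < #|A|)%N.
    by rewrite index_cat mem_enum xA cardE index_mem mem_enum.
  by rewrite /f nth_cat -cardE -AB ix -mem_enum mem_nth // -cardE -AB.
have fK : f @: K \subset K.
  apply/subsetP => _ /imsetP[x xK ->].
  have qE X : q X = (enum X ++ enum (K :\: X)) ++ enum (~: K) by rewrite /q catA.
  have szK X : X \subset K -> size (enum X ++ enum (K :\: X)) = #|K|.
    by move=> XK; rewrite size_cat -!cardE cardsDS // subnKC // subset_leq_card.
  have memK X y : X \subset K -> (y \in enum X ++ enum (K :\: X)) = (y \in K).
    move=> XK; rewrite mem_cat !mem_enum !inE.
    by case: (boolP (y \in X)) => [/(subsetP XK)->|].
  have ix : (index x (q A) < #|K|)%N.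
    by rewrite qE index_cat memK // xK -(szK A) // index_mem memK.
  by rewrite /f qE nth_cat szK // ix -(memK B) // mem_nth // szK.
exists (perm f_inj).
  rewrite inE eqEcard; apply/andP; split.
    apply: subset_trans fK; apply/subsetP => _ /imsetP[x xK ->].
    by rewrite permE imset_f.
  by rewrite card_imset //; apply: perm_inj.
apply/eqP; rewrite eqEcard; apply/andP; split.
  apply: subset_trans fA; apply/subsetP => _ /imsetP[x xA ->].
  by rewrite permE imset_f.
by rewrite card_imset ?AB //; apply: perm_inj.
Qed.

Lemma imset_permM s s' A : (s * s')%g @: A = s' @: (s @: A).
Proof.
by rewrite -imset_comp; apply: eq_imset => x; rewrite permM.
Qed.

(** For a uniform [s] in the stabilizer, [s @: A] is uniform among the subsets of [K] of its size,
    because the fibers of [s |-> s @: A] have equal sizes. *)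
Lemma subset_avg_stab K A psi : A \subset K ->
  subset_avg #|A| K psi
  = (\sum_(s in set_stab K) psi (s @: A)) / #|set_stab K|%:R.
Proof.
move=> AK; pose PA B := (B \subset K) && (#|B| == #|A|).
pose N B := #|[set s in set_stab K | s @: A == B]|.
have sumE phi : \sum_(s in set_stab K) phi (s @: A)
    = \sum_(B | PA B) (N B)%:R * phi B :> R.
  rewrite (partition_big (fun s => s @: A) PA) /=.
    apply: eq_bigr => B _; rewrite (eq_bigr (fun=> phi B)); last first.
      by move=> s /andP[_ /eqP->].
    rewrite sumr_const -[_ *+ _]mulr_natl; congr (_%:R * _).
    by apply: eq_card => s; rewrite [RHS]inE.
  move=> s; rewrite inE => /eqP sK; apply/andP; split.
    by rewrite -sK imsetS.
  by rewrite card_imset //; apply: perm_inj.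
(* Right multiplication by a stabilizing [s] with [s @: A = B] carries the fiber over [A] onto the
   fiber over [B]. *)
have NE B : PA B -> N B = N A.
  case/andP=> BK /eqP BA; have [s sK sA] := set_stab_transitive AK BK (esym BA).
  rewrite /N -[RHS](card_imset _ (mulIg s)); apply: eq_card => t.
  apply/idP/imsetP => [|[u]]; rewrite !inE; last first.
    case/andP=> /eqP uK /eqP uA ->; rewrite !imset_permM uK uA sA eqxx andbT.
    by move: sK; rewrite inE.
  case/andP=> /eqP tK /eqP tA; exists (t * s^-1)%g; last by rewrite mulgKV.
  have sV X : (s^-1)%g @: (s @: X) = X.
    rewrite -imset_permM mulgV; apply/setP => x.
    by apply/imsetP/idP => [[y yX ->]|xX]; [rewrite perm1|exists x; rewrite ?perm1].
  rewrite !inE !imset_permM tK tA -{1}sA sV eqxx andbT.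
  by move: sK; rewrite inE => /eqP sK; rewrite -{1}sK sV.
have NA0 : (N A)%:R != 0 :> R.
  rewrite pnatr_eq0 -lt0n; apply/card_gt0P; exists 1%g; rewrite !inE.
  have i1 X : (1%g : {perm C}) @: X = X.
    by rewrite (eq_imset (g := id)) ?imset_id // => x; rewrite perm1.
  by rewrite !i1 !eqxx.
have stabE : #|set_stab K|%:R = (N A)%:R * 'C(#|K|, #|A|)%:R :> R.
  rewrite -sum1_card natr_sum (sumE (fun=> 1)).
  rewrite (eq_bigr (fun=> (N A)%:R)); last by move=> B /NE->; rewrite mulr1.
  rewrite sumr_const -[_ *+ _]mulr_natr -cards_draws cardsE.
  by congr (_ * _%:R).
have -> : \sum_(s in set_stab K) psi (s @: A)
    = (N A)%:R * \sum_(B | PA B) psi B.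
  by rewrite sumE mulr_sumr; apply: eq_bigr => B /NE->.
by rewrite stabE -mulf_div mulfV // mul1r.
Qed.

Lemma set_stab_gt0 K : 0 < #|set_stab K|%:R :> R.
Proof.
rewrite ltr0n; have [s sK _] := set_stab_transitive (subxx K) (subxx K) erefl.
by apply/card_gt0P; exists s.
Qed.

Lemma set_stab_setT : set_stab [set: C] = [set: {perm C}].
Proof.
apply/setP => s; rewrite !inE eqEsubset subsetT /=; apply/subsetP => x _.
by apply/imsetP; exists ((s^-1)%g x); rewrite ?inE // permKV.
Qed.

(** Each [s @: A j] is a uniform [i]-subset of [K], so [m * subset_avg i K psi] is the mean over [s]
    of the sum of the [psi (s @: A j)]; Jensen's inequality does the rest. *)
Lemma expR_subset_avg_stab K i m (A : 'I_m -> {set C}) psi (th : R) :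
  (forall j, A j \subset K) -> (forall j, #|A j| = i) ->
  expR (m%:R * th * subset_avg i K psi) <=
  (\sum_(s in set_stab K) expR (th * \sum_j psi (s @: A j))) / #|set_stab K|%:R.
Proof.
move=> AK Ai; pose n : R := #|set_stab K|%:R.
have n0 : 0 < n := set_stab_gt0 K.
pose p (s : {perm C}) : R := (s \in set_stab K)%:R / n.
have sumpE (F : {perm C} -> R) :
    (\sum_(s in set_stab K) F s) / n = \sum_s p s * F s.
  rewrite mulr_suml big_mkcond; apply: eq_bigr => s _; rewrite /p.
  by case: ifP => _; rewrite ?mul0r // mul1r mulrC.
rewrite sumpE.
have -> : m%:R * th * subset_avg i K psi
    = \sum_s p s * (th * \sum_j psi (s @: A j)).
  rewrite -sumpE -mulr_sumr exchange_big /=.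
  rewrite (eq_bigr (fun=> subset_avg i K psi * n)) => [|j _]; last first.
    by rewrite -(Ai j) subset_avg_stab // divfK // gt_eqF.
  rewrite sumr_const card_ord -[_ *+ m]mulr_natl; field.
  by rewrite gt_eqF.
apply: jensen_expR => [s|]; first by rewrite divr_ge0 // ltW.
under eq_bigr => s _ do rewrite -[p s]mulr1.
by rewrite -sumpE sumr_const mulfV // gt_eqF.
Qed.

(* Sampling a k-set is dominated, for convex functions, by sampling m
   independent i-sets: extend the union of the i-sets to a k-set K; permutations
   make K uniform and, given K, each i-set uniform in K. *)
Lemma expR_subset_avg_iid i k m psi (th : R) :
  (m * i <= k)%N -> (k <= #|C|)%N -> (i <= #|C|)%N ->
  subset_avg k [set: C] (fun K => expR (m%:R * th * subset_avg i K psi))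
  <= (subset_avg i [set: C] (fun A => expR (th * psi A))) ^+ m.
Proof.
move=> mik kC iC; pose n : R := #|{perm C}|%:R.
have n0 : 0 < n by have := set_stab_gt0 [set: C]; rewrite set_stab_setT cardsT.
set lhs := subset_avg _ _ _.
(* The bound for one fixed tuple; [m * i <= k] leaves room for a [k]-set containing all its
   members. *)
have bound (A : {ffun 'I_m -> {set C}}) : (forall j, #|A j| == i) ->
    lhs <= (\sum_(s : {perm C}) expR (th * \sum_j psi (s @: A j))) / n.
  move=> Ai; have Ai' j : #|A j| = i by apply/eqP.
  have [K KA Kk] : exists2 K : {set C}, \bigcup_j A j \subset K & #|K| = k.
    have cardU : (#|\bigcup_j A j| <= k)%N.
      apply: leq_trans mik; apply: (@leq_trans (\sum_j #|A j|)).
        elim/big_ind2: _ => [|X a Y b Xa Yb|//]; first by rewrite cards0.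
        by apply: leq_trans (leq_card_setU _ _) _; apply: leq_add.
      by rewrite (eq_bigr (fun=> i)) // sum_nat_const card_ord.
    have : (0 < #|[set B : {set C} | [&& \bigcup_j A j \subset B,
        B \subset [set: C] & #|B| == k]]|)%N.
      by rewrite card_between ?subsetT // bin_gt0 cardsT leq_sub2r.
    case/card_gt0P => K; rewrite inE => /and3P[KA _ /eqP Kk]; by exists K.
  have AK j : A j \subset K by apply: subset_trans KA; apply: (bigcup_sup j).
  rewrite /lhs -Kk (subset_avg_stab _ (subsetT K)) set_stab_setT cardsT -/n.
  rewrite ler_pM2r ?invr_gt0 //.
  have -> : \sum_(s in [set: {perm C}])
        expR (m%:R * th * subset_avg i (s @: K) psi)
      = \sum_(s : {perm C}) expR (m%:R * th * subset_avg i K (fun B => psi (s @: B))).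
    apply: eq_big => [s|s _]; first by rewrite inE.
    by rewrite subset_avg_imset // => x y _ _; apply: perm_inj.
  have N0 := set_stab_gt0 K.
  apply: (@le_trans _ _ (\sum_(s : {perm C}) (\sum_(t in set_stab K)
     expR (th * \sum_j psi ((t * s)%g @: A j))) / #|set_stab K|%:R)).
    apply: ler_sum => s _.
    apply: le_trans (expR_subset_avg_stab (fun B => psi (s @: B)) th AK Ai') _.
    rewrite ler_pM2r ?invr_gt0 //; apply: ler_sum => t _.
    by rewrite ler_expR; under eq_bigr => j _ do rewrite -imset_permM.
  rewrite -mulr_suml exchange_big /= ler_pdivrMr // mulr_natr -sumr_const.
  apply: ler_sum => t _.
  by rewrite [leRHS](reindex_inj (mulgI t)).
pose c : R := 'C(#|C|, i)%:R.
have c0 : 0 < c by rewrite ltr0n bin_gt0.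
have prodE (F : {set C} -> R) :
   (\sum_(A : {set C} | #|A| == i) F A) ^+ m
   = \sum_(A : {ffun 'I_m -> {set C}} | [forall j, #|A j| == i]) \prod_j F (A j).
  rewrite -[in LHS](card_ord m) -prodr_const.
  rewrite (bigA_distr_big_dep (fun _ (A : {set C}) => #|A| == i)).
  by apply: eq_bigl => A; apply/familyP/forallP => H j; apply: H.
have cE : c = \sum_(A : {set C} | #|A| == i) 1.
  rewrite sumr_const /c -card_draws cardsE; congr _%:R.
have avgE (F : {set C} -> R) :
    subset_avg i [set: C] F = (\sum_(A : {set C} | #|A| == i) F A) / c.
  by rewrite /subset_avg cardsT; congr (_ / _); apply: eq_bigl => A; rewrite subsetT.
rewrite avgE expr_div_n ler_pdivlMr ?exprn_gt0 //.
have -> : c ^+ m = \sum_(A : {ffun 'I_m -> {set C}} | [forall j, #|A j| == i]) 1.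
  by rewrite cE (prodE (fun=> 1)); apply: eq_bigr => A _; rewrite big1.
rewrite mulr_sumr; under eq_bigr => A _ do rewrite mulr1.
(* Sum the bound over all [c ^+ m] tuples. For fixed [s], replacing each [A] by [s @: A] removes
   [s], and the sum over tuples factors into an [m]-th power. *)
apply: (@le_trans _ _ (\sum_(A : {ffun 'I_m -> {set C}} | [forall j, #|A j| == i])
   (\sum_(s : {perm C}) expR (th * \sum_j psi (s @: A j))) / n)).
  by apply: ler_sum => A /forallP; apply: bound.
rewrite -mulr_suml exchange_big /= ler_pdivrMr // mulr_natr -sumr_const.
apply: ler_sum => s _.
rewrite (reindex_inj (h := fun A : {set C} => s @: A)) /=; last first.
  by apply: imset_inj; apply: perm_inj.
rewrite (eq_bigl (fun A : {set C} => #|A| == i)); last first.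
  by move=> A; rewrite card_imset //; apply: perm_inj.
rewrite prodE; apply: ler_sum => A _.
by rewrite mulr_sumr expR_sum.
Qed.

End Stabilizer.

(** * Quasi-independent families of random variables *)

Section QuasiIndependence.
Variables (R : realType) (C V : finType) (P : {ffun C -> V} -> R).
Hypothesis P_ge0 : forall w, 0 <= P w.
Implicit Types (I A B D : {set C}) (x w : {ffun C -> V}) (g G h : {ffun C -> V} -> R).

Definition agree I w x := [forall c in I, w c == x c].
Definition cond_mass I x h := \sum_(w | agree I w x) P w * h w.
(** For a conditioning event of mass zero this is 0, so covariances vanish there ([cond_cov0]) and
    bounds can be stated for every [x]. *)
Definition cond_exp I x h := cond_mass I x h / cond_mass I x (fun=> 1).
Definition cond_cov I x g G :=
  cond_exp I x (fun w => g w * G w) - cond_exp I x g * cond_exp I x G.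
(** Conditioning on [x] over [I] and on the value [v] at a further coordinate [a] is conditioning on
    [reset x a v] over [a |: I]; see [agree_reset]. *)
Definition reset x (a : C) (v : V) : {ffun C -> V} :=
  [ffun c => if c == a then v else x c].
Definition depends_on I h := forall w w', agree I w w' -> h w = h w'.

Lemma agreeP I w x : reflect {in I, w =1 x} (agree I w x).
Proof.
apply: (iffP forall_inP) => [H c /H /eqP //|H c cI]; apply/eqP; exact: H.
Qed.

Lemma agree_reset I a w x v : a \notin I ->
  agree (a |: I) w (reset x a v) = agree I w x && (w a == v).
Proof.
move=> aI; apply/agreeP/andP => [H|[/agreeP H /eqP wa] c].
  split; last by rewrite H ?setU11 // ffunE eqxx.
  apply/agreeP => c cI; rewrite H ?inE ?cI ?orbT // ffunE.
  by case: eqP => // ca; rewrite -ca cI in aI.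
rewrite !inE ffunE; case: eqP => [-> //|_ /=]; exact: H.
Qed.

Lemma eq_cond_exp I x h h' : (forall w, agree I w x -> h w = h' w) ->
  cond_exp I x h = cond_exp I x h'.
Proof. by move=> e; congr (_ / _); apply: eq_bigr => w /e->. Qed.

Lemma cond_mass_reset I a x h : a \notin I ->
  cond_mass I x h = \sum_v cond_mass (a |: I) (reset x a v) h.
Proof.
move=> aI; rewrite /cond_mass (partition_big (fun w : {ffun C -> V} => w a) predT) //=.
apply: eq_bigr => v _; apply: eq_bigl => w; by rewrite agree_reset.
Qed.

Lemma cond_mass1_ge0 I x : 0 <= cond_mass I x (fun=> 1).
Proof. by apply: sumr_ge0 => w _; rewrite mulr1. Qed.

Lemma cond_mass0 I x h : cond_mass I x (fun=> 1) = 0 -> cond_mass I x h = 0.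
Proof.
move=> /psumr_eq0P H; apply: big1 => w wx.
by have := H _ w wx; rewrite mulr1 => -> //; rewrite ?mul0r // => ? _; rewrite mulr1.
Qed.

Lemma cond_exp_tower I a x h : a \notin I ->
  cond_exp I x h = \sum_v (cond_mass (a |: I) (reset x a v) (fun=> 1)
    / cond_mass I x (fun=> 1)) * cond_exp (a |: I) (reset x a v) h.
Proof.
move=> aI; rewrite /cond_exp (cond_mass_reset x h aI) mulr_suml.
apply: eq_bigr => v _; set M := cond_mass _ _ (fun=> 1).
have [M0|M0] := eqVneq (cond_mass (a |: I) (reset x a v) (fun=> 1)) 0.
  by rewrite M0 (cond_mass0 h M0) !mul0r.
by rewrite [RHS]mulrAC mulrCA mulfV // mulr1.
Qed.

Lemma cond_weights_sum1 I a x : a \notin I -> cond_mass I x (fun=> 1) != 0 ->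
  \sum_v (cond_mass (a |: I) (reset x a v) (fun=> 1)
    / cond_mass I x (fun=> 1)) = 1.
Proof. by move=> aI M0; rewrite -mulr_suml -cond_mass_reset // mulfV. Qed.

Lemma cond_expM I x g (r : R) : cond_exp I x (fun w => r * g w) = r * cond_exp I x g.
Proof.
by rewrite /cond_exp mulrA; congr (_ / _); rewrite mulr_sumr; apply: eq_bigr => w _; ring.
Qed.

Lemma cond_cov0 I x g G : cond_mass I x (fun=> 1) = 0 -> cond_cov I x g G = 0.
Proof. by move=> M0; rewrite /cond_cov /cond_exp !(cond_mass0 _ M0) !mul0r subrr. Qed.

(** The base case of the peeling inductions, where one of the functions has no free coordinate
    left. *)
Lemma cond_cov_cst I x g G (r : R) : (forall w, agree I w x -> g w = r) ->
  cond_cov I x g G = 0.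
Proof.
move=> gr; have [M0|M0] := eqVneq (cond_mass I x (fun=> 1)) 0; first exact: cond_cov0.
rewrite /cond_cov (@eq_cond_exp I x _ (fun w => r * G w)) => [|w /gr-> //].
rewrite (@eq_cond_exp I x g (fun w => r * 1)) => [|w /gr->]; last by rewrite mulr1.
by rewrite !cond_expM /cond_exp mulfV // mulr1 subrr.
Qed.

Lemma cond_covC I x g G : cond_cov I x g G = cond_cov I x G g.
Proof.
rewrite /cond_cov [_ * cond_exp I x G]mulrC; congr (_ - _).
by apply: eq_cond_exp => w _; rewrite mulrC.
Qed.

Lemma cond_exp_norm_le I x g : (forall w, `|g w| <= 1) -> `|cond_exp I x g| <= 1.
Proof.
move=> g1; have [M0|M0] := eqVneq (cond_mass I x (fun=> 1)) 0.
  by rewrite /cond_exp (cond_mass0 _ M0) mul0r normr0.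
have Mp : 0 < cond_mass I x (fun=> 1) by rewrite lt_def M0 cond_mass1_ge0.
rewrite normrM normfV [X in _ / X]ger0_norm ?cond_mass1_ge0 // ler_pdivrMr // mul1r.
apply: le_trans (ler_norm_sum _ _ _) _; apply: ler_sum => w _.
by rewrite normrM ger0_norm // ler_wpM2l.
Qed.

(** Law of total covariance for revealing the coordinate [a]. As [g'] is constant once [a] is
    revealed, replacing [G] too by its conditional expectation would not change the last term. *)
Lemma cond_cov_total I a x g G (g' := fun w => cond_exp (a |: I) (reset x a (w a)) g) :
  a \notin I ->
  cond_cov I x g G = \sum_v (cond_mass (a |: I) (reset x a v) (fun=> 1)
    / cond_mass I x (fun=> 1)) * cond_cov (a |: I) (reset x a v) g G
    + cond_cov I x g' G.
Proof.
move=> aI; rewrite /cond_cov.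
have e v h : cond_exp (a |: I) (reset x a v) (fun w => g' w * h w)
    = cond_exp (a |: I) (reset x a v) g * cond_exp (a |: I) (reset x a v) h.
  rewrite -cond_expM; apply: eq_cond_exp => w.
  by rewrite agree_reset // => /andP[_ /eqP wa]; rewrite /g' wa.
rewrite [cond_exp I x (fun w => g' w * G w)](cond_exp_tower _ _ aI).
under [X in _ = _ + (X - _)]eq_bigr => v _ do rewrite e.
have -> : cond_exp I x g' = cond_exp I x g.
  rewrite !(cond_exp_tower _ _ aI); apply: eq_bigr => v _.
  have [M0|M0] := eqVneq (cond_mass (a |: I) (reset x a v) (fun=> 1)) 0.
    by rewrite M0 !mul0r.
  congr (_ * _); rewrite -[LHS](eq_cond_exp (h := fun w => g' w * 1)).
    by rewrite e /cond_exp mulfV // mulr1.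
  by move=> w _; rewrite mulr1.
rewrite addrA; congr (_ - _).
rewrite [LHS](cond_exp_tower _ _ aI) -big_split; apply: eq_bigr => v _ /=.
by rewrite -mulrDr subrK.
Qed.

(** In the law of total covariance the conditional covariances are averaged, which costs at most
    [d1], and [g'] is a function of the coordinate [a] alone with values in [[-1, 1]], which costs
    [d2]. *)
Lemma cond_cov_peel I a x g G (d1 d2 : R) : 0 <= d1 -> a \notin I ->
  (forall w, `|g w| <= 1) ->
  (forall v, `|cond_cov (a |: I) (reset x a v) g G| <= d1) ->
  (forall al : V -> R, (forall v, `|al v| <= 1) ->
     `|cond_cov I x (fun w => al (w a)) G| <= d2) ->
  `|cond_cov I x g G| <= d1 + d2.
Proof.
move=> d1_ge0 aI g1 H1 H2.
have [M0|M0] := eqVneq (cond_mass I x (fun=> 1)) 0.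
  rewrite cond_cov0 // normr0 addr_ge0 //.
  by apply: le_trans (H2 (fun=> 0) _) => // v; rewrite normr0.
rewrite (cond_cov_total _ _ _ aI); apply: le_trans (ler_normD _ _) _.
apply: lerD; last first.
  by apply: (H2 (fun v => cond_exp (a |: I) (reset x a v) g)) => v; apply: cond_exp_norm_le.
apply: le_trans (ler_norm_sum _ _ _) _.
rewrite -[leRHS]mul1r -[X in _ <= X * _](cond_weights_sum1 aI M0) mulr_suml.
apply: ler_sum => v _.
have p0 : 0 <= cond_mass (a |: I) (reset x a v) (fun=> 1)
    / cond_mass I x (fun=> 1) by apply: divr_ge0; apply: cond_mass1_ge0.
by rewrite normrM (ger0_norm p0) ler_wpM2l.
Qed.

Variables (n : nat) (gam : R).
Hypothesis gam_ge0 : 0 <= gam.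

(** Only pairs of coordinates are controlled, but after conditioning on others; the count [#|I|.+2]
    includes the pair itself. *)
Definition quasi_independent := forall I x a b (al be : V -> R),
  a \notin I -> b \notin I -> a != b -> (#|I|.+2 <= n)%N ->
  (forall v, `|al v| <= 1) -> (forall v, `|be v| <= 1) ->
  `|cond_cov I x (fun w => al (w a)) (fun w => be (w b))| <= gam.

Hypothesis P_quasi : quasi_independent.

(** Coordinates of [B] are peeled off [G] one at a time, each at cost [gam]. *)
Lemma cond_cov_coord_le I x a B al G :
  a \notin I -> a \notin B -> [disjoint B & I] -> (#|I| + #|B| < n)%N ->
  (forall v, `|al v| <= 1) -> (forall w, `|G w| <= 1) -> depends_on (B :|: I) G ->
  `|cond_cov I x (fun w => al (w a)) G| <= #|B|%:R * gam.
Proof.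
have [m Bm] : exists m, #|B| = m by exists #|B|.
rewrite Bm; elim: m B Bm I x => [|m IH] B Bm I x aI aB BI In al1 G1 Gdep.
  rewrite cond_covC (@cond_cov_cst I x G _ (G x)) ?normr0 ?mul0r // => w wx.
  by apply: Gdep; move: Bm => /eqP; rewrite cards_eq0 => /eqP->; rewrite set0U.
have [b bB] : exists b, b \in B by apply/card_gt0P; rewrite Bm.
have bI : b \notin I by rewrite (disjointFr BI).
have ab : a != b by apply: contraNneq aB => ->.
have Bb : #|B :\ b| = m by have := cardsD1 b B; rewrite bB Bm => -[].
(* Peeling acts on the first argument, so [G] is moved there by symmetry. *)
rewrite -natr1 mulrDl mul1r cond_covC.
apply: (@cond_cov_peel I b) => //; first by rewrite mulr_ge0.
- move=> v; rewrite cond_covC; apply: (IH (B :\ b)) => //.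
  + by rewrite !inE negb_or ab.
  + by rewrite !inE (negbTE aB) andbF.
  + rewrite disjoint_sym disjoints_subset; apply/subsetP => c; rewrite !inE negb_and negbK.
    case/orP => [->//|cI]; by rewrite (disjointFl BI) // orbT.
  + by rewrite cardsU1 bI addnAC addnC add1n.
  + move=> w w' /agreeP H; apply: Gdep; apply/agreeP => c cBI; apply: H.
    move: cBI; rewrite !inE; by case: (c == b); case: (c \in B).
- move=> be be1; rewrite cond_covC; apply: P_quasi => //.
  by apply: leq_trans In; rewrite addnS !ltnS leq_addr.
Qed.

(** Coordinates of [A] are peeled off [g]; each leaves a function of one coordinate against [G], at
    cost [#|B| * gam] by the previous lemma. *)
Lemma cond_cov_le I x A B g G :
  [disjoint A & I] -> [disjoint B & I] -> [disjoint A & B] ->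
  (#|I| + #|A| + #|B| <= n)%N ->
  (forall w, `|g w| <= 1) -> (forall w, `|G w| <= 1) ->
  depends_on (A :|: I) g -> depends_on (B :|: I) G ->
  `|cond_cov I x g G| <= #|A|%:R * (#|B|%:R * gam).
Proof.
have [m Am] : exists m, #|A| = m by exists #|A|.
rewrite Am; elim: m A Am I x => [|m IH] A Am I x AI BI AB In g1 G1 gdep Gdep.
  rewrite (@cond_cov_cst I x g _ (g x)) ?normr0 ?mul0r // => w wx.
  by apply: gdep; move: Am => /eqP; rewrite cards_eq0 => /eqP->; rewrite set0U.
have [a aA] : exists a, a \in A by apply/card_gt0P; rewrite Am.
have aI : a \notin I by rewrite (disjointFr AI).
have aB : a \notin B by rewrite (disjointFr AB).
have Aa : #|A :\ a| = m by have := cardsD1 a A; rewrite aA Am => -[].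
rewrite -natr1 mulrDl mul1r.
apply: (@cond_cov_peel I a) => //; first by rewrite !mulr_ge0.
- move=> v; apply: (IH (A :\ a)) => //.
  + rewrite disjoint_sym disjoints_subset; apply/subsetP => c; rewrite !inE negb_and negbK.
    case/orP => [->//|cI]; by rewrite (disjointFl AI) // orbT.
  + rewrite disjoint_sym disjoints_subset; apply/subsetP => c; rewrite !inE.
    case/orP => [/eqP->//|cI]; by rewrite (disjointFl BI).
  + by apply: disjointWl AB; apply: subsetDl.
  + by rewrite cardsU1 aI -[(true + _)%N]/(#|I|.+1) addSnnS.
  + move=> w w' /agreeP H; apply: gdep; apply/agreeP => c cAI; apply: H.
    move: cAI; rewrite !inE; by case: (c == a); case: (c \in A).
  + move=> w w' /agreeP H; apply: Gdep; apply/agreeP => c cBI; apply: H.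
    move: cBI; rewrite !inE; by case: (c == a); case: (c \in B).
- move=> al al1; apply: cond_cov_coord_le => //.
  by apply: leq_trans In; rewrite addnS addSn ltnS leq_add2r leq_addr.
Qed.

Hypothesis P_sum1 : \sum_w P w = 1.

Definition expect h := \sum_w P w * h w.

Lemma le_expect h h' : (forall w, h w <= h' w) -> expect h <= expect h'.
Proof. by move=> H; apply: ler_sum => w _; rewrite ler_wpM2l. Qed.

Lemma expect_ge0 h : (forall w, 0 <= h w) -> 0 <= expect h.
Proof. by move=> H; apply: sumr_ge0 => w _; rewrite mulr_ge0. Qed.

Lemma expectM (r : R) h : expect (fun w => r * h w) = r * expect h.
Proof. by rewrite /expect mulr_sumr; apply: eq_bigr => w _; rewrite mulrCA. Qed.

(** The covariance bound with nothing conditioned on, for [g] and [G] rescaled to be bounded by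
    1. *)
Lemma expect_mul_le A B g G (a b : R) : 0 < a -> 0 < b ->
  [disjoint A & B] -> (#|A| + #|B| <= n)%N ->
  (forall w, `|g w| <= a) -> (forall w, `|G w| <= b) ->
  depends_on A g -> depends_on B G ->
  expect (fun w => g w * G w) <= expect g * expect G + #|A|%:R * #|B|%:R * gam * a * b.
Proof.
move=> a0 b0 AB ABn ga Gb gA GB.
(* Conditioning on no coordinate still requires some [x]; one exists because the total mass is 1. *)
have [x _] : exists x : {ffun C -> V}, x \in predT.
  apply/card_gt0P; rewrite lt0n; apply/negP => /eqP/card0_eq c0.
  move: P_sum1; rewrite big_pred0 => [/esym/eqP|w]; first by rewrite oner_eq0.
  by have := c0 w; rewrite inE.
have ag w : agree set0 w x by apply/agreeP => c; rewrite inE.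
have cE h : cond_exp set0 x h = expect h.
  rewrite /cond_exp /cond_mass (eq_bigl predT) //.
  rewrite [X in _ / X](eq_bigl predT) //.
  by under [X in _ / X]eq_bigr => w _ do rewrite mulr1; rewrite P_sum1 divr1.
have := @cond_cov_le set0 x A B (fun w => a^-1 * g w) (fun w => b^-1 * G w).
have dis0 D : [disjoint D & set0] by rewrite disjoints_subset setC0 subsetT.
rewrite cards0 !setU0 => /(_ (dis0 A) (dis0 B) AB ABn).
have sc r h : 0 < r -> (forall w, `|h w| <= r) -> forall w, `|r^-1 * h w| <= 1.
  move=> r0 hr w; rewrite normrM gtr0_norm ?invr_gt0 //.
  by rewrite mulrC ler_pdivrMr // mul1r.
move=> /(_ (sc _ _ a0 ga) (sc _ _ b0 Gb)).
have H1 : depends_on A (fun w => a^-1 * g w) by move=> w w' /gA->.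
have H2 : depends_on B (fun w => b^-1 * G w) by move=> w w' /GB->.
move=> /(_ H1 H2); rewrite /cond_cov !cE !expectM.
have -> : expect (fun w => a^-1 * g w * (b^-1 * G w))
    = a^-1 * b^-1 * expect (fun w => g w * G w).
  by rewrite -expectM; apply: eq_bigr => w _; ring.
move=> /(le_trans (ler_norm _)).
have -> : a^-1 * b^-1 * expect (fun w => g w * G w)
    - a^-1 * expect g * (b^-1 * expect G)
   = (expect (fun w => g w * G w) - expect g * expect G) / (a * b).
  by field; rewrite !gt_eqF.
rewrite ler_pdivrMr ?mulr_gt0 // lerBlDl.
by rewrite !mulrA.
Qed.

(** Factors are multiplied in one at a time. The product of the first [l] depends only on the union
    of their blocks and is bounded by [b ^+ l], so it is almost uncorrelated with the next
    factor. *)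
Lemma expect_prod_le i m (A : 'I_m -> {set C}) (g : 'I_m -> {ffun C -> V} -> R)
    (e b : R) :
  (forall j, #|A j| = i) -> (forall j j', j != j' -> [disjoint A j & A j']) ->
  (m * i <= n)%N -> 1 <= e -> 1 <= b ->
  (forall j w, 0 <= g j w <= b) -> (forall j, depends_on (A j) (g j)) ->
  (forall j, expect (g j) <= e) ->
  expect (fun w => \prod_j g j w)
    <= e ^+ m * (1 + m%:R * ((m * i) ^ 2)%:R * gam * b ^+ m).
Proof.
move=> Ai Adis min e1 b1 g0b gdep ge.
have e0 : 0 <= e by lra.
have b0 : 0 < b by lra.
(* Bounds the error of any single step: both coordinate sets have at most [m * i] elements, and the
   sup norms multiply to at most [b ^+ m]. *)
pose d := ((m * i) ^ 2)%:R * gam * b ^+ m.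
have d0 : 0 <= d by rewrite !mulr_ge0 // exprn_ge0 // ltW.
suff H l : (l <= m)%N -> expect (fun w => \prod_(j < m | (j < l)%N) g j w)
    <= e ^+ l * (1 + l%:R * d).
  have := H m (leqnn m); rewrite /d !mulrA; apply: le_trans.
  rewrite le_eqVlt; apply/orP; left; apply/eqP; apply: eq_bigr => w _.
  by congr (_ * _); apply: eq_bigl => j; rewrite ltn_ord.
elim: l => [_|l IH lm].
  rewrite expr0 mul0r addr0 mulr1 -[leRHS]P_sum1 le_eqVlt; apply/orP; left; apply/eqP.
  by apply: eq_bigr => w _; rewrite big1 ?mulr1.
pose jl := Ordinal lm; pose G w := \prod_(j < m | (j < l)%N) g j w.
have -> : expect (fun w => \prod_(j < m | (j < l.+1)%N) g j w)
    = expect (fun w => g jl w * G w).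
  apply: eq_bigr => w _; congr (_ * _); rewrite (bigD1 jl) //=; congr (_ * _).
  apply: eq_bigl => j; rewrite ltnS -val_eqE /= andbC ltn_neqAle //.
pose B := \bigcup_(j < m | (j < l)%N) A j.
have G0 w : 0 <= G w by apply: prodr_ge0 => j _; case/andP: (g0b j w).
have Gb w : G w <= b ^+ l.
  apply: (@le_trans _ _ (\prod_(j < m | (j < l)%N) b)).
    by apply: ler_prod => j _; apply: g0b.
  by rewrite -(big_ord_widen _ (fun=> b) (ltnW lm)) prodr_const card_ord.
have cardB : (#|B| <= l * i)%N.
  apply: (@leq_trans (\sum_(j < m | (j < l)%N) #|A j|)%N).
    rewrite /B; elim/big_ind2: _ => [|X a Y c Xa Yc|//]; first by rewrite cards0.
    by apply: leq_trans (leq_card_setU _ _) _; apply: leq_add.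
  rewrite (eq_bigr (fun=> i)) // -(big_ord_widen _ (fun=> i) (ltnW lm)).
  by rewrite sum_nat_const card_ord.
have lmi : (i + l * i <= m * i)%N by rewrite -mulSn leq_mul2r lm orbT.
have := @expect_mul_le (A jl) B (g jl) G b (b ^+ l) b0.
rewrite exprn_gt0 // => /(_ isT) H.
apply: le_trans (H _ _ _ _ _ _) _.
- rewrite disjoint_sym disjoints_subset; apply/bigcupsP => j jl'.
  rewrite -disjoints_subset; apply: Adis; apply: contraTneq jl' => ->.
  by rewrite ltnn.
- rewrite Ai; apply: leq_trans min; apply: leq_trans lmi; by rewrite leq_add2l.
- by move=> w; have /andP[? ?] := g0b jl w; rewrite ger0_norm.
- by move=> w; rewrite ger0_norm.
- exact: gdep.
- move=> w w' /agreeP ww'; apply: eq_bigr => j jl'; apply: gdep; apply/agreeP => c cA.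
  by apply: ww'; apply/bigcupP; exists j.
rewrite -[l.+1%:R]natr1.
have IH' := IH (ltnW lm).
have X0 : 0 <= expect G by apply: expect_ge0.
apply: (@le_trans _ _ (e * (e ^+ l * (1 + l%:R * d)) + d)).
  apply: lerD.
    apply: ler_pM => //; apply: expect_ge0 => w; by case/andP: (g0b jl w).
  rewrite /d -mulrA -exprS; apply: ler_pM.
  + by rewrite !mulr_ge0.
  + by rewrite exprn_ge0 // ltW.
  + apply: ler_wpM2r => //; rewrite -natrM ler_nat Ai expnS expn1.
    apply: leq_mul; first by apply: leq_trans lmi; apply: leq_addr.
    by apply: leq_trans cardB _; apply: leq_trans lmi; apply: leq_addl.
  + by rewrite ler_weXn2l.
(* As [e >= 1], the new error [d] may be multiplied by [e ^+ l.+1] to restore the shape of the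
   bound. *)
have -> : e ^+ l.+1 * (1 + (l%:R + 1) * d)
    = e * (e ^+ l * (1 + l%:R * d)) + e ^+ l.+1 * d by rewrite exprS; ring.
by rewrite lerD2l ler_peMl // exprn_ege1.
Qed.

End QuasiIndependence.

(** The blocks are consecutive runs of length [i] in the enumeration of [K]; dividing a position by
    [i] recovers its block. *)
Lemma disjoint_blocks (C : finType) (K : {set C}) i m : (m * i <= #|K|)%N ->
  exists A : 'I_m -> {set C},
    [/\ forall j, A j \subset K, forall j, #|A j| = i &
        forall j j', j != j' -> [disjoint A j & A j']].
Proof.
move=> miK.
have lt (j : 'I_m) (r : 'I_i) : (j * i + r < #|K|)%N.
  apply: leq_trans miK; apply: (@leq_trans (j.+1 * i)).
    by rewrite mulSn addnC ltn_add2r.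
  by rewrite leq_mul2r ltn_ord orbT.
exists (fun j => [set enum_val (Ordinal (lt j r)) | r : 'I_i]); split.
- by move=> j; apply/subsetP => _ /imsetP[r _ ->]; apply: enum_valP.
- move=> j; rewrite card_imset ?card_ord // => r r' /enum_val_inj /(congr1 val) /=.
  by move/addnI/val_inj.
- move=> j j' jj'; apply/pred0P => x /=; apply/negP => /andP[].
  case/imsetP => r _ -> /imsetP[r' _] /enum_val_inj /(congr1 val) /= e.
  have i0 : (0 < i)%N by apply: leq_ltn_trans (ltn_ord r).
  have := congr1 (fun x => x %/ i)%N e.
  by rewrite !divnMDl // !divn_small // !addn0 => /val_inj; apply/eqP.
Qed.

(** * Moment generating functions under quasi-independence *)

Section QuasiIndependentConcentration.
Variables (R : realType) (C V : finType) (P : {ffun C -> V} -> R).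
Hypothesis P_ge0 : forall w, 0 <= P w.
Hypothesis P_sum1 : \sum_w P w = 1.
Variables (n : nat) (gam : R).
Hypothesis gam_ge0 : 0 <= gam.
Hypothesis P_quasi : quasi_independent P n gam.

Lemma expect01 (h : {ffun C -> V} -> R) : (forall w, 0 <= h w <= 1) ->
  0 <= expect P h <= 1.
Proof.
move=> h01; apply/andP; split.
  by apply: expect_ge0 => // w; case/andP: (h01 w).
rewrite -[leRHS]P_sum1; apply: ler_sum => w _.
by rewrite ler_piMr //; case/andP: (h01 w).
Qed.

(** The error factor of [expect_prod_le] when the factors are bounded by the exponential of the
    absolute value of [th]. *)
Definition mgf_error (m i : nat) (th : R) :=
  1 + m%:R * ((m * i) ^ 2)%:R * gam * expR `|th| ^+ m.

Lemma mgf_error_ge0 m i th : 0 <= mgf_error m i th.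
Proof. by rewrite addr_ge0 // !mulr_ge0 // exprn_ge0 // expR_ge0. Qed.

(** Jensen's inequality over the images of disjoint blocks under the stabilizer of [K] leaves a
    product over blocks, and Hoeffding's bound controls each factor. Each [h A] is centered at its
    own mean, which may vary with [A]. *)
Lemma expect_expR_subset_avg_le (K : {set C}) i m
    (h : {set C} -> {ffun C -> V} -> R) (th : R) :
  (m * i <= #|K|)%N -> (#|K| <= n)%N -> (forall A w, 0 <= h A w <= 1) ->
  (forall A, depends_on A (h A)) -> `|th| <= 2^-1 ->
  expect P (fun w => expR (m%:R * th *
      subset_avg i K (fun A => h A w - expect P (h A))))
  <= expR (2 * th ^+ 2) ^+ m * mgf_error m i th.
Proof.
move=> miK Kn h01 hdep th_le.
have [A [AK Ai Adis]] := disjoint_blocks miK.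
pose N : R := #|set_stab K|%:R; have N0 : 0 < N := set_stab_gt0 R K.
pose g (s : {perm C}) (j : 'I_m) w :=
  expR (th * (h (s @: A j) w - expect P (h (s @: A j)))).
apply: (@le_trans _ _ ((\sum_(s in set_stab K)
    expect P (fun w => \prod_j g s j w)) / N)).
  rewrite mulr_suml (eq_bigr (fun s => expect P (fun w => N^-1 * \prod_j g s j w)));
    last by move=> s _; rewrite expectM mulrC.
  rewrite exchange_big /=; apply: ler_sum => w _; rewrite -mulr_sumr ler_wpM2l //.
  apply: le_trans (expR_subset_avg_stab _ th AK Ai) _.
  rewrite -mulr_sumr mulrC ler_pM2l ?invr_gt0 //; apply: ler_sum => s _.
  by rewrite mulr_sumr expR_sum.
rewrite ler_pdivrMr // /N mulr_natr -sumr_const.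
apply: ler_sum => s _.
have sI : injective s := @perm_inj _ s.
apply: (@expect_prod_le _ _ _ _ P_ge0 n gam gam_ge0 P_quasi P_sum1 i m
  (fun j => s @: A j)).
- by move=> j; rewrite card_imset.
- by move=> j j' /Adis; rewrite -!setI_eq0 -imsetI; [move/eqP->; rewrite imset0 | move=> ? ? _ _; apply: sI].
- exact: leq_trans Kn.
- by rewrite -expR0 ler_expR mulr_ge0 ?sqr_ge0.
- by rewrite -expR0 ler_expR.
- move=> j w; rewrite expR_ge0 ler_expR /=.
  have /andP[a0 a1] := h01 (s @: A j) w.
  have /andP[b0 b1] := expect01 (h01 (s @: A j)).
  apply: le_trans (ler_norm _) _; rewrite normrM ler_piMr // ler_norml.
  by apply/andP; split; lra.
- by move=> j w w' ww'; rewrite /g (hdep _ _ _ ww').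
- move=> j; apply: hoeffding_expR => // w.
  have /andP[a0 a1] := h01 (s @: A j) w.
  have /andP[b0 b1] := expect01 (h01 (s @: A j)).
  by rewrite ler_norml; apply/andP; split; rewrite /expect in b0 b1 *; lra.
Qed.

End QuasiIndependentConcentration.

(** * Complexes as images of families of random vertices *)

Section Complex.
Variables (R : realType) (V : finType).
Implicit Types (pi : {set V} -> R) (S s t : {set V}) (f Phi : {set V} -> R).

Lemma complex_card d pi S : is_complex d pi -> pi S != 0 -> #|S| = d.
Proof.
by case=> pi0 [pid _] S0; apply: pid; rewrite lt_def S0 pi0.
Qed.

Lemma sum_pijE d pi k Phi : is_complex d pi ->
  \sum_s pij d pi k s * Phi s = \sum_S pi S * subset_avg k S Phi.
Proof.
move=> pic; transitivity (\sum_(S : {set V}) \sum_(s : {set V} | (s \subset S) && (#|s| == k))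
    pi S * Phi s / 'C(d, k)%:R).
  rewrite (exchange_big_dep predT) //=; apply: eq_bigr => s _; rewrite /pij.
  case: ifP => _; last by rewrite mul0r big_pred0 // => S; rewrite andbF.
  rewrite !mulr_suml; apply: eq_big => [S|S _]; first by rewrite andbT.
  by rewrite mulrAC.
apply: eq_bigr => S _; have [->|S0] := eqVneq (pi S) 0.
  by rewrite mul0r big1 // => s _; rewrite !mul0r.
rewrite /subset_avg (complex_card pic S0) mulrA mulr_sumr mulr_suml.
by apply: eq_bigr.
Qed.

(** Choosing a [d]-subset of a top face and then a [k]-subset of it is choosing a [k]-subset
    directly. *)
Lemma sum_pij_skeleton D piY d pi k Phi : is_skeleton d pi D piY ->
  is_complex d pi -> (k <= d)%N ->
  \sum_s pij d pi k s * Phi s = \sum_s pij D piY k s * Phi s.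
Proof.
case=> piYc [dD piE] pic kd; rewrite sum_pijE //.
under eq_bigr => S _ do rewrite piE.
rewrite !sum_pijE //; apply: eq_bigr => S _.
have [->|S0] := eqVneq (piY S) 0; first by rewrite !mul0r.
by rewrite subset_avg_subset_avg // (complex_card piYc S0).
Qed.

Definition face_mean d pi i f := \sum_t pij d pi i t * f t.

Definition mgf d pi k i (lam : R) f :=
  \sum_s pij d pi k s * expR (lam * (subset_avg i s f - face_mean d pi i f)).

Variables (C : finType) (P : {ffun C -> V} -> R).

(* [P] is the law of a family of vertices indexed by [C] whose values form the
   random top face. *)
Definition realizes (pi : {set V} -> R) :=
  [/\ forall w, 0 <= P w,
      forall w : {ffun C -> V}, P w != 0 -> injective w &
      forall Phi : {set V} -> R,
        \sum_S pi S * Phi S = expect P (fun w : {ffun C -> V} => Phi (w @: [set: C]))].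

Lemma realizes_sum1 pi : \sum_S pi S = 1 -> realizes pi -> \sum_w P w = 1.
Proof.
move=> pi1 [_ _ push]; have := push (fun=> 1).
rewrite /expect; under eq_bigr => S _ do rewrite mulr1.
by rewrite pi1; under eq_bigr => w _ do rewrite mulr1.
Qed.

Lemma realizes_subset_avg pi k Phi : realizes pi ->
  \sum_S pi S * subset_avg k S Phi
  = expect P (fun w => subset_avg k [set: C] (fun K => Phi (w @: K))).
Proof.
case=> _ Pinj push; rewrite push; apply: eq_bigr => w _.
have [->|w0] := eqVneq (P w) 0; first by rewrite !mul0r.
by rewrite subset_avg_imset // => c c' _ _; apply: Pinj.
Qed.

Lemma expect_subset_avg k (K : {set C}) (F : {ffun C -> V} -> {set C} -> R) :
  expect P (fun w => subset_avg k K (F w))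
  = subset_avg k K (fun A => expect P (fun w => F w A)).
Proof.
rewrite subset_avg_sum; apply: eq_bigr => w _.
by rewrite subset_avgM.
Qed.

Lemma mgf_expect pi k i lam f : is_complex #|C| pi -> realizes pi ->
  mgf #|C| pi k i lam f
  = expect P (fun w => subset_avg k [set: C] (fun K =>
      expR (lam * (subset_avg i K (fun A => f (w @: A)) - face_mean #|C| pi i f)))).
Proof.
move=> pic Ppi; rewrite /mgf sum_pijE // realizes_subset_avg //.
case: Ppi => _ Pinj _; apply: eq_bigr => w _.
have [->|w0] := eqVneq (P w) 0; first by rewrite !mul0r.
congr (_ * _); apply: eq_subset_avg => K _ _.
by rewrite subset_avg_imset // => c c' _ _; apply: Pinj.
Qed.

(** The deviation is that of [f (w @: A)] from its mean [psi A], averaged over [A] in [K], plus that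
    of the average of [psi] over [K] from [mu]. Quasi-independence bounds the first for every fixed
    [K], comparison with [m] independent [i]-sets the second; each gives one factor
    [expR (2 * th ^+ 2) ^+ m]. *)
Lemma mgf_quasi_independent pi n (gam : R) k i m (th : R) f :
  is_complex #|C| pi -> realizes pi -> 0 <= gam -> quasi_independent P n gam ->
  (0 < i <= k)%N -> (m * i <= k)%N -> (k <= #|C|)%N -> (k <= n)%N ->
  (forall t, 0 <= f t <= 1) -> `|th| <= 2^-1 ->
  mgf #|C| pi k i (m%:R * th) f
    <= expR (2 * th ^+ 2) ^+ m * (expR (2 * th ^+ 2) ^+ m * mgf_error gam m i th).
Proof.
move=> pic Ppi gam0 Pq /andP[i0 ik] mik kC kn f01 th_le.
have pi1 : \sum_S pi S = 1 by case: pic => _ [].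
have P1 := realizes_sum1 pi1 Ppi; have P0 : forall w, 0 <= P w by case: Ppi.
have iC := leq_trans ik kC.
pose psi (A : {set C}) := expect P (fun w : {ffun C -> V} => f (w @: A)).
have muE : face_mean #|C| pi i f = subset_avg i [set: C] psi.
  by rewrite /face_mean sum_pijE // realizes_subset_avg // expect_subset_avg.
rewrite mgf_expect // expect_subset_avg muE.
set mu := subset_avg i _ psi; set E := expR _ ^+ m; set B := mgf_error _ _ _ _.
have psi01 A : 0 <= psi A <= 1 by apply: expect01.
have B0 : 0 <= E * B by rewrite mulr_ge0 ?mgf_error_ge0 // exprn_ge0 // expR_ge0.
apply: (@le_trans _ _ (subset_avg k [set: C] (fun K => E * B *
    expR (m%:R * th * subset_avg i K (fun A => psi A - mu))))).
  apply: le_subset_avg => K _ Kk.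
  have miK : (m * i <= #|K|)%N by rewrite Kk.
  have Kn : (#|K| <= n)%N by rewrite Kk.
  have fdep A : depends_on A (fun w : {ffun C -> V} => f (w @: A)).
    by move=> w w' /agreeP ww'; congr f; apply: eq_in_imset.
  have := expect_expR_subset_avg_le P0 P1 gam0 Pq miK Kn (fun _ _ => f01 _) fdep th_le.
  move=> /(ler_wpM2r (expR_ge0 (m%:R * th * subset_avg i K (fun A => psi A - mu)))).
  apply: le_trans; rewrite [leRHS]mulrC -expectM; apply: le_expect => // w.
  rewrite -expRD ler_expR !subset_avgB subset_avg_cst ?Kk // -/psi.
  rewrite le_eqVlt; apply/orP; left; apply/eqP; ring.
rewrite subset_avgM mulrC ler_wpM2r //.
apply: le_trans (expR_subset_avg_iid _ _ _ _ _) _ => //.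
rewrite lerXn2r ?nnegrE ?expR_ge0 //.
  by rewrite /subset_avg divr_ge0 // sumr_ge0 // => A _; rewrite expR_ge0.
by apply: hoeffding_subset_avg => //; rewrite cardsT.
Qed.

End Complex.

(** * The mass of the top faces above a given face *)

Section Upmass.
Variables (R : realType) (V : finType).
Implicit Types (pi : {set V} -> R) (S s t : {set V}).

(** For a [d]-uniform complex, the probability that the random top face contains [s], which is
    ['C(d, #|s|)] times the induced mass of [s]. *)
Definition upmass pi s := \sum_(S : {set V} | s \subset S) pi S.

Lemma upmass_ge0 pi s : (forall S, 0 <= pi S) -> 0 <= upmass pi s.
Proof. by move=> pi0; apply: sumr_ge0. Qed.

Lemma upmass_face pi s : (forall S, 0 <= pi S) -> upmass pi s != 0 -> face pi s.
Proof.
move=> pi0; apply: contraNT => /existsPn H; apply/eqP; apply: big1 => S sS.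
have := H S; rewrite sS andbT -leNgt => piS; apply/eqP.
by rewrite eq_le piS pi0.
Qed.

Lemma face_upmass pi s : (forall S, 0 <= pi S) -> face pi s -> 0 < upmass pi s.
Proof.
move=> pi0 /existsP[S /andP[S0 sS]]; rewrite /upmass (bigD1 S) //=.
by rewrite ltr_wpDr // sumr_ge0.
Qed.

Lemma sum_upmassU1 pi s (Q : pred V) (F : V -> R) :
  \sum_(v | Q v) upmass pi (v |: s) * F v
  = \sum_(S : {set V} | s \subset S) pi S * \sum_(v in S | Q v) F v.
Proof.
rewrite /upmass; under eq_bigr => v _ do rewrite mulr_suml.
rewrite (exchange_big_dep (fun S => s \subset S)) /=.
  apply: eq_bigr => S sS; rewrite mulr_sumr; apply: eq_bigl => v.
  by rewrite subUset sub1set sS andbT andbC.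
by move=> v S _; rewrite subUset => /andP[].
Qed.

(** Every top face containing [s] has [d - #|s|] further vertices. *)
Lemma upmassU1_notin pi d s : (forall S, pi S != 0 -> #|S| = d) ->
  \sum_(v | v \notin s) upmass pi (v |: s) = (d - #|s|)%:R * upmass pi s.
Proof.
move=> pid; under eq_bigr => v _ do rewrite -[upmass _ _]mulr1.
rewrite sum_upmassU1 /upmass mulr_sumr; apply: eq_bigr => S sS.
have [->|S0] := eqVneq (pi S) 0; first by rewrite mul0r mulr0.
rewrite mulrC sumr_const; congr (_%:R * _).
rewrite -(pid S S0) -cardsDS //; apply: eq_card => v; rewrite !inE.
by rewrite andbC.
Qed.

Lemma upmass_full pi d s : (forall S, pi S != 0 -> #|S| = d) -> #|s| = d ->
  upmass pi s = pi s.
Proof.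
move=> pid sd; rewrite /upmass (bigD1 s) //= big1 ?addr0 // => S /andP[sS Ss].
apply/eqP; apply: contraNT Ss => /pid Sd.
by rewrite eq_sym eqEcard sS Sd sd leqnn.
Qed.

End Upmass.

(** * Random orderings of the top face *)

Section Realizations.
Variables (R : realType) (V C : finType).
Implicit Types (pi : {set V} -> R) (x w : {ffun C -> V}) (I : {set C}).

Lemma cond_mass_coord (P : {ffun C -> V} -> R) I a x (al : V -> R) h : a \notin I ->
  cond_mass P I x (fun w => al (w a) * h w)
  = \sum_v al v * cond_mass P (a |: I) (reset x a v) h.
Proof.
move=> aI; rewrite (cond_mass_reset _ _ _ aI); apply: eq_bigr => v _.
rewrite /cond_mass mulr_sumr; apply: eq_bigr => w.
by rewrite agree_reset // => /andP[_ /eqP->]; rewrite mulrCA.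
Qed.

Lemma imset_reset I a x v : a \notin I ->
  reset x a v @: (a |: I) = v |: x @: I.
Proof.
move=> aI; rewrite imsetU1 ffunE eqxx; congr (_ |: _); apply: eq_in_imset => c cI.
by rewrite ffunE; case: eqP => // ca; rewrite -ca cI in aI.
Qed.

Lemma agree_setT w x : agree [set: C] w x = (w == x).
Proof.
apply/agreeP/eqP => [H|->//]; apply/ffunP => c; exact: H.
Qed.

Lemma cond_mass_setT (P : {ffun C -> V} -> R) x :
  cond_mass P [set: C] x (fun=> 1) = P x.
Proof.
rewrite /cond_mass (eq_bigl (pred1 x)) => [|w]; last by rewrite agree_setT.
by rewrite big_pred1_eq mulr1.
Qed.

(** Downward induction from the full set: masses are known for complete families and follow for
    partial ones by summing out one coordinate. *)
Lemma setI_ind (Pr : {set C} -> Prop) : Pr [set: C] ->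
  (forall I a, a \notin I -> Pr (a |: I) -> Pr I) -> forall I, Pr I.
Proof.
move=> PT PS I; have [m Im] : exists m, #|~: I| = m by exists #|~: I|.
elim: m I Im => [|m IH] I Im.
  by move/eqP: Im; rewrite cards_eq0 => /eqP e; rewrite -[I]setCK e setC0.
have [a aI] : exists a, a \in ~: I by apply/card_gt0P; rewrite Im.
apply: (PS I a); first by move: aI; rewrite inE.
apply: IH; rewrite setCU setIC -setDE.
by have := cardsD1 a (~: I); rewrite aI Im => -[].
Qed.

(** A uniformly random one of the [#|C|!] orderings of the random top face. *)
Definition order_law pi w : R :=
  if injectiveb w then pi (w @: [set: C]) / ((#|C|)`!)%:R else 0.

(** The equality of cardinals says that [x] is injective on [I]. Summing out a coordinate gives the
    factor [#|C| - #|I|] of [upmassU1_notin], which builds up the factorial. *)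
Lemma order_law_mass pi I x : (forall S, pi S != 0 -> #|S| = #|C|) ->
  cond_mass (order_law pi) I x (fun=> 1) =
  if #|x @: I| == #|I| then upmass pi (x @: I) * ((#|C| - #|I|)`!)%:R / ((#|C|)`!)%:R
  else 0.
Proof.
move=> pid; elim/setI_ind: I x => [|I a aI IH] x.
  rewrite cond_mass_setT /order_law cardsT subnn fact0 mulr1.
  have -> : injectiveb x = (#|x @: [set: C]| == #|C|).
    apply/injectiveP/idP => [xi|]; first by rewrite card_imset ?cardsT.
    by rewrite -[X in _ == X]cardsT => /imset_injP H c c' /H; apply; rewrite inE.
  by case: ifP => // /eqP e; rewrite (upmass_full pid).
rewrite (cond_mass_reset _ _ _ aI); under eq_bigr => v _ do rewrite IH imset_reset //.
have cU v : #|v |: x @: I| = ((v \notin x @: I) + #|x @: I|)%N by rewrite cardsU1.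
rewrite cardsU1 aI; case: ifP => [/eqP xI|xI]; last first.
  (* A collision on [I] persists on [a |: I], so every term vanishes. *)
  apply: big1 => v _; rewrite cU; case: ifP => //; rewrite add1n.
  have := leq_imset_card x I; rewrite leq_eqVlt xI /= => lt.
  by case: (v \notin _) => /eqP e; move: lt; rewrite -ltnS -e ?add1n ?ltnn // add0n ltnNge ltnW.
under eq_bigr => v _ do rewrite cU xI eqn_add2r.
rewrite (eq_bigr (fun v => if v \notin x @: I then upmass pi (v |: x @: I) *
   (((#|C| - (#|I|.+1))`!)%:R / ((#|C|)`!)%:R) else 0)); last first.
  by move=> v _; case: (v \notin _); rewrite //= mulrA.
rewrite -big_mkcond -mulr_suml (upmassU1_notin _ pid) xI.
have lt : (#|I| < #|C|)%N.
  by rewrite ltnNge; apply: contra aI => CI; have /eqP -> : I == [set: C];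
    rewrite ?inE // eqEcard subsetT cardsT.
rewrite -(subnSK lt) factS natrM; ring.
Qed.

Lemma order_law_realizes pi : is_complex #|C| pi -> (0 < #|C|)%N ->
  realizes (order_law pi) pi.
Proof.
move=> pic C0; have pi0 : forall S, 0 <= pi S by case: pic.
split.
- by move=> w; rewrite /order_law; case: ifP => // _; rewrite divr_ge0.
- by move=> w; rewrite /order_law; case: injectiveP => //; rewrite eqxx.
move=> Phi.
have [S S0] : exists S, pi S != 0.
  apply/existsP; apply: contraT => /existsPn H; case: pic => _ [_].
  rewrite big1 => [/esym/eqP|S _]; first by rewrite oner_eq0.
  by apply/eqP; rewrite -[_ == _]negbK.
have [v _] : exists v, v \in S by apply/card_gt0P; rewrite (complex_card pic S0).
(* The total mass, for the weights [pi S * Phi S] in place of [pi]. *)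
have := @order_law_mass (fun S => pi S * Phi S) set0 [ffun=> v].
rewrite imset0 !cards0 eqxx subn0 mulfK ?pnatr_eq0 -?lt0n ?fact_gt0 // => H.
transitivity (upmass (fun S => pi S * Phi S) set0).
  by apply: eq_bigl => S'; rewrite sub0set.
rewrite -H => [|S']; last first.
  by rewrite mulf_eq0 negb_or => /andP[/(complex_card pic)].
apply: eq_big => [w|w _]; first by apply/agreeP => c; rewrite inE.
by rewrite /order_law; case: ifP => _; rewrite ?mul0r // mulr1 mulrAC.
Qed.

(* Covariance along the edges of the graph underlying the link of [s]. *)
Definition link_cov_le d pi (s : {set V}) (gam : R) := forall al be : V -> R,
  (forall v, `|al v| <= 1) -> (forall v, `|be v| <= 1) ->
  let r : R := (d - #|s|)%:R in
  `|(\sum_u \sum_v link_weight pi s u v * al u * be v) / (r * (r - 1) * upmass pi s)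
    - (\sum_(u | u \notin s) upmass pi (u |: s) * al u) / (r * upmass pi s)
      * ((\sum_(u | u \notin s) upmass pi (u |: s) * be u) / (r * upmass pi s))|
  <= gam.

(** Conditioning on the coordinates in [I] passes to the link of [x @: I]: there one coordinate is a
    random vertex and two are a random edge. After the factorials cancel, the conditional covariance
    is the one in [link_cov_le]. *)
Lemma order_law_quasi pi n (gam : R) : is_complex #|C| pi -> (n <= #|C|)%N -> 0 <= gam ->
  (forall s : {set V}, face pi s -> (#|s|.+2 <= n)%N -> link_cov_le #|C| pi s gam) ->
  quasi_independent (order_law pi) n gam.
Proof.
move=> pic nC gam0 H I x a b al be aI bI ab In al1 be1.
have pid S : pi S != 0 -> #|S| = #|C| by apply: complex_card.
have pi0 : forall S, 0 <= pi S by case: pic.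
have mass0 := order_law_mass I x pid.
have [M0|M0] := eqVneq (cond_mass (order_law pi) I x (fun=> 1)) 0.
  rewrite cond_cov0 ?normr0 // => w; rewrite /order_law.
  by case: ifP => // _; rewrite divr_ge0.
move: mass0 M0; case: ifP => [/eqP xI mE|_ ->]; last by rewrite eqxx.
set X := x @: I in xI mE *; rewrite mE => M0.
have X0 : upmass pi X != 0 by apply: contra M0 => /eqP->; rewrite !mul0r.
have [q CE] : exists q, #|C| = (#|I| + q.+2)%N.
  exists (#|C| - #|I|.+2)%N; rewrite -addSnnS -addSnnS subnKC //.
  exact: leq_trans nC.
have CIE : (#|C| - #|I| = q.+2)%N by rewrite CE addKn.
have CI1 : (#|C| - #|I|.+1 = q.+1)%N by rewrite subnS CIE.
have CI2 : (#|C| - #|I|.+2 = q)%N by rewrite subnS CI1.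
pose N : R := ((#|C|)`!)%:R.
have N0 : N != 0 by rewrite pnatr_eq0 -lt0n fact_gt0.
have q0 : (q`!)%:R != 0 :> R by rewrite pnatr_eq0 -lt0n fact_gt0.
have mass1 c (ga : V -> R) : c \notin I ->
    cond_mass (order_law pi) I x (fun w => ga (w c))
    = (\sum_(u | u \notin X) upmass pi (u |: X) * ga u) * ((q.+1)`!)%:R / N.
  move=> cI; transitivity (cond_mass (order_law pi) I x (fun w => ga (w c) * 1)).
    by apply: eq_bigr => w _; rewrite mulr1.
  rewrite cond_mass_coord // -mulrA mulr_suml [RHS]big_mkcond; apply: eq_bigr => v _ /=.
  rewrite order_law_mass // imset_reset // -/X !cardsU1 cI xI eqn_add2r CI1 -/N.
  by case: (v \notin X); rewrite ?mulr0 //=; ring.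
have mass2 : cond_mass (order_law pi) I x (fun w => al (w a) * be (w b))
    = (\sum_u \sum_v link_weight pi X u v * al u * be v) * (q`!)%:R / N.
  rewrite cond_mass_coord // -mulrA mulr_suml; apply: eq_bigr => u _.
  transitivity (al u * cond_mass (order_law pi) (a |: I) (reset x a u)
      (fun w => be (w b) * 1)).
    by congr (_ * _); apply: eq_bigr => w _; rewrite mulr1.
  have baI : b \notin a |: I by rewrite !inE negb_or eq_sym ab.
  rewrite cond_mass_coord // mulr_sumr mulr_suml; apply: eq_bigr => v _.
  rewrite order_law_mass // !imset_reset // -/X !(cardsU1 _ (_ |: _)) baI !cardsU1 aI xI.
  rewrite /link_weight -[\sum_(t | _) _]/(upmass pi _) setUCA.
  rewrite [v \in _ |: _]inE in_set1 negb_or [v == u]eq_sym.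
  have cardE (b1 b2 : bool) k : (b1 + (b2 + k) == true + (true + k))%N = b1 && b2.
    by rewrite !addnA eqn_add2r; case: b1; case: b2.
  rewrite cardE; case: (u != v); case: (u \in X); case: (v \in X) => /=;
    rewrite ?mulr0 ?mul0r // !add1n CI2 -/N; ring.
rewrite /cond_cov /cond_exp mass2 !mass1 // mE -/N.
have := H X (upmass_face pi0 X0); rewrite xI => /(_ In al be al1 be1).
rewrite -/X /= xI CIE; apply: le_trans; rewrite le_eqVlt; apply/orP; left; apply/eqP.
rewrite !factS !natrM; congr `| _ |.
have q1 : q.+1%:R != 0 :> R by rewrite pnatr_eq0.
have q2 : q.+2%:R != 0 :> R by rewrite pnatr_eq0.
have q21 : q.+2%:R - 1 = q.+1%:R :> R by rewrite -[q.+2%:R]natr1 addrK.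
rewrite q21; move: q1 q2; move: (q.+1%:R : R) (q.+2%:R : R) => Q1 Q2 q1 q2; field.
by rewrite N0 X0 q0 q1 q2.
Qed.

End Realizations.

(** * Partite top faces listed by color *)

Section PartiteRealization.
Variables (R : realType) (V C : finType) (col : V -> C) (pi : {set V} -> R).
Implicit Types (x w : {ffun C -> V}) (I : {set C}) (s S : {set V}).
Hypothesis pi_ge0 : forall S, 0 <= pi S.
Hypothesis pi_card : forall S, pi S != 0 -> #|S| = #|C|.
Hypothesis pi_col : forall S, pi S != 0 -> {in S &, injective col}.

(** Here [w c] is the vertex of color [c]. The weights [p] are left free so that they can be
    multiplied by a test function. *)
Definition color_law (p : {set V} -> R) w : R :=
  if [forall c, col (w c) == c] then p (w @: [set: C]) else 0.

(** There are as many vertices as colors and their colors differ, so each color occurs once. *)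
Lemma top_face_color S c : pi S != 0 -> #|[set v in S | col v == c]| = 1%N.
Proof.
move=> S0; have cS : col @: S = [set: C].
  by apply/eqP; rewrite eqEcard subsetT cardsT card_in_imset ?pi_card ?leqnn //; apply: pi_col.
have : c \in col @: S by rewrite cS inE.
case/imsetP => v vS ->; apply/eqP/cards1P; exists v; apply/setP => u.
rewrite !inE; apply/andP/eqP => [[uS /eqP]|->]; first exact: (pi_col S0).
by rewrite vS eqxx.
Qed.

Lemma upmassU1_color s c :
  \sum_(v | col v == c) upmass pi (v |: s) = upmass pi s.
Proof.
under eq_bigr => v _ do rewrite -[upmass _ _]mulr1.
rewrite sum_upmassU1; apply: eq_bigr => S _.
have [->|S0] := eqVneq (pi S) 0; first by rewrite mul0r.
rewrite sumr_const -[#|_|]/(#|[pred v in S | col v == c]|).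
have -> : #|[pred v in S | col v == c]| = #|[set v in S | col v == c]|.
  by apply: eq_card => v; rewrite !inE.
by rewrite top_face_color // mulr1.
Qed.

Lemma upmass_color0 s u v : u != v -> col u = col v -> u \in s -> v \in s ->
  upmass pi s = 0.
Proof.
move=> uv cuv us vs; apply: big1 => S sS; apply/eqP; apply: contraNT uv => S0.
by apply/eqP; apply: (pi_col S0) => //; apply: (subsetP sS).
Qed.

(** No counting factor appears, in contrast to orderings: a top face has a single vertex of the
    color summed out. *)
Lemma color_law_mass (F : {set V} -> R) I x :
  cond_mass (color_law (fun S => pi S * F S)) I x (fun=> 1) =
  if [forall c in I, col (x c) == c] then upmass (fun S => pi S * F S) (x @: I) else 0.
Proof.
elim/setI_ind: I x => [|I a aI IH] x.
  rewrite cond_mass_setT /color_law.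
  have -> : [forall c, col (x c) == c] = [forall c in [set: C], col (x c) == c].
    by apply: eq_forallb => c; rewrite inE.
  case: ifP => // /forall_inP H.
  rewrite (@upmass_full _ _ _ #|C|) //.
    by move=> S; rewrite mulf_eq0 negb_or => /andP[/pi_card].
  rewrite card_imset ?cardsT // => c c' e.
  by rewrite -(eqP (H c _)) ?inE // e (eqP (H c' _)) ?inE.
rewrite (cond_mass_reset _ _ _ aI); under eq_bigr => v _ do rewrite IH imset_reset //.
have cE v : [forall c in a |: I, col (reset x a v c) == c]
    = [forall c in I, col (x c) == c] && (col v == a).
  apply/forall_inP/andP => [H|[/forall_inP H1 H2] c].
    split; last by have := H a; rewrite setU11 ffunE eqxx => ->.
    apply/forall_inP => c cI; have := H c; rewrite !inE cI orbT ffunE.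
    by case: (eqVneq c a) => [ca|_ /(_ isT) //]; rewrite -ca cI in aI.
  rewrite !inE ffunE; case: eqP => [-> //|_ /=]; exact: H1.
under eq_bigr => v _ do rewrite cE.
case: ifP => _ /=; last by rewrite big1.
rewrite -big_mkcond /upmass.
under eq_bigr => v _ do rewrite -[\sum_(S | _) _]/(upmass _ _) -[upmass _ _]mulr1.
rewrite sum_upmassU1; apply: eq_bigr => S _.
have [->|S0] := eqVneq (pi S) 0; first by rewrite !mul0r.
rewrite sumr_const.
have -> : #|[pred v in S | col v == a]| = #|[set v in S | col v == a]|.
  by apply: eq_card => v; rewrite !inE.
by rewrite top_face_color // mulr1.
Qed.

Lemma color_law_mass1 I x : cond_mass (color_law pi) I x (fun=> 1) =
  if [forall c in I, col (x c) == c] then upmass pi (x @: I) else 0.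
Proof.
have := color_law_mass (fun=> 1) I x.
have -> : (fun S => pi S * 1) = pi by apply/funext => S; rewrite mulr1.
by [].
Qed.

Lemma color_law_realizes : \sum_S pi S = 1 -> (0 < #|C|)%N ->
  realizes (color_law pi) pi.
Proof.
move=> pi1 C0; split.
- by move=> w; rewrite /color_law; case: ifP.
- move=> w; rewrite /color_law; case: ifP => [/forallP H _ c c' e|]; last by rewrite eqxx.
  by rewrite -(eqP (H c)) e (eqP (H c')).
move=> Phi.
have [S S0] : exists S, pi S != 0.
  apply/existsP; apply: contraT => /existsPn H; move: pi1.
  rewrite big1 => [/esym/eqP|S _]; first by rewrite oner_eq0.
  by apply/eqP; rewrite -[_ == _]negbK.
have [v _] : exists v, v \in S by apply/card_gt0P; rewrite pi_card.
have := color_law_mass Phi set0 [ffun=> v].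
rewrite imset0 ifT; last by apply/forall_inP => c; rewrite inE.
move=> H; transitivity (upmass (fun S => pi S * Phi S) set0).
  by apply: eq_bigl => S'; rewrite sub0set.
rewrite -H; apply: eq_big => [w|w _]; first by apply/agreeP => c; rewrite inE.
by rewrite /color_law; case: ifP => _; rewrite ?mul0r // mulr1.
Qed.

(** The covariance, given that the top face contains [s], of functions of its vertices of colors [a]
    and [b]. *)
Definition color_cov_le s (gam : R) := forall (a b : C) (al be : V -> R),
  a \notin col @: s -> b \notin col @: s -> a != b ->
  (forall v, `|al v| <= 1) -> (forall v, `|be v| <= 1) ->
  `|(\sum_(u | col u == a) \sum_(v | col v == b)
       upmass pi (v |: (u |: s)) * al u * be v) / upmass pi s
    - (\sum_(u | col u == a) upmass pi (u |: s) * al u) / upmass pi s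
      * ((\sum_(u | col u == b) upmass pi (u |: s) * be u) / upmass pi s)|
  <= gam.

(** If [x] respects the colors on [I], conditioning on it means that the top face contains [x @: I],
    whose colors are exactly [I]; otherwise the event is null. *)
Lemma color_law_quasi (n : nat) (gam : R) : 0 <= gam ->
  (forall s, face pi s -> (#|s|.+2 <= n)%N -> color_cov_le s gam) ->
  quasi_independent (color_law pi) n gam.
Proof.
move=> gam0 H I x a b al be aI bI ab In al1 be1.
have [M0|M0] := eqVneq (cond_mass (color_law pi) I x (fun=> 1)) 0.
  rewrite cond_cov0 ?normr0 // => w; rewrite /color_law.
  by case: ifP.
have := color_law_mass1 I x; case: ifP => [/forall_inP xcol mE|_ e]; last by rewrite e eqxx in M0.
set X := x @: I in mE *; rewrite mE in M0.
have colX : col @: X = I.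
  rewrite -imset_comp; apply/setP => c; apply/imsetP/idP => [[c' c'I /= ->]|cI].
    by rewrite (eqP (xcol _ c'I)).
  by exists c => //=; rewrite (eqP (xcol _ cI)).
have xI : #|X| = #|I|.
  apply/eqP; rewrite eqn_leq leq_imset_card /= -{1}colX leq_imset_card //.
have xcolT : [forall c in I, col (x c) == c] by apply/forall_inP.
have cE (J : {set C}) (y : {ffun C -> V}) c v : c \notin J ->
    [forall c in J, col (y c) == c] ->
    [forall c' in c |: J, col (reset y c v c') == c'] = (col v == c).
  move=> cJ /forall_inP yJ; apply/forall_inP/idP => [/(_ c)|cv c'].
    by rewrite setU11 ffunE eqxx => ->.
  rewrite !inE ffunE; case: eqP => [-> //|_ /=]; exact: yJ.
have mass1 c (ga : V -> R) : c \notin I ->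
    cond_mass (color_law pi) I x (fun w => ga (w c))
    = \sum_(u | col u == c) upmass pi (u |: X) * ga u.
  move=> cI; transitivity (cond_mass (color_law pi) I x (fun w => ga (w c) * 1)).
    by apply: eq_bigr => w _; rewrite mulr1.
  rewrite cond_mass_coord // [RHS]big_mkcond; apply: eq_bigr => v _ /=.
  rewrite color_law_mass1 imset_reset // cE // -/X.
  by case: ifP; rewrite ?mulr0 // mulrC.
have mass2 : cond_mass (color_law pi) I x (fun w => al (w a) * be (w b))
    = \sum_(u | col u == a) \sum_(v | col v == b) upmass pi (v |: (u |: X)) * al u * be v.
  rewrite cond_mass_coord // [RHS]big_mkcond; apply: eq_bigr => u _.
  transitivity (al u * cond_mass (color_law pi) (a |: I) (reset x a u)
      (fun w => be (w b) * 1)).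
    by congr (_ * _); apply: eq_bigr => w _; rewrite mulr1.
  have baI : b \notin a |: I by rewrite !inE negb_or eq_sym ab.
  rewrite cond_mass_coord // mulr_sumr.
  case: ifP => ua; last first.
    apply: big1 => v _; rewrite color_law_mass1 ifF ?mulr0 //.
    apply/negP => /forall_inP /(_ a); rewrite !inE eqxx orbT => /(_ isT).
    by rewrite !ffunE eqxx (negbTE ab) ua.
  rewrite [RHS]big_mkcond; apply: eq_bigr => v _.
  rewrite color_law_mass1 cE //; last by rewrite cE.
  rewrite !imset_reset // -/X; case: ifP; rewrite ?mulr0 // => _; ring.
rewrite /cond_cov /cond_exp mass2 !mass1 // mE.
by apply: H; rewrite ?colX ?xI //; apply: upmass_face.
Qed.

End PartiteRealization.

(** * Eigenvalues of reversible walks *)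

Lemma char_poly_similar (F : fieldType) n (P A B : 'M[F]_n) :
  P \in unitmx -> P *m A = B *m P -> char_poly A = char_poly B.
Proof.
move=> Pu PA; rewrite /char_poly.
have : map_mx polyC P *m char_poly_mx A = char_poly_mx B *m map_mx polyC P.
  by rewrite /char_poly_mx mulmxBr mulmxBl -!map_mxM PA scalar_mxC.
move=> /(congr1 determinant); rewrite !det_mulmx mulrC => /mulIf; apply.
by rewrite det_map_mx polyC_eq0 -unitfE -unitmxE.
Qed.

(* [y] gives the coordinates in a unitary eigenbasis of the complexification,
   whose eigenvalues are the reals [d]. *)
Lemma sym_eigenbasis (R : realType) n (N : 'M[R]_n) : N^T = N ->
  exists (d : 'I_n -> R) (y : 'rV[R]_n -> 'I_n -> R[i]),
  [/\ char_poly N = \prod_(i < n) ('X - (d i)%:P),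
      forall x x' : 'rV[R]_n, (\sum_j x 0 j * x' 0 j)%:C%C = \sum_i y x i * (y x' i)^* &
      forall (x : 'rV[R]_n) i, y (x *m N) i = (d i)%:C%C * y x i].
Proof.
move=> Nsym; pose toC := real_complex R.
pose NC : 'M[R[i]]_n := map_mx toC N.
have NC_herm : NC \is hermsymmx.
  apply: realsym_hermsym.
    by apply/is_hermitianmxP; rewrite expr0 scale1r map_mx_id //; apply/matrixP => i j; rewrite !mxE -[in LHS]Nsym mxE.
  by apply/mxOverP => i j; rewrite mxE; apply/complex_realP; exists (N i j).
have /orthomx_spectralP := hermitian_normalmx NC_herm.
have := hermitian_spectral_diag_real NC_herm.
have := spectral_unitarymx NC.
set P := spectralmx NC; set sp := spectral_diag NC => Pu sp_real NCE.
have sp_ex i : exists k : R, sp 0 i = k%:C%C.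
  by apply/complex_realP; move/mxOverP: sp_real; apply.
have [d dE] := choice sp_ex.
have PV : invmx P = P^t*%sesqui by rewrite invmx_unitary.
have Punit := unitarymx_unit Pu.
exists d, (fun x i => (map_mx toC x *m invmx P) 0 i); split.
- apply: (map_poly_inj toC); rewrite map_char_poly -/NC.
  rewrite (@char_poly_similar _ _ P NC (diag_mx sp)) //; last first.
    by rewrite {1}NCE !mulmxA mulmxV // mul1mx.
  rewrite char_poly_trig ?diag_mx_is_trig // rmorph_prod /=.
  apply: eq_bigr => i _.
  by rewrite mxE eqxx mulr1n dE rmorphB /= map_polyX map_polyC.
- move=> x x'; rewrite PV.
  have -> : (\sum_j x 0 j * x' 0 j)%:C%C = (map_mx toC x *m (map_mx toC x')^T) 0 0.
    rewrite mxE (rmorph_sum toC); apply: eq_bigr => j _.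
    by rewrite !mxE -rmorphM.
  have PP : P^t*%sesqui *m P = 1%:M by rewrite -PV mulVmx.
  rewrite -[map_mx toC x in LHS]mulmx1 -PP mulmxA -mulmxA mxE.
  apply: eq_bigr => i _; congr (_ * _).
  rewrite !mxE rmorph_sum; apply: eq_bigr => j _.
  rewrite !mxE rmorphM /= conjCK mulrC conj_Creal //.
  by apply/complex_realP; exists (x' 0 j).
- move=> x i; rewrite map_mxM -/NC {1}NCE -!mulmxA mulmxV // mulmx1.
  by rewrite mulmxA mul_mx_diag mxE dE mulrC.
Qed.

(** [M] is similar to the symmetric matrix [N], and [w i] is the squared modulus of the [i]-th
    coordinate of [x], which is [f] scaled by the square root of [deg]. That square root itself has
    eigenvalue 1; at most one eigenvalue satisfies [Q], hence only this one, and [f] is orthogonal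
    to it. *)
Lemma walk_eigen_decomposition_ord (R : realType) n (L : 'I_n -> 'I_n -> R)
    (Q : pred R) (f : 'I_n -> R) :
  let deg i := \sum_j L i j in
  let M := \matrix_(i, j) (L i j / deg i) in
  (forall i j, L i j = L j i) -> (forall i, 0 < deg i) -> Q 1 ->
  (forall s : seq R, uniq s -> all Q s ->
    (\sum_(mu <- s) mup mu (char_poly M) <= 1)%N) ->
  \sum_i deg i * f i = 0 ->
  exists d w : 'I_n -> R,
    [/\ forall i, 0 <= w i, forall i, Q (d i) -> w i = 0,
        \sum_i \sum_j L i j * f i * f j = \sum_i d i * w i &
        \sum_i deg i * f i ^+ 2 = \sum_i w i].
Proof.
move=> deg M Lsym deg_gt0 Q1 HM fdeg.
pose sd i := Num.sqrt (deg i).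
have sd_gt0 i : 0 < sd i by rewrite sqrtr_gt0.
have sd_neq0 i : sd i != 0 by rewrite gt_eqF.
have sd2 i : sd i * sd i = deg i by rewrite -expr2 sqr_sqrtr // ltW.
pose N := \matrix_(i, j) (L i j / (sd i * sd j)).
have Nsym : N^T = N.
  by apply/matrixP => i j; rewrite !mxE Lsym [sd j * _]mulrC.
have [d [y [cpN yy yN]]] := sym_eigenbasis Nsym.
have cpM : char_poly M = \prod_(i < n) ('X - (d i)%:P).
  rewrite -cpN; pose S := diag_mx (\row_i sd i).
  have Su : S \in unitmx.
    rewrite unitmxE det_diag unitfE; apply/prodf_neq0 => i _.
    by rewrite mxE.
  apply: (char_poly_similar Su); apply/matrixP => i j.
  rewrite mul_diag_mx mul_mx_diag !mxE -sd2; field.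
  by rewrite !sd_neq0.
have mupM i : mup (d i) (char_poly M) = count_mem (d i) (map d (enum 'I_n)).
  by rewrite cpM -mu_prod_XsubC big_map big_enum.
(* Two indices in [Q] would give total multiplicity at least 2, whether or not their eigenvalues
   coincide. *)
have Q_uniq i j : Q (d i) -> Q (d j) -> i = j.
  move=> Qi Qj; apply/eqP/negP => /negP ij.
  have enumP k : k \in enum 'I_n by rewrite mem_enum.
  case: (eqVneq (d i) (d j)) => [dij|dij].
    have := HM [:: d i] isT; rewrite /= Qi => /(_ isT).
    rewrite big_seq1 mupM leqNgt => /negP; apply.
    rewrite count_map.
    have /leq_trans : (count (mem [:: i; j]) (enum 'I_n) <=
        count (preim d (pred1 (d i))) (enum 'I_n))%N.
      apply: sub_count => k /=; rewrite !inE => /orP[] /eqP-> //.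
      by rewrite dij.
    move/(_ _ (leqnn _)); apply: leq_trans.
    rewrite -size_filter.
    have /uniq_leq_size : uniq [:: i; j] by rewrite /= inE ij.
    by apply=> k kij; rewrite mem_filter enumP andbT.
  have := HM [:: d i; d j]; rewrite /= inE dij Qi Qj => /(_ isT isT).
  rewrite big_cons big_seq1 !mupM leqNgt => /negP; apply.
  have gt0 k : (0 < count_mem (d k) (map d (enum 'I_n)))%N.
    by rewrite -has_count has_pred1 map_f.
  exact: (leq_add (gt0 i) (gt0 j)).
pose e := \row_i sd i; pose x := \row_i (sd i * f i).
have eN : e *m N = e.
  apply/rowP => j; rewrite !mxE.
  transitivity ((\sum_i L j i) / sd j); last by rewrite -/(deg j) -sd2 mulfK.
  rewrite mulr_suml; apply: eq_bigr => i _; rewrite !mxE Lsym; field.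
  by rewrite !sd_neq0.
have w_ex i : exists k : R, y x i * (y x i)^* = k%:C%C.
  by apply/complex_realP; rewrite realE mul_conjC_ge0.
have [w wE] := choice w_ex.
have toC_sum (F : 'I_n -> R) : (\sum_i F i)%:C%C = \sum_i (F i)%:C%C.
  exact: (rmorph_sum (real_complex R)).
have toC_inj (r s : R) : r%:C%C = s%:C%C -> r = s by case.
exists d, w; split.
- move=> i; have := mul_conjC_ge0 (y x i).
  by rewrite wE ler0c.
- move=> i Qi.
  (* [N] fixes [e], so [e] has coordinates only at eigenvalue 1; such an index satisfies [Q] and
     hence is [i]. Being orthogonal to [e], the vector [x] has no component there. *)
  have z0 j : j != i -> y e j = 0.
    move=> ji; have := yN e j; rewrite eN => /eqP.
    rewrite -subr_eq0 -{1}[y e j]mul1r -mulrBl mulf_eq0 => /orP[|/eqP //].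
    rewrite subr_eq0 => /eqP/(toC_inj 1) d1.
    by case/eqP: ji; apply: Q_uniq => //; rewrite -d1.
  have ze : y e i != 0.
    apply/eqP => zi0; have := yy e e.
    rewrite [RHS]big1 => [|j _]; last first.
      by case: (eqVneq j i) => [->|/z0->]; rewrite ?zi0 mul0r.
    move/(toC_inj _ 0)/psumr_eq0P => /(_ _ i isT); rewrite !mxE sd2 => h.
    have := deg_gt0 i; rewrite h ?ltxx // => j _.
    by rewrite !mxE sd2 ltW.
  have := yy x e; rewrite [RHS](bigD1 i) //= [X in _ + X]big1 => [|j /z0->];
    last by rewrite conjC0 mulr0.
  rewrite addr0; have -> : \sum_j x 0 j * e 0 j = 0.
    rewrite -[RHS]fdeg; apply: eq_bigr => j _; rewrite !mxE -sd2; ring.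
  move=> /esym/eqP; rewrite mulf_eq0 conjC_eq0 (negbTE ze) orbF => /eqP y0.
  by have := wE i; rewrite y0 mul0r => /esym/(toC_inj _ 0).
- apply: toC_inj.
  transitivity (\sum_j (x *m N) 0 j * x 0 j)%:C%C.
    congr (_%:C)%C; rewrite exchange_big; apply: eq_bigr => j _ /=.
    rewrite !mxE mulr_suml; apply: eq_bigr => i _; rewrite !mxE; field.
    by rewrite !sd_neq0.
  rewrite yy toC_sum; apply: eq_bigr => i _.
  by rewrite yN -mulrA wE; apply: esym; apply: (rmorphM (real_complex R)).
- apply: toC_inj.
  transitivity (\sum_j x 0 j * x 0 j)%:C%C.
    congr (_%:C)%C; apply: eq_bigr => j _; rewrite !mxE -sd2; ring.
  by rewrite yy toC_sum; apply: eq_bigr.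
Qed.

Lemma walk_eigen_decomposition (R : realType) (U : finType) (A : {set U})
    (L : U -> U -> R) (Q : pred R) (M : 'M[R]_#|A|) (f : U -> R) :
  let deg u := \sum_(v in A) L u v in
  M = \matrix_(a, b) (L (enum_val a) (enum_val b) / deg (enum_val a)) ->
  (forall u v, L u v = L v u) -> (forall u, u \in A -> 0 < deg u) -> Q 1 ->
  (forall s : seq R, uniq s -> all Q s ->
    (\sum_(mu <- s) mup mu (char_poly M) <= 1)%N) ->
  \sum_(u in A) deg u * f u = 0 ->
  exists d w : 'I_#|A| -> R,
    [/\ forall i, 0 <= w i, forall i, Q (d i) -> w i = 0,
        \sum_(u in A) \sum_(v in A) L u v * f u * f v = \sum_i d i * w i &
        \sum_(u in A) deg u * f u ^+ 2 = \sum_i w i].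
Proof.
move=> deg ME Lsym deg_gt0 Q1 HM fdeg.
pose L' (a b : 'I_#|A|) := L (enum_val a) (enum_val b).
have degE a : \sum_b L' a b = deg (enum_val a) by rewrite /deg [RHS]big_enum_val.
have Lsym' a b : L' a b = L' b a by apply: Lsym.
have deg_gt0' a : 0 < \sum_b L' a b by rewrite degE deg_gt0 // enum_valP.
have ME' : M = \matrix_(a, b) (L' a b / \sum_b L' a b).
  by rewrite ME; apply/matrixP => a b; rewrite !mxE degE.
have fdeg' : \sum_a (\sum_b L' a b) * f (enum_val a) = 0.
  by rewrite -[RHS]fdeg [RHS]big_enum_val; apply: eq_bigr => a _; rewrite degE.
rewrite ME' in HM.
have [d [w [w0 wQ E1 E2]]] :=
  @walk_eigen_decomposition_ord R _ L' Q (fun a => f (enum_val a))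
    Lsym' deg_gt0' Q1 HM fdeg'.
exists d, w; split => //.
- rewrite -E1 [LHS]big_enum_val; apply: eq_bigr => a _.
  by rewrite [LHS]big_enum_val; apply: eq_bigr.
- by rewrite -E2 [LHS]big_enum_val; apply: eq_bigr => a _; rewrite degE.
Qed.

(** * From eigenvalues of links to covariances *)

(** After centering [al] and [be], polarization turns the bilinear form into two quadratic forms, to
    which the hypothesis and the parallelogram law apply. Centering does not increase second
    moments. *)
Lemma form_cov_le (R : realType) (V : finType) (L : V -> V -> R) (om : V -> R)
    (rho gam : R) :
  (forall u v, L u v = L v u) -> (forall u, \sum_v L u v = rho * om u) ->
  (forall u, 0 <= om u) -> 0 < rho -> 0 < \sum_u om u ->
  (forall f : V -> R, \sum_u om u * f u = 0 ->
    `|\sum_u \sum_v L u v * f u * f v| <= gam * rho * \sum_u om u * f u ^+ 2) ->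
  0 <= gam ->
  forall al be : V -> R, (forall v, `|al v| <= 1) -> (forall v, `|be v| <= 1) ->
  `|(\sum_u \sum_v L u v * al u * be v) / (rho * \sum_u om u)
    - (\sum_u om u * al u) / (\sum_u om u) * ((\sum_u om u * be u) / (\sum_u om u))|
  <= gam.
Proof.
move=> Lsym Lsum om0 rho0; set Om := \sum_u om u => Om0 H gam0 al be al1 be1.
have Om_neq0 : Om != 0 by rewrite gt_eqF.
have rho_neq0 : rho != 0 by rewrite gt_eqF.
pose mean (f : V -> R) := (\sum_u om u * f u) / Om.
pose B (f g : V -> R) := \sum_u \sum_v L u v * f u * g v.
have meanE f : \sum_u om u * f u = mean f * Om by rewrite /mean divfK.
have B1 f (r : R) : B f (fun=> r) = r * rho * mean f * Om.
  rewrite -mulrA -meanE mulr_sumr; apply: eq_bigr => u _.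
  by rewrite -!mulr_suml Lsum; ring.
have BC f g : B f g = B g f.
  rewrite /B exchange_big; apply: eq_bigr => u _; apply: eq_bigr => v _ /=.
  by rewrite Lsym; ring.
have BD f g h (r : R) : B f (fun v => g v + r * h v) = B f g + r * B f h.
  rewrite /B mulr_sumr -big_split; apply: eq_bigr => u _ /=.
  rewrite mulr_sumr -big_split; apply: eq_bigr => v _ /=; ring.
have BDl f g h (r : R) : B (fun v => g v + r * h v) f = B g f + r * B h f.
  by rewrite BC BD [B f g]BC [B f h]BC.
pose a' v := al v + -1 * mean al; pose b' v := be v + -1 * mean be.
have Bab : B a' b' = B al be - rho * Om * mean al * mean be.
  rewrite /a' /b' (BD _ be (fun=> mean be)) !(BDl _ al (fun=> mean al)).
  rewrite [B (fun=> mean al) be]BC !B1.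
  have -> : mean (fun=> mean al) = mean al.
    by rewrite {1}/mean -mulr_suml -/Om mulrC mulrA mulVf // mul1r.
  ring.
have mean0 f : \sum_u om u * (f u + -1 * mean f) = 0.
  under eq_bigr => u _ do rewrite mulrDr.
  rewrite big_split /= meanE -mulr_suml -/Om; ring.
have norm2 f : (forall v, `|f v| <= 1) -> \sum_u om u * (f u + -1 * mean f) ^+ 2 <= Om.
  move=> f1; have -> : \sum_u om u * (f u + -1 * mean f) ^+ 2
      = \sum_u om u * f u ^+ 2 - mean f ^+ 2 * Om.
    have -> : mean f ^+ 2 * Om = 2 * mean f * (mean f * Om) - mean f ^+ 2 * Om by ring.
    rewrite -{1}meanE /Om !mulr_sumr -!sumrB; apply: eq_bigr => u _; ring.
  rewrite lerBlDr; apply: (@le_trans _ _ Om); last first.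
    by rewrite lerDl mulr_ge0 ?sqr_ge0 // ltW.
  apply: ler_sum => u _; rewrite ler_piMr //.
  by rewrite -[f u ^+ 2]real_normK ?num_real // expr_le1.
have quad : `|B a' b'| <= gam * rho * Om.
  have pol : 4 * B a' b' = B (fun v => a' v + 1 * b' v) (fun v => a' v + 1 * b' v)
      - B (fun v => a' v + -1 * b' v) (fun v => a' v + -1 * b' v).
    rewrite (BD _ a' b' 1) (BD _ a' b' (-1)) !(BDl _ a' b' 1) !(BDl _ a' b' (-1)).
    rewrite [B b' a']BC; ring.
  have zero r : \sum_u om u * (a' u + r * b' u) = 0.
    under eq_bigr => u _ do rewrite mulrDr mulrCA.
    by rewrite big_split /= -mulr_sumr !mean0 mulr0 addr0.
  have h1 := H _ (zero 1); have h2 := H _ (zero (-1)).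
  have na : \sum_u om u * a' u ^+ 2 <= Om := norm2 al al1.
  have nb : \sum_u om u * b' u ^+ 2 <= Om := norm2 be be1.
  rewrite -/(B _ _) in h1 h2.
  have par : \sum_u om u * (a' u + 1 * b' u) ^+ 2 + \sum_u om u * (a' u + -1 * b' u) ^+ 2
      = 2 * \sum_u om u * a' u ^+ 2 + 2 * \sum_u om u * b' u ^+ 2.
    rewrite !mulr_sumr -!big_split; apply: eq_bigr => u _ /=; ring.
  have : 4 * `|B a' b'| <= 4 * (gam * rho * Om).
    rewrite -[X in X * `|_|]ger0_norm // -normrM pol.
    apply: le_trans (ler_normB _ _) _; apply: le_trans (lerD h1 h2) _.
    rewrite -mulrDr par [leRHS]mulrCA ler_wpM2l ?(mulr_ge0 gam0 (ltW rho0)) //.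
    lra.
  by rewrite ler_pM2l.
have -> : (\sum_u \sum_v L u v * al u * be v) / (rho * Om)
    - (\sum_u om u * al u) / Om * ((\sum_u om u * be u) / Om)
    = B a' b' / (rho * Om).
  rewrite Bab -/(B al be) -/(mean al) -/(mean be); field.
  by rewrite Om_neq0 rho_neq0.
have ro : 0 < rho * Om by rewrite mulr_gt0.
rewrite normrM normfV (gtr0_norm ro) ler_pdivrMr //.
by rewrite mulrA.
Qed.

Section Links.
Variables (R : realType) (V : finType) (d : nat) (pi : {set V} -> R) (s : {set V}).
Hypothesis pic : is_complex d pi.
Hypothesis s_face : face pi s.
Hypothesis s_card : (#|s|.+2 <= d)%N.

Let L := link_weight pi s.
Let om (u : V) : R := if u \notin s then upmass pi (u |: s) else 0.
Let r : R := (d - #|s|)%:R.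

Let pi0 : forall S, 0 <= pi S. Proof. by case: pic. Qed.
Let pid : forall S, pi S != 0 -> #|S| = d.
Proof. by move=> S; apply: complex_card. Qed.

Lemma link_weight_sym u v : L u v = L v u.
Proof.
rewrite /L /link_weight eq_sym setUCA -!andbA [(u \notin s) && _]andbC //.
Qed.

Lemma om_ge0 u : 0 <= om u.
Proof. by rewrite /om; case: ifP => // _; apply: upmass_ge0. Qed.

Lemma sum_om : \sum_u om u = r * upmass pi s.
Proof. by rewrite -big_mkcond (upmassU1_notin _ pid). Qed.

Lemma sum_om_mul (f : V -> R) :
  \sum_u om u * f u = \sum_(u | u \notin s) upmass pi (u |: s) * f u.
Proof.
rewrite [RHS]big_mkcond; apply: eq_bigr => u _; rewrite /om.
by case: ifP => // _; rewrite mul0r.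
Qed.

(** Each top face containing [s] and [u] has [r - 1] further vertices; so [om] is the degree up to
    this factor. *)
Lemma link_weight_row u : \sum_v L u v = (r - 1) * om u.
Proof.
rewrite /om; case: ifP => us; last first.
  by rewrite mulr0 big1 // => v _; rewrite /L /link_weight us andbF.
transitivity (\sum_(v | v \notin u |: s) upmass pi (v |: (u |: s))).
  rewrite [RHS]big_mkcond; apply: eq_bigr => v _; rewrite /L /link_weight us andbT.
  by rewrite !inE negb_or eq_sym setUCA.
rewrite (upmassU1_notin _ pid) cardsU1 us /r add1n.
rewrite subnS -subn1 natrB // subn_gt0; exact: ltnW.
Qed.

Lemma link_weight_notin u v : v \notin link_verts pi s -> L u v = 0.
Proof.
rewrite inE negb_and negbK /L /link_weight => /orP[->|nf]; first by rewrite andbF.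
case: ifP => // _; apply/eqP; apply: contraNT nf => h.
have /existsP[S /andP[S0 sS]] := upmass_face pi0 h.
by apply/existsP; exists S; rewrite S0 (subset_trans _ sS) // subsetUr.
Qed.

Lemma link_deg u : \sum_(v in link_verts pi s) L u v = (r - 1) * om u.
Proof.
rewrite -link_weight_row [RHS](bigID (mem (link_verts pi s))) /=.
by rewrite [X in _ + X]big1 ?addr0 // => v; apply: link_weight_notin.
Qed.

Lemma om_notin u : u \notin link_verts pi s -> om u = 0.
Proof.
rewrite inE negb_and negbK /om => /orP[->//|nf]; case: ifP => // _.
by apply/eqP; apply: contraNT nf; apply: upmass_face.
Qed.

Lemma r1_gt0 : 0 < r - 1.
Proof. by rewrite subr_gt0 ltr1n ltn_subRL addn1. Qed.

Lemma sum_om_in (F : V -> R) :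
  \sum_(u in link_verts pi s) om u * F u = \sum_u om u * F u.
Proof.
rewrite [RHS](bigID (mem (link_verts pi s))) /=.
by rewrite [X in _ + X]big1 ?addr0 // => v /om_notin->; rewrite mul0r.
Qed.

Lemma link_eigen (Q : pred R) (f : V -> R) : Q 1 ->
  (forall t : seq R, uniq t -> all Q t ->
    (\sum_(mu <- t) mup mu (char_poly (link_walk pi s)) <= 1)%N) ->
  \sum_u om u * f u = 0 ->
  exists (n : nat) (ev w : 'I_n -> R),
    [/\ forall i, 0 <= w i, forall i, Q (ev i) -> w i = 0,
        \sum_u \sum_v L u v * f u * f v = \sum_i ev i * w i &
        (r - 1) * \sum_u om u * f u ^+ 2 = \sum_i w i].
Proof.
move=> Q1 HQ f0; pose A := link_verts pi s.
have deg_gt0 u : u \in A -> 0 < \sum_(v in A) L u v.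
  rewrite link_deg inE => /andP[us uf]; rewrite mulr_gt0 ?r1_gt0 // /om us.
  exact: face_upmass.
have fdeg : \sum_(u in A) (\sum_(v in A) L u v) * f u = 0.
  under eq_bigr => u _ do rewrite link_deg -mulrA.
  by rewrite -mulr_sumr sum_om_in f0 mulr0.
have [ev [w [w0 wQ E1 E2]]] := @walk_eigen_decomposition R V A L Q (link_walk pi s) f
  erefl link_weight_sym deg_gt0 Q1 HQ fdeg.
exists #|A|, ev, w; split => //.
- rewrite -E1 [LHS](bigID (mem A)) /= [X in _ + X]big1 ?addr0 => [|u uA]; last first.
    by apply: big1 => v _; rewrite link_weight_sym link_weight_notin // !mul0r.
  apply: eq_bigr => u _; rewrite [LHS](bigID (mem A)) /= [X in _ + X]big1 ?addr0 // => v vA.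
  by rewrite link_weight_notin // !mul0r.
- rewrite -E2 -sum_om_in mulr_sumr; apply: eq_bigr => u _.
  by rewrite link_deg mulrA.
Qed.

(** Eigenvalues above [lam] carry no weight in the decomposition of a centered [f]. *)
Lemma link_rayleigh lam (f : V -> R) : lam < 1 -> second_eig_le (link_walk pi s) lam ->
  \sum_u om u * f u = 0 ->
  \sum_u \sum_v L u v * f u * f v <= lam * (r - 1) * \sum_u om u * f u ^+ 2.
Proof.
move=> lam1 H f0.
have [n [ev [w [w0 wQ -> E2]]]] := link_eigen (Q := fun mu => lam < mu) lam1 H f0.
rewrite -mulrA E2 mulr_sumr; apply: ler_sum => i _.
by case: (leP (ev i) lam) => [h|/wQ->]; [apply: ler_wpM2r | rewrite !mulr0].
Qed.

Lemma link_rayleigh2 lam (f : V -> R) : lam < 1 -> two_sided_eig_le (link_walk pi s) lam ->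
  \sum_u om u * f u = 0 ->
  `|\sum_u \sum_v L u v * f u * f v| <= lam * (r - 1) * \sum_u om u * f u ^+ 2.
Proof.
move=> lam1 H f0.
have Q1 : lam < `|1| by rewrite normr1.
have [n [ev [w [w0 wQ -> E2]]]] := link_eigen (Q := fun mu => lam < `|mu|) Q1 H f0.
rewrite -mulrA E2 mulr_sumr; apply: le_trans (ler_norm_sum _ _ _) _.
apply: ler_sum => i _; rewrite normrM (ger0_norm (w0 i)).
by case: (leP `|ev i| lam) => [h|/wQ->]; [apply: ler_wpM2r | rewrite !mulr0].
Qed.

(** Says that link eigenvalues are at least [- 1 / (r - 1)]: on each top face [S], the form plus the
    diagonal is the square of the sum of [f] over [S :\: s]. *)
Lemma link_form_ge (f : V -> R) :
  - \sum_u om u * f u ^+ 2 <= \sum_u \sum_v L u v * f u * f v.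
Proof.
have -> : \sum_u om u * f u ^+ 2 = \sum_(S : {set V} | s \subset S)
    pi S * \sum_(u in S | u \notin s) f u ^+ 2.
  by rewrite sum_om_mul sum_upmassU1.
have -> : \sum_u \sum_v L u v * f u * f v = \sum_(S : {set V} | s \subset S)
    pi S * \sum_(u in S | u \notin s) f u * \sum_(v in S | v \notin u |: s) f v.
  transitivity (\sum_(u | u \notin s) f u * \sum_(v | v \notin u |: s)
     upmass pi (v |: (u |: s)) * f v).
    rewrite [RHS]big_mkcond; apply: eq_bigr => u _ /=; case: ifP => us; last first.
      by apply: big1 => v _; rewrite /L /link_weight us andbF /= !mul0r.
    rewrite mulr_sumr [RHS]big_mkcond; apply: eq_bigr => v _ /=.
    rewrite /L /link_weight us andbT !inE negb_or eq_sym setUCA.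
    case: ifP => _; rewrite ?mul0r //; rewrite /upmass; ring.
  under eq_bigr => u _ do rewrite sum_upmassU1 mulr_sumr.
  rewrite (exchange_big_dep (fun S : {set V} => s \subset S)) /=; last first.
    by move=> u S _; rewrite subUset => /andP[].
  apply: eq_bigr => S sS; rewrite mulr_sumr; apply: eq_big => [u|u _].
    by rewrite subUset sub1set sS andbT andbC.
  by rewrite mulrCA.
rewrite -sumrN; apply: ler_sum => S sS; rewrite -mulrN ler_wpM2l //.
rewrite -subr_ge0 opprK -big_split /=.
have -> : \sum_(u in S | u \notin s) (f u * (\sum_(v in S | v \notin u |: s) f v) + f u ^+ 2)
   = (\sum_(u in S | u \notin s) f u) ^+ 2.
  rewrite expr2 mulr_suml; apply: eq_bigr => u /andP[uS us].
  rewrite expr2 -mulrDr; congr (_ * _).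
  rewrite [RHS](bigD1 u) ?uS //= addrC; congr (_ + _); apply: eq_bigl => v.
  by rewrite !inE negb_or -andbA [(v != u) && _]andbC.
exact: sqr_ge0.
Qed.

Lemma link_cov_of_form gam : 0 <= gam ->
  (forall f : V -> R, \sum_u om u * f u = 0 ->
    `|\sum_u \sum_v L u v * f u * f v| <= gam * (r - 1) * \sum_u om u * f u ^+ 2) ->
  link_cov_le d pi s gam.
Proof.
move=> gam0 H al be al1 be1 /=; rewrite -/r.
have rp : 0 < r by have := r1_gt0; lra.
have om_gt0 : 0 < \sum_u om u by rewrite sum_om mulr_gt0 // face_upmass.
have := form_cov_le link_weight_sym link_weight_row om_ge0 r1_gt0 om_gt0 H gam0 al1 be1.
by rewrite !sum_om_mul sum_om mulrCA !mulrA.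
Qed.

Lemma two_sided_link_cov lam : 0 <= lam < 1 ->
  two_sided_eig_le (link_walk pi s) lam -> link_cov_le d pi s lam.
Proof.
move=> /andP[l0 l1] H; apply: link_cov_of_form => // f f0.
exact: link_rayleigh2.
Qed.

(** The upper bound on the form comes from [lam], the lower one from [link_form_ge], which suffices
    once [1 <= gam * (r - 1)]. *)
Lemma one_sided_link_cov lam gam : lam < 1 -> lam <= gam -> 0 <= gam ->
  1 <= gam * (r - 1) -> second_eig_le (link_walk pi s) lam -> link_cov_le d pi s gam.
Proof.
move=> l1 lg g0 gr H; apply: link_cov_of_form => // f f0.
have F0 : 0 <= \sum_u om u * f u ^+ 2.
  by apply: sumr_ge0 => u _; rewrite mulr_ge0 ?om_ge0 ?sqr_ge0.
rewrite ler_norml; apply/andP; split.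
  apply: le_trans (link_form_ge f); rewrite lerN2; by rewrite ler_peMl.
apply: le_trans (link_rayleigh l1 H f0) _.
by rewrite ler_wpM2r // ler_wpM2r // ltW // r1_gt0.
Qed.

End Links.

(** The Rayleigh bound is applied to the centered [al] on color [a] plus or minus the centered [be]
    on color [b]; only the cross terms survive. Degrees in the link carry a factor [r - 1], which is
    lost. *)
Lemma one_sided_color_cov (R : realType) (V C : finType) (col : V -> C)
    (pi : {set V} -> R) (s : {set V}) (lam : R) :
  is_complex #|C| pi -> (forall S, pi S != 0 -> {in S &, injective col}) ->
  face pi s -> (#|s|.+2 <= #|C|)%N -> 0 <= lam < 1 ->
  second_eig_le (link_walk pi s) lam ->
  color_cov_le col pi s (lam * ((#|C| - #|s|)%:R - 1)).
Proof.
move=> pic pcol sf sC /andP[lam0 lam1] H a b al be aS bS ab al1 be1.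
have pi0 : forall S, 0 <= pi S by case: pic.
have pid S : pi S != 0 -> #|S| = #|C| by apply: complex_card.
have W0 : 0 < upmass pi s := face_upmass pi0 sf.
have W_neq0 : upmass pi s != 0 by rewrite gt_eqF.
set r := _%:R; set W := upmass pi s in W0 W_neq0 *.
have sumW t c : \sum_(v | col v == c) upmass pi (v |: t) = upmass pi t.
  exact: (upmassU1_color pid pcol).
pose mean c (f : V -> R) := (\sum_(u | col u == c) upmass pi (u |: s) * f u) / W.
have meanE c f : \sum_(u | col u == c) upmass pi (u |: s) * f u = mean c f * W.
  by rewrite /mean divfK.
have cent0 c f : \sum_(u | col u == c) upmass pi (u |: s) * (f u - mean c f) = 0.
  under eq_bigr => u _ do rewrite mulrBr.
  by rewrite sumrB -mulr_suml sumW meanE mulrC subrr.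
have cent2 c f : (forall v, `|f v| <= 1) ->
    \sum_(u | col u == c) upmass pi (u |: s) * (f u - mean c f) ^+ 2 <= W.
  move=> f1; have -> : \sum_(u | col u == c) upmass pi (u |: s) * (f u - mean c f) ^+ 2
      = \sum_(u | col u == c) upmass pi (u |: s) * f u ^+ 2 - mean c f ^+ 2 * W.
    have -> : mean c f ^+ 2 * W = 2 * mean c f * (mean c f * W) - mean c f ^+ 2 * W by ring.
    rewrite -{1}meanE /W -(sumW s c) !mulr_sumr -!sumrB; apply: eq_bigr => u _; ring.
  rewrite lerBlDr; apply: (@le_trans _ _ W); last first.
    by rewrite lerDl mulr_ge0 ?sqr_ge0 // ltW.
  rewrite -[leRHS](sumW s c); apply: ler_sum => u _.
  rewrite ler_piMr ?upmass_ge0 //.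
  by rewrite -[f u ^+ 2]real_normK ?num_real // expr_le1.
pose a' v := al v - mean a al; pose b' v := be v - mean b be.
pose T := \sum_(u | col u == a) \sum_(v | col v == b)
  upmass pi (v |: (u |: s)) * a' u * b' v.
have notin c u : c \notin col @: s -> col u == c -> u \notin s.
  by move=> cs /eqP uc; apply: contra cs => us; rewrite -uc imset_f.
have TE : T = \sum_(u | col u == a) \sum_(v | col v == b)
    upmass pi (v |: (u |: s)) * al u * be v - W * mean a al * mean b be.
  have inner u : \sum_(v | col v == b) upmass pi (v |: (u |: s)) * a' u * b' v
     = \sum_(v | col v == b) upmass pi (v |: (u |: s)) * al u * be v
       - mean a al * (\sum_(v | col v == b) upmass pi (u |: (v |: s)) * be v)
       - mean b be * (upmass pi (u |: s) * a' u).
    rewrite -(sumW (u |: s) b) mulr_sumr [X in _ - _ * X]mulr_suml mulr_sumr -!sumrB.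
    by apply: eq_bigr => v _; rewrite [u |: (v |: s)]setUCA /a' /b'; ring.
  rewrite /T; under eq_bigr => u _ do rewrite inner.
  rewrite !sumrB -!mulr_sumr cent0 mulr0 subr0; congr (_ - _).
  have -> : W * mean a al * mean b be = mean a al * (mean b be * W) by ring.
  rewrite -meanE; congr (_ * _); rewrite exchange_big /=.
  by apply: eq_bigr => v _; rewrite -mulr_suml sumW.
have quad (e : R) : e ^+ 2 = 1 -> e * T <= lam * (r - 1) * W.
  move=> e2.
  pose f u := if col u == a then a' u else if col u == b then e * b' u else 0.
  pose om u := if u \notin s then upmass pi (u |: s) else 0.
  have ba : (b == a) = false by rewrite eq_sym; apply/negbTE.
  have omE (g : R -> R) : g 0 = 0 -> \sum_u om u * g (f u)
      = \sum_(u | col u == a) upmass pi (u |: s) * g (a' u)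
        + \sum_(u | col u == b) upmass pi (u |: s) * g (e * b' u).
    move=> g0; rewrite (bigID (fun u => col u == a)) /=; congr (_ + _).
      by apply: eq_bigr => u ua; rewrite /om (notin a) // /f ua.
    rewrite (bigID (fun u => col u == b)) /= [X in _ + X]big1 ?addr0; last first.
      by move=> u /andP[ua ub]; rewrite /f (negbTE ua) (negbTE ub) g0 mulr0.
    apply: eq_big => [u|u /andP[ua ub]].
      by case: (eqVneq (col u) b) => [->|]; rewrite ?ba ?andbF.
    by rewrite /om (notin b) // /f (negbTE ua) ub.
  have f0 : \sum_u om u * f u = 0.
    rewrite (omE id) // cent0 add0r.
    under eq_bigr => u _ do rewrite mulrCA.
    by rewrite -mulr_sumr cent0 mulr0.
  have := link_rayleigh pic sC lam1 H f0.
  rewrite (omE (fun y => y ^+ 2)) ?expr0n // -/r.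
  have -> : \sum_(u | col u == b) upmass pi (u |: s) * (e * b' u) ^+ 2
      = \sum_(u | col u == b) upmass pi (u |: s) * b' u ^+ 2.
    by apply: eq_bigr => u _; rewrite exprMn e2 mul1r.
  have -> : \sum_u \sum_v link_weight pi s u v * f u * f v = 2 * (e * T).
    pose fa u := if col u == a then a' u else 0.
    pose fb u := if col u == b then e * b' u else 0.
    pose B (g h : V -> R) := \sum_u \sum_v link_weight pi s u v * g u * h v.
    have fE u : f u = fa u + fb u.
      rewrite /f /fa /fb; case: (eqVneq (col u) a) => [->|_]; last by rewrite add0r.
      by rewrite (negbTE ab) addr0.
    (* Distinct vertices of one color lie in no common top face, so a color class spans no edges. *)
    have same c (g h : V -> R) : (forall u, col u != c -> g u = 0) ->
        (forall u, col u != c -> h u = 0) -> B g h = 0.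
      move=> g0 h0; apply: big1 => u _; apply: big1 => v _.
      case: (eqVneq (col u) c) => [uc|/g0->]; last by rewrite mulr0 mul0r.
      case: (eqVneq (col v) c) => [vc|/h0->]; last by rewrite mulr0.
      rewrite /link_weight; case: (eqVneq u v) => [|uv]; first by rewrite !mul0r.
      case: ifP => _; rewrite ?mul0r // -/(upmass pi _).
      rewrite (@upmass_color0 _ _ _ col pi pcol _ u v) ?mul0r ?uc ?vc //.
        by rewrite setU11.
      by rewrite !inE eqxx orbT.
    have BabE : B fa fb = e * T.
      rewrite /T mulr_sumr [RHS]big_mkcond; apply: eq_bigr => u _ /=.
      rewrite /fa; case: ifP => ua; last by apply: big1 => v _; rewrite mulr0 mul0r.
      rewrite mulr_sumr [RHS]big_mkcond; apply: eq_bigr => v _ /=.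
      rewrite /fb; case: ifP => vb; last by rewrite mulr0.
      have uv : u != v by apply: contraNneq ab => uv; rewrite -(eqP ua) -(eqP vb) uv.
      rewrite /link_weight uv (notin a) // (notin b) //= -/(upmass pi _) setUCA; ring.
    have BbaE : B fb fa = e * T.
      rewrite -BabE /B exchange_big; apply: eq_bigr => u _; apply: eq_bigr => v _ /=.
      by rewrite link_weight_sym; ring.
    transitivity (B fa fa + B fa fb + (B fb fa + B fb fb)).
      rewrite /B -!big_split; apply: eq_bigr => u _ /=.
      rewrite -!big_split; apply: eq_bigr => v _ /=; rewrite !fE; ring.
    rewrite (same a fa fa) ?(same b fb fb) ?BabE ?BbaE; first by ring.
    - by move=> u /negbTE; rewrite /fb => ->.
    - by move=> u /negbTE; rewrite /fb => ->.
    - by move=> u /negbTE; rewrite /fa => ->.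
    - by move=> u /negbTE; rewrite /fa => ->.
  have na : \sum_(u | col u == a) upmass pi (u |: s) * a' u ^+ 2 <= W := cent2 a al al1.
  have nb : \sum_(u | col u == b) upmass pi (u |: s) * b' u ^+ 2 <= W := cent2 b be be1.
  move=> h; rewrite -(ler_pM2l (ltr0Sn R 1)); apply: le_trans h _.
  rewrite [leRHS]mulrCA ler_wpM2l ?mulr_ge0 //; last by lra.
  by rewrite /r subr_ge0 ler1n subn_gt0 ltnW.
have -> : (\sum_(u | col u == a) \sum_(v | col v == b)
       upmass pi (v |: (u |: s)) * al u * be v) / W
    - (\sum_(u | col u == a) upmass pi (u |: s) * al u) / W
      * ((\sum_(u | col u == b) upmass pi (u |: s) * be u) / W) = T / W.
  by rewrite TE -/(mean a al) -/(mean b be); field.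
have := quad (-1); rewrite sqrrN expr1n mulN1r => /(_ erefl) q1.
have := quad 1; rewrite expr1n mul1r => /(_ erefl) q2.
by rewrite normrM normfV (gtr0_norm W0) ler_pdivrMr // ler_norml lerNl q1 q2.
Qed.

(** * Exponential concentration from the gap of the down-up walk *)

Section DownUp.
Variables (R : realType) (V : finType) (D : nat) (pi : {set V} -> R) (c : R).
Hypothesis pic : is_complex D pi.
Hypothesis D_gt0 : (0 < D)%N.
Hypothesis c_gt0 : 0 < c.
Hypothesis gap : second_eig_le (downup_walk D pi) (1 - c / D%:R).
Implicit Types (S t : {set V}) (F : {set V} -> R).

Let pi0 : forall S, 0 <= pi S. Proof. by case: pic. Qed.
Let pi1 : \sum_S pi S = 1. Proof. by case: pic => _ []. Qed.
Let pid : forall S, pi S != 0 -> #|S| = D.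
Proof. by move=> S; apply: complex_card. Qed.
Let DR_gt0 : 0 < D%:R :> R. Proof. by rewrite ltr0n. Qed.
Let DR_neq0 : D%:R != 0 :> R. Proof. by rewrite gt_eqF. Qed.

(** [pi S] times the probability of stepping to [S']: a common facet [t] is reached with probability
    [1 / D] and left for [S'] with probability [pi S' / upmass pi t]. This form shows the
    symmetry. *)
Definition downup_weight S S' : R := pi S * pi S' *
  \sum_(t : {set V} | [&& t \subset S, t \subset S' & #|t|.+1 == D])
    (D%:R * upmass pi t)^-1.

Lemma downup_weight_sym S S' : downup_weight S S' = downup_weight S' S.
Proof.
rewrite /downup_weight [pi S * _]mulrC; congr (_ * _); apply: eq_bigl => t.
by rewrite andbCA.
Qed.

Lemma downup_weight_ge0 S S' : 0 <= downup_weight S S'.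
Proof.
rewrite !mulr_ge0 //; apply: sumr_ge0 => t _.
by rewrite invr_ge0 mulr_ge0 ?upmass_ge0.
Qed.

Lemma sum_facets S (h : {set V} -> R) : #|S| = D ->
  \sum_(v in S) h (S :\ v) = \sum_(t : {set V} | (t \subset S) && (#|t|.+1 == D)) h t.
Proof.
move=> SD; rewrite -(big_imset h) /=; last first.
  move=> u v uS vS e; apply/eqP; apply: contraT => uv.
  have : v \in S :\ u by rewrite !inE eq_sym uv.
  by rewrite e !inE eqxx.
apply: eq_bigl => t; apply/imsetP/andP => [[v vS ->]|[tS /eqP tD]].
  by rewrite subsetDl -SD [in X in _ == X](cardsD1 v) vS.
have [v vE] : exists v, S :\: t = [set v].
  by apply/cards1P; rewrite cardsDS // SD -tD subSnn.
have : v \in S :\: t by rewrite vE set11.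
rewrite inE => /andP[vt vS]; exists v => //.
apply/setP => u; rewrite !inE.
have := congr1 (fun X : {set V} => u \in X) vE; rewrite !inE => <-.
by case: (boolP (u \in t)) => [/(subsetP tS)->|_]; case: (u \in S).
Qed.

Lemma downup_weight_row S : \sum_S' downup_weight S S' = pi S.
Proof.
have [S0|S0] := eqVneq (pi S) 0.
  by rewrite S0 big1 // => S' _; rewrite /downup_weight S0 !mul0r.
have SD := pid S0.
transitivity (pi S * \sum_(t : {set V} | (t \subset S) && (#|t|.+1 == D)) D%:R^-1).
  under eq_bigr => S' _ do rewrite /downup_weight -mulrA mulr_sumr.
  rewrite -mulr_sumr (exchange_big_dep (fun t => (t \subset S) && (#|t|.+1 == D))) /=;
    last by move=> S' t _ /and3P[-> _ ->].
  congr (_ * _); apply: eq_bigr => t /andP[tS tD].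
  rewrite (eq_bigl (fun S' => t \subset S')); last by move=> S'; rewrite tS tD andbT.
  rewrite -mulr_suml -/(upmass pi t) invfM mulrCA mulfV ?mulr1 //.
  rewrite gt_eqF //; apply: face_upmass => //; apply/existsP; exists S.
  by rewrite lt_def S0 pi0.
rewrite -(sum_facets (fun=> D%:R^-1) SD) sumr_const SD -[_ *+ D]mulr_natr.
by rewrite mulVf ?mulr1.
Qed.

Lemma downup_walkE : downup_walk D pi = \matrix_(a, b)
  (downup_weight (enum_val a) (enum_val b)
   / \sum_(S in top_faces pi) downup_weight (enum_val a) S).
Proof.
apply/matrixP => a b; rewrite !mxE; set S : {set V} := enum_val a; set S' := enum_val b.
have S0 : 0 < pi S by have := enum_valP a; rewrite inE.
have S_neq0 : pi S != 0 by rewrite gt_eqF.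
have -> : \sum_(T in top_faces pi) downup_weight S T = pi S.
  rewrite -[RHS]downup_weight_row [RHS](bigID (mem (top_faces pi))) /=.
  rewrite [X in _ + X]big1 ?addr0 // => T; rewrite inE -leNgt => T0.
  have T0' : pi T = 0 by apply/eqP; rewrite eq_le T0 pi0.
  by rewrite /downup_weight T0' mulr0 mul0r.
rewrite /downup_weight mulrAC [pi S * _]mulrC mulfK // mulrC.
pose g t := if t \subset S' then (D%:R * upmass pi t)^-1 * pi S' else 0.
transitivity (\sum_(v in S) g (S :\ v)).
  apply: eq_bigr => v vS; rewrite /g; case: ifP => // _; rewrite /upmass invfM.
  by rewrite mulrA mulrAC -!mulrA [_^-1 * pi S']mulrC.
rewrite (sum_facets g (pid S_neq0)) mulr_suml [LHS]big_mkcond [RHS]big_mkcond.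
apply: eq_bigr => t _ /=; rewrite /g.
by case: (t \subset S); case: (t \subset S'); case: (_ == D).
Qed.

Lemma downup_dirichlet F : \sum_S pi S * F S ^+ 2
    - \sum_S \sum_S' downup_weight S S' * F S * F S'
  = 2^-1 * \sum_S \sum_S' downup_weight S S' * (F S - F S') ^+ 2.
Proof.
have e1 : \sum_S \sum_S' downup_weight S S' * F S ^+ 2 = \sum_S pi S * F S ^+ 2.
  by apply: eq_bigr => S _; rewrite -mulr_suml downup_weight_row.
have e2 : \sum_S \sum_S' downup_weight S S' * F S' ^+ 2 = \sum_S pi S * F S ^+ 2.
  rewrite exchange_big -e1; apply: eq_bigr => S _; apply: eq_bigr => S' _.
  by rewrite downup_weight_sym.
have -> : \sum_S \sum_S' downup_weight S S' * (F S - F S') ^+ 2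
  = \sum_S \sum_S' downup_weight S S' * F S ^+ 2
    + \sum_S \sum_S' downup_weight S S' * F S' ^+ 2
    - 2 * \sum_S \sum_S' downup_weight S S' * F S * F S'.
  rewrite mulr_sumr -big_split -sumrB; apply: eq_bigr => S _ /=.
  rewrite mulr_sumr -big_split -sumrB; apply: eq_bigr => S' _ /=; ring.
rewrite e1 e2; lra.
Qed.

(** The gap bounds the form on the centered [F], and [downup_dirichlet] rewrites variance minus form
    as the mean squared variation along a step. *)
Lemma downup_poincare F :
  \sum_S pi S * F S ^+ 2 - (\sum_S pi S * F S) ^+ 2 <=
  D%:R / c * (2^-1 * \sum_S \sum_S' downup_weight S S' * (F S - F S') ^+ 2).
Proof.
have [m mE] : exists m, m = \sum_S pi S * F S by exists (\sum_S pi S * F S).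
rewrite -mE; pose g S := F S - m; pose T := top_faces pi.
have piT S : S \notin T -> pi S = 0.
  by rewrite inE -leNgt => S0; apply/eqP; rewrite eq_le S0 pi0.
have degE S : \sum_(S' in T) downup_weight S S' = pi S.
  rewrite -[RHS]downup_weight_row [RHS](bigID (mem T)) /=.
  rewrite [X in _ + X]big1 ?addr0 // => S' /piT h.
  by rewrite /downup_weight h mulr0 mul0r.
have sumT (G : {set V} -> R) : \sum_(S in T) pi S * G S = \sum_S pi S * G S.
  rewrite [RHS](bigID (mem T)) /= [X in _ + X]big1 ?addr0 // => S /piT->.
  by rewrite mul0r.
have g0 : \sum_(S in T) (\sum_(S' in T) downup_weight S S') * g S = 0.
  under eq_bigr => S _ do rewrite degE.
  rewrite sumT; under eq_bigr => S _ do rewrite mulrBr.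
  by rewrite sumrB -mulr_suml pi1 mul1r mE subrr.
have deg_gt0 S : S \in T -> 0 < \sum_(S' in T) downup_weight S S'.
  by rewrite degE inE.
have Q1 : 1 - c / D%:R < 1 by rewrite ltrBlDr ltrDl divr_gt0.
have [ev [w [w0 wQ E1 E2]]] := @walk_eigen_decomposition R {set V} T downup_weight
  (fun mu => 1 - c / D%:R < mu) (downup_walk D pi) g downup_walkE downup_weight_sym
  deg_gt0 Q1 gap g0.
have E1' : \sum_S \sum_S' downup_weight S S' * g S * g S' = \sum_i ev i * w i.
  rewrite -E1 [LHS](bigID (mem T)) /= [X in _ + X]big1 ?addr0 => [|S /piT h]; last first.
    by apply: big1 => S' _; rewrite /downup_weight h !mul0r.
  apply: eq_bigr => S _; rewrite [LHS](bigID (mem T)) /= [X in _ + X]big1 ?addr0 // => S' /piT h.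
  by rewrite /downup_weight h mulr0 !mul0r.
have E2' : \sum_S pi S * g S ^+ 2 = \sum_i w i.
  by rewrite -E2 -sumT; apply: eq_bigr => S _; rewrite degE.
have varE : \sum_S pi S * F S ^+ 2 - m ^+ 2 = \sum_S pi S * g S ^+ 2.
  have -> : m ^+ 2 = 2 * m * (\sum_S pi S * F S) - m ^+ 2 * \sum_S pi S.
    by rewrite pi1 -mE; ring.
  rewrite !mulr_sumr -!sumrB; apply: eq_bigr => S _; rewrite /g; ring.
have -> : \sum_S \sum_S' downup_weight S S' * (F S - F S') ^+ 2
    = \sum_S \sum_S' downup_weight S S' * (g S - g S') ^+ 2.
  apply: eq_bigr => S _; apply: eq_bigr => S' _; congr (_ * _ ^+ 2); rewrite /g; ring.
rewrite varE -downup_dirichlet E2' E1'.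
have : \sum_i ev i * w i <= (1 - c / D%:R) * \sum_i w i.
  rewrite mulr_sumr; apply: ler_sum => i _.
  by case: (leP (ev i) (1 - c / D%:R)) => [h|/wQ->]; [apply: ler_wpM2r | rewrite !mulr0].
rewrite mulrBl mul1r => h.
rewrite mulrAC ler_pdivlMr // -ler_pdivrMl // mulrCA.
by rewrite [D%:R^-1 * _]mulrC mulrA; move: h; rewrite mulrAC [_ * c]mulrC; lra.
Qed.

Variables (i : nat) (f : {set V} -> R).
Hypothesis i_bounds : (0 < i <= D)%N.
Hypothesis f01 : forall t, 0 <= f t <= 1.

(** The sum over the facet is normalized by ['C(D, i)], so that it can be compared with any top face
    above [t]. It misses the [i]-sets through the deleted vertex, a fraction
    ['C(D.-1, i.-1) / 'C(D, i) = i / D]. *)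
Lemma subset_avg_facet_diff S t : #|S| = D -> t \subset S -> #|t|.+1 = D ->
  0 <= subset_avg i S f - (\sum_(A : {set V} | (A \subset t) && (#|A| == i)) f A)
    / 'C(D, i)%:R <= i%:R / D%:R.
Proof.
move=> SD tS tD; rewrite /subset_avg SD -mulrBl.
have C0 : 0 < 'C(D, i)%:R :> R by rewrite ltr0n bin_gt0; case/andP: i_bounds.
have -> : \sum_(A : {set V} | (A \subset S) && (#|A| == i)) f A
    - \sum_(A : {set V} | (A \subset t) && (#|A| == i)) f A
  = \sum_(A : {set V} | (A \subset S) && (#|A| == i) && ~~ (A \subset t)) f A.
  rewrite [X in X - _](bigID (fun A : {set V} => A \subset t)) /= addrAC.
  rewrite [X in X - _](eq_bigl (fun A : {set V} => (A \subset t) && (#|A| == i))).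
    by rewrite subrr add0r.
  move=> A; case: (boolP (A \subset t)) => At; last by rewrite andbF.
  by rewrite (subset_trans At tS) andbT.
apply/andP; split.
  by rewrite divr_ge0 // sumr_ge0 // => A _; case/andP: (f01 A).
apply: (@le_trans _ _ ((\sum_(A : {set V} | (A \subset S) && (#|A| == i) && ~~ (A \subset t)) 1)
  / 'C(D, i)%:R)).
  rewrite ler_pM2r ?invr_gt0 //; apply: ler_sum => A _; by case/andP: (f01 A).
rewrite ler_pdivrMr // sumr_const.
have cardE : ('C(D.-1, i) + #|[pred A : {set V} | (A \subset S) && (#|A| == i) && ~~ (A \subset t)]|
   = 'C(D, i))%N.
  rewrite -[in RHS]SD -cards_draws -(cardID [pred A : {set V} | A \subset t]); congr (_ + _)%N.
    rewrite -tD /= -cards_draws; apply: eq_card => A; rewrite !inE.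
    by case: (boolP (A \subset t)) => [/subset_trans/(_ tS)->|]; rewrite ?andbF ?andbT.
  by apply: eq_card => A; rewrite !inE andbC.
have -> : #|[pred A : {set V} | (A \subset S) && (#|A| == i) && ~~ (A \subset t)]|
    = 'C(D.-1, i.-1).
  apply/eqP; rewrite -(eqn_add2l 'C(D.-1, i)) cardE.
  by move: i_bounds D_gt0; case: (i) => // i'; case: (D) => // D' _ _; rewrite binS.
rewrite mulrAC ler_pdivlMr // -!natrM ler_nat.
case/andP: i_bounds => i0 _.
by have := mul_bin_diag D i.-1; rewrite prednK // mulnC => ->.
Qed.

Lemma subset_avg_downup_lipschitz S S' : downup_weight S S' != 0 ->
  `|subset_avg i S f - subset_avg i S' f| <= i%:R / D%:R.
Proof.
rewrite /downup_weight !mulf_eq0 !negb_or -andbA => /and3P[/pid SD /pid SD' h].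
have [t /and3P[tS tS' /eqP tD]] : exists t : {set V},
    [&& t \subset S, t \subset S' & #|t|.+1 == D].
  apply/existsP; apply: contraNT h => /existsPn H; rewrite big_pred0 // => t.
  exact/negbTE.
have /andP[a1 a2] := subset_avg_facet_diff SD tS tD.
have /andP[b1 b2] := subset_avg_facet_diff SD' tS' tD.
by rewrite ler_norml; apply/andP; split; lra.
Qed.

Let mu := face_mean D pi i f.
Let M (lam : R) := \sum_S pi S * expR (lam * (subset_avg i S f - mu)).
Let h : R := i%:R ^+ 2 / (4 * c * D%:R).

Let h_ge0 : 0 <= h.
Proof. by rewrite divr_ge0 ?sqr_ge0 // !mulr_ge0 // ltW. Qed.

(** The Poincare inequality for [G], the square root of the exponential: [G] has second moment
    [M lam] and mean [M (lam / 2)], and its variation along a step is controlled by [sqr_expRB_le]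
    and the Lipschitz bound. The constants combine to [h]. *)
Lemma downup_mgf_halve lam : (1 - h * lam ^+ 2) * M lam <= M (lam / 2) ^+ 2.
Proof.
pose G S := expR (lam / 2 * (subset_avg i S f - mu)).
have G2 S : G S ^+ 2 = expR (lam * (subset_avg i S f - mu)).
  by rewrite /G -expRM_natl; congr expR; field.
have := downup_poincare G.
have -> : \sum_S pi S * G S ^+ 2 = M lam by apply: eq_bigr => S _; rewrite G2.
rewrite -/(M (lam / 2)) => P.
have bound : \sum_S \sum_S' downup_weight S S' * (G S - G S') ^+ 2
    <= (lam / 2 * (i%:R / D%:R)) ^+ 2 * (2 * M lam).
  apply: (@le_trans _ _ (\sum_S \sum_S' downup_weight S S' *
      ((lam / 2 * (i%:R / D%:R)) ^+ 2 * (G S ^+ 2 + G S' ^+ 2)))).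
    apply: ler_sum => S _; apply: ler_sum => S' _.
    have [->|L0] := eqVneq (downup_weight S S') 0; first by rewrite !mul0r.
    apply: ler_wpM2l; first exact: downup_weight_ge0.
    apply: le_trans (sqr_expRB_le _ _) _.
    have e x : expR (2 * (lam / 2 * x)) = expR (lam / 2 * x) ^+ 2.
      by rewrite expRM_natl.
    rewrite !e -/(G S) -/(G S'); apply: ler_wpM2r; first by rewrite addr_ge0 ?sqr_ge0.
    have -> : lam / 2 * (subset_avg i S f - mu) - lam / 2 * (subset_avg i S' f - mu)
      = lam / 2 * (subset_avg i S f - subset_avg i S' f) by ring.
    rewrite ![(lam / 2 * _) ^+ 2]exprMn ler_wpM2l ?sqr_ge0 //.
    rewrite -[leLHS]real_normK ?num_real // lerXn2r ?nnegrE ?divr_ge0 //.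
    exact: subset_avg_downup_lipschitz.
  set K := (_ ^+ 2).
  have -> : \sum_S \sum_S' downup_weight S S' * (K * (G S ^+ 2 + G S' ^+ 2))
    = K * (\sum_S \sum_S' downup_weight S S' * G S ^+ 2
      + \sum_S \sum_S' downup_weight S S' * G S' ^+ 2).
    rewrite -big_split mulr_sumr; apply: eq_bigr => S _ /=.
    rewrite -big_split mulr_sumr; apply: eq_bigr => S' _ /=; ring.
  rewrite ler_wpM2l ?sqr_ge0 //.
  have e1 : \sum_S \sum_S' downup_weight S S' * G S ^+ 2 = M lam.
    by apply: eq_bigr => S _; rewrite -mulr_suml downup_weight_row G2.
  rewrite e1 exchange_big /=.
  have -> : \sum_S \sum_S' downup_weight S' S * G S ^+ 2 = M lam.
    rewrite -e1; apply: eq_bigr => S _; apply: eq_bigr => S' _.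
    by rewrite downup_weight_sym.
  by rewrite mulrDl mul1r.
have : D%:R / c * (2^-1 * \sum_S \sum_S' downup_weight S S' * (G S - G S') ^+ 2)
    <= h * lam ^+ 2 * M lam.
  apply: (@le_trans _ _ (D%:R / c * (2^-1 *
      ((lam / 2 * (i%:R / D%:R)) ^+ 2 * (2 * M lam))))).
    have Dc : 0 <= D%:R / c by rewrite divr_ge0 // ltW.
    by rewrite (ler_wpM2l Dc) // ler_wpM2l.
  rewrite le_eqVlt; apply/orP; left; apply/eqP; rewrite /h; field.
  by rewrite DR_neq0 gt_eqF.
by move: P; rewrite mulrBl mul1r; lra.
Qed.

(** Hoeffding's bound starts the induction. A halving step adds [2 * h * lam ^+ 2] to the exponent;
    as each further halving comes with a squaring, the additions decrease geometrically and sum to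
    at most [4 * h * lam ^+ 2]. *)
Lemma downup_mgf_le_pow2 (N : nat) lam : `|lam| <= 2 ^+ N / 2 -> h * lam ^+ 2 <= 2^-1 ->
  M lam <= expR (4 * h * lam ^+ 2 + 2 * lam ^+ 2 / 2 ^+ N).
Proof.
elim: N lam => [|N IH] lam lamN hlam.
  have -> : M lam = \sum_S pi S * expR (lam * (subset_avg i S f - \sum_S pi S * subset_avg i S f)).
    by rewrite /M /mu /face_mean sum_pijE.
  rewrite expr0 divr1; apply: le_trans (hoeffding_expR pi0 pi1 _ _) _.
  - have avg01 S := subset_avg01 i S f01.
    move=> S; have /andP[a0 a1] := avg01 S.
    have m0 : 0 <= \sum_S pi S * subset_avg i S f.
      by apply: sumr_ge0 => S' _; rewrite mulr_ge0 //; case/andP: (avg01 S').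
    have m1 : \sum_S pi S * subset_avg i S f <= 1.
      by rewrite -[leRHS]pi1; apply: ler_sum => S' _; rewrite ler_piMr //; case/andP: (avg01 S').
    by rewrite ler_norml; apply/andP; split; lra.
  - by move: lamN; rewrite expr0 mul1r.
  - by rewrite ler_expR lerDr mulr_ge0 ?sqr_ge0 // mulr_ge0.
have lam2 : (lam / 2) ^+ 2 = lam ^+ 2 / 4 by field.
have hlam0 : 0 <= h * lam ^+ 2 by rewrite mulr_ge0 ?sqr_ge0.
have {}IH := IH (lam / 2).
have lamN' : `|lam / 2| <= 2 ^+ N / 2.
  rewrite exprS in lamN; rewrite normrM [`|2^-1|]gtr0_norm ?invr_gt0 //; lra.
have hlam' : h * (lam / 2) ^+ 2 <= 2^-1 by rewrite lam2 mulrA; lra.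
have {IH} := IH lamN' hlam'; set E := expR _ => IH.
have M0 x : 0 <= M x by apply: sumr_ge0 => S _; rewrite mulr_ge0 ?expR_ge0.
have H1 : (1 - h * lam ^+ 2) * M lam <= E ^+ 2.
  apply: le_trans (downup_mgf_halve lam) _.
  by rewrite lerXn2r ?nnegrE ?expR_ge0.
have p1 : 0 < 1 - h * lam ^+ 2 by lra.
(* The inverse of [1 - y] is at most [expR (2 * y)] for [0 <= y <= 1/2]. *)
have H2 : 1 <= (1 - h * lam ^+ 2) * expR (2 * (h * lam ^+ 2)).
  apply: (@le_trans _ _ ((1 - h * lam ^+ 2) * (1 + 2 * (h * lam ^+ 2)))).
    by have := mulr_ge0 hlam0 (ltW p1); nra.
  by rewrite ler_pM2l // expR_ge1Dx.
have -> : expR (4 * h * lam ^+ 2 + 2 * lam ^+ 2 / 2 ^+ N.+1)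
    = E ^+ 2 * expR (2 * (h * lam ^+ 2)).
  rewrite /E -expRM_natl -expRD; congr expR; rewrite lam2 [2 ^+ N.+1]exprS.
  have id (H L Q : R) : Q != 0 ->
      4 * H * L + 2 * L / (2 * Q) = 2 * (4 * H * (L / 4) + 2 * (L / 4) / Q) + 2 * (H * L).
    by move=> Q0; field.
  by apply: id; rewrite expf_neq0.
rewrite -(ler_pM2l p1) [leRHS]mulrCA; apply: le_trans H1 _.
by rewrite ler_peMr ?sqr_ge0.
Qed.

(** For large [N] the term [2 * lam ^+ 2 / 2 ^+ N] is at most 1, and [4 * h * lam ^+ 2] is at most
    2. *)
Lemma downup_mgf_le lam : h * lam ^+ 2 <= 2^-1 -> M lam <= expR 3.
Proof.
move=> hlam.
have [N HN] : exists N : nat, 2 * lam ^+ 2 + 2 * `|lam| <= 2 ^+ N.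
  pose x := 2 * lam ^+ 2 + 2 * `|lam|.
  have x0 : 0 <= x by rewrite addr_ge0 // mulr_ge0 ?sqr_ge0.
  exists (Num.truncn x).+1; apply: ltW.
  apply: lt_le_trans (truncnS_gt x) _.
  rewrite -natrX ler_nat; exact: ltnW (ltn_expl _ _).
have lam0 := sqr_ge0 lam; have nlam0 := normr_ge0 lam.
have N0 : 0 < 2 ^+ N :> R by rewrite exprn_gt0.
apply: le_trans (@downup_mgf_le_pow2 N lam _ hlam) _.
  by rewrite ler_pdivlMr //; lra.
rewrite ler_expR.
have : 2 * lam ^+ 2 / 2 ^+ N <= 1 by rewrite ler_pdivrMr // mul1r; lra.
by rewrite -[4 * h * _]mulrA; lra.
Qed.

End DownUp.

(** Given the top face, comparison with [m] independent [i]-subsets gives the factor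
    [expR (2 * th ^+ 2) ^+ m] times the exponential of [m * th] times the deviation of the average
    over the whole top face, which [downup_mgf_le] bounds. *)
Lemma mgf_downup (R : realType) (V : finType) (D : nat) (pi : {set V} -> R) (c : R)
    k i m (th : R) (f : {set V} -> R) :
  is_complex D pi -> 0 < c -> second_eig_le (downup_walk D pi) (1 - c / D%:R) ->
  (0 < i <= k)%N -> (m * i <= k)%N -> (k <= D)%N -> (2 * k ^ 2 <= D)%N ->
  (forall t, 0 <= f t <= 1) -> `|th| <= 2^-1 -> th ^+ 2 <= 4 * c ->
  mgf D pi k i (m%:R * th) f <= expR (2 * th ^+ 2) ^+ m * expR 3.
Proof.
move=> pic c0 gap /andP[i0 ik] mik kD kkD f01 th_le thc.
have D0 : (0 < D)%N by apply: leq_trans kD; apply: leq_trans ik.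
have iD : (0 < i <= D)%N by rewrite i0 (leq_trans ik).
have pic' : is_complex #|'I_D| pi by rewrite card_ord.
have Prl : realizes (order_law (C := 'I_D) pi) pi.
  by apply: order_law_realizes => //; rewrite card_ord.
have := mgf_expect k i (m%:R * th) f pic' Prl; rewrite card_ord => ->.
set mu := face_mean D pi i f.
apply: (@le_trans _ _ (expect (order_law (C := 'I_D) pi) (fun w : {ffun 'I_D -> V} =>
   expR (2 * th ^+ 2) ^+ m *
   expR (m%:R * th * (subset_avg i [set: 'I_D] (fun A => f (w @: A)) - mu))))).
  apply: le_expect => [|w]; first by case: Prl.
  set Fw := subset_avg i _ _.
  apply: (@le_trans _ _ (subset_avg k [set: 'I_D] (fun K =>
      expR (m%:R * th * subset_avg i K (fun A => f (w @: A) - mu))))).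
    apply: le_subset_avg => K _ Kk.
    by rewrite subset_avgB subset_avg_cst ?Kk.
  apply: le_trans (expR_subset_avg_iid _ _ mik _ _) _; rewrite ?card_ord //.
    exact: leq_trans kD.
  have -> : expR (m%:R * th * (Fw - mu)) = expR (th * (Fw - mu)) ^+ m.
    by rewrite -expRM_natl mulrA.
  have avg0 : 0 <= subset_avg i [set: 'I_D] (fun A => expR (th * (f (w @: A) - mu))).
    by rewrite /subset_avg divr_ge0 // sumr_ge0 // => A _; rewrite expR_ge0.
  rewrite -exprMn lerXn2r ?nnegrE ?avg0 ?(mulr_ge0 (expR_ge0 _) (expR_ge0 _)) //.
  have -> : subset_avg i [set: 'I_D] (fun A => expR (th * (f (w @: A) - mu)))
    = expR (th * (Fw - mu)) * subset_avg i [set: 'I_D] (fun A => expR (th * (f (w @: A) - Fw))).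
    rewrite -subset_avgM; apply: eq_subset_avg => A _ _.
    by rewrite -expRD; congr expR; ring.
  rewrite mulrC ler_wpM2r ?expR_ge0 //.
  apply: hoeffding_subset_avg => //; rewrite cardsT card_ord; by case/andP: iD.
rewrite expectM ler_wpM2l ?exprn_ge0 ?expR_ge0 //.
have -> : expect (order_law (C := 'I_D) pi) (fun w : {ffun 'I_D -> V} =>
   expR (m%:R * th * (subset_avg i [set: 'I_D] (fun A => f (w @: A)) - mu)))
  = \sum_S pi S * expR (m%:R * th * (subset_avg i S f - mu)).
  case: Prl => _ Pinj ->; apply: eq_bigr => w _.
  have [->|w0] := eqVneq (order_law pi w) 0; first by rewrite !mul0r.
  by rewrite subset_avg_imset // => x y _ _; apply: Pinj.
apply: (downup_mgf_le pic D0 c0 gap iD f01).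
have DR : 0 < D%:R :> R by rewrite ltr0n.
rewrite mulrAC ler_pdivrMr ?mulr_gt0 //.
(* With [th ^+ 2 <= 4 * c], this puts [m * th] in the range of [downup_mgf_le]. *)
have mi : (i%:R * m%:R) ^+ 2 * 2 <= D%:R :> R.
  rewrite -natrM -natrX -natrM ler_nat; apply: leq_trans kkD.
  by rewrite mulnC leq_mul2l /= leq_sqr mulnC.
have -> : i%:R ^+ 2 * (m%:R * th) ^+ 2 = ((i%:R * m%:R) ^+ 2 * th ^+ 2 :> R) by ring.
apply: (@le_trans _ _ ((D%:R / 2) * (4 * c))); last by rewrite le_eqVlt; apply/orP; left; apply/eqP; field.
apply: ler_pM => //; rewrite ?sqr_ge0 //.
by rewrite ler_pdivlMr.
Qed.

(** * From moment generating functions to samplers *)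

Section Sampler.
Variables (R : realType) (V : finType).
Implicit Types (pi f : {set V} -> R).

Lemma face_mean01 d pi i f : is_complex d pi -> (forall t, 0 <= f t <= 1) ->
  0 <= face_mean d pi i f <= 1.
Proof.
move=> pic f01; rewrite /face_mean sum_pijE //; case: pic => pi0 [_ pi1].
have avg01 S := subset_avg01 i S f01.
apply/andP; split.
  by apply: sumr_ge0 => S _; rewrite mulr_ge0 //; case/andP: (avg01 S).
by rewrite -[leRHS]pi1; apply: ler_sum => S _; rewrite ler_piMr //; case/andP: (avg01 S).
Qed.

Lemma pij_ge0 d pi k s : is_complex d pi -> 0 <= pij d pi k s.
Proof.
by case=> pi0 _; rewrite /pij; case: ifP => // _; rewrite divr_ge0 // sumr_ge0.
Qed.

Lemma sampler_tail_le d pi k i f (lam eps : R) :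
  is_complex d pi -> 0 <= lam ->
  \sum_(s : {set V} | eps < `|(\sum_(t : {set V} | (t \subset s) && (#|t| == i)) f t)
      / 'C(k, i)%:R - face_mean d pi i f|) pij d pi k s
  <= expR (- (lam * eps)) * (mgf d pi k i lam f + mgf d pi k i (- lam) f).
Proof.
move=> pic lam0; rewrite /mgf -big_split mulr_sumr [leLHS]big_mkcond.
apply: ler_sum => s _ /=.
rewrite -mulrDr mulrCA.
have p0 := pij_ge0 k s pic.
have E0 x y : 0 <= expR x + expR y :> R by rewrite addr_ge0 ?expR_ge0.
have [sk|sk] := eqVneq #|s| k; last first.
  by have -> : pij d pi k s = 0; [rewrite /pij (negbTE sk) | rewrite mul0r; case: ifP].
case: ifP => [|_]; last by rewrite mulr_ge0 // mulr_ge0 ?expR_ge0.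
rewrite -{1}sk -/(subset_avg i s f).
set x := subset_avg i s f - _ => tail.
rewrite -[leLHS]mulr1 ler_wpM2l //.
rewrite mulrDr -!expRD.
have ge1 y : 0 <= y -> 1 <= expR y :> R by move=> y0; rewrite -expR0 ler_expR.
have [x0|x0] := leP 0 x.
  rewrite (ger0_norm x0) in tail.
  apply: (@le_trans _ _ (expR (- (lam * eps) + lam * x))); last by rewrite lerDl expR_ge0.
  by apply: ge1; rewrite addrC subr_ge0 ler_wpM2l // ltW.
rewrite (ltr0_norm x0) in tail.
apply: (@le_trans _ _ (expR (- (lam * eps) + - lam * x))); last by rewrite lerDr expR_ge0.
by apply: ge1; rewrite addrC mulNr -mulrN subr_ge0 ler_wpM2l // ltW.
Qed.

(** Chernoff's bound at [th = th1 * eps]: as [th1 <= 1/8], the exponent [- m th eps + 4 m th^2] is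
    at most [- m th1 eps^2 / 2], and [k0 / i <= 2 m]. Keeping [k0] apart from [k] lets a bound in
    terms of one level serve at a higher one. *)
Lemma sampler_of_mgf d pi k i (k0 m p : nat) (th1 B eps : R) :
  (2 <= p)%N -> is_complex d pi -> 0 < th1 <= 8^-1 -> 0 < B -> 0 < eps ->
  (0 < i)%N -> (k0 <= 2 * (m * i))%N ->
  (forall f th, (forall t, 0 <= f t <= 1) -> `|th| <= th1 ->
    mgf d pi k i (m%:R * th) f <= B * expR (4 * (m%:R * th ^+ 2))) ->
  incl_sampler d pi k i eps
    ((2 * B + 1) / eps * expR (- (th1 / 4 * eps ^+ p * (k0%:R / i%:R)))).
Proof.
move=> p2 pic /andP[th0 th8] B0 eps0 i0 k0mi H f f01 /=.
rewrite -/(face_mean d pi i f); set beta := _ * expR _.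
have beta0 : 0 < beta by rewrite mulr_gt0 ?expR_gt0 // divr_gt0 //; lra.
(* For [eps >= 1] no deviation exceeds [eps], both averages lying in [[0, 1]]; below 1, a power [p]
   above 2 only weakens the bound. *)
have [eps1|eps1] := leP 1 eps.
  rewrite big1 // => s; rewrite /pij; case: ifP => // /eqP sk.
  rewrite -{1}sk -/(subset_avg i s f) => tail; exfalso; move: tail.
  have /andP[a0 a1] := subset_avg01 i s f01.
  have /andP[b0 b1] := face_mean01 i pic f01.
  apply/negP; rewrite -leNgt; apply: le_trans eps1.
  by rewrite ler_norml; apply/andP; split; lra.
pose th := th1 * eps; have th_gt0 : 0 < th by rewrite mulr_gt0.
have th_le : `|th| <= th1 by rewrite gtr0_norm // ler_piMr // ltW.
have lam0 : 0 <= m%:R * th by rewrite mulr_ge0 // ltW.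
apply: le_lt_trans (sampler_tail_le k i f eps pic lam0) _.
have H1 := H f th f01 th_le.
have thN : `|- th| <= th1 by rewrite normrN.
have := H f (- th) f01 thN; rewrite sqrrN mulrN => H2.
(* The sampler bound is strict; the room comes from [2 * B < 2 * B + 1 <= (2 * B + 1) / eps]. *)
apply: (@le_lt_trans _ _ (2 * B * expR (- (th1 / 4 * eps ^+ p * (k0%:R / i%:R))))); last first.
  rewrite ltr_pM2r ?expR_gt0 //; apply: (@lt_le_trans _ _ (2 * B + 1)); first by rewrite ltrDl.
  by rewrite ler_pdivlMr // ler_piMr // ?ltW //; lra.
apply: (@le_trans _ _ (expR (- (m%:R * th * eps)) *
   (2 * (B * expR (4 * (m%:R * th ^+ 2)))))).
  by rewrite ler_wpM2l ?expR_ge0 //; lra.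
have -> : expR (- (m%:R * th * eps)) * (2 * (B * expR (4 * (m%:R * th ^+ 2))))
   = 2 * B * (expR (- (m%:R * th * eps)) * expR (4 * (m%:R * th ^+ 2))) by ring.
rewrite ler_pM2l ?mulr_gt0 // -expRD ler_expR.
have mk : k0%:R / i%:R <= 2 * m%:R :> R.
  rewrite ler_pdivrMr ?ltr0n // -!natrM ler_nat; by rewrite -mulnA.
have e2 : 0 <= eps ^+ 2 := sqr_ge0 eps.
have ep : eps ^+ p <= eps ^+ 2 by rewrite ler_wiXn2l // ltW.
have : th1 / 4 * eps ^+ p * (k0%:R / i%:R) <= th1 / 4 * eps ^+ 2 * (2 * m%:R).
  apply: ler_pM => //; first by rewrite mulr_ge0 ?divr_ge0 ?exprn_ge0 // ltW.
  by rewrite ler_wpM2l // divr_ge0 // ltW.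
have : 0 <= m%:R * eps ^+ 2 * (th1 * (8^-1 - th1)).
  by rewrite !mulr_ge0 // ?subr_ge0 // ltW.
rewrite /th; nra.
Qed.

Lemma face_mean_skeleton D piY d pi i f : is_skeleton d pi D piY -> is_complex d pi ->
  (i <= d)%N -> face_mean d pi i f = face_mean D piY i f.
Proof. exact: sum_pij_skeleton. Qed.

Lemma mgf_skeleton D piY d pi k i lam f : is_skeleton d pi D piY -> is_complex d pi ->
  (i <= k)%N -> (k <= d)%N -> mgf d pi k i lam f = mgf D piY k i lam f.
Proof.
move=> sk pic ik kd; rewrite /mgf (sum_pij_skeleton _ sk) //.
by rewrite (face_mean_skeleton _ sk) // (leq_trans ik).
Qed.

Lemma mgf_antitone d pi k k' i lam f : is_complex d pi ->
  (i <= k)%N -> (k <= k')%N -> (k' <= d)%N ->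
  mgf d pi k' i lam f <= mgf d pi k i lam f.
Proof.
move=> pic ik kk' k'd; rewrite /mgf !sum_pijE //; set mu := face_mean _ _ _ _.
apply: ler_sum => S _; have [->|S0] := eqVneq (pi S) 0; first by rewrite !mul0r.
have SD := complex_card pic S0; apply: ler_wpM2l; first by case: pic.
rewrite -[leRHS](subset_avg_subset_avg _ kk') ?SD //.
apply: le_subset_avg => s _ sk'.
have ks : (k <= #|s|)%N by rewrite sk'.
apply: le_trans (jensen_subset_avg _ ks).
by rewrite subset_avgM subset_avgB subset_avg_cst // subset_avg_subset_avg.
Qed.

End Sampler.

(** * The three kinds of nice complexes *)

Section Nice.
Variables (R : realType) (c : R).
Hypothesis c_gt0 : 0 < c.

(** Chosen so that the expansion bound is [expR (- 4 a d)]. Of this exponent, [2 a d] is given up in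
    [quasi_gap], [a d] pays for the exponential in [mgf_error], and [a d] for its polynomial
    factors. *)
Let a : R := c * ln 2 / 4.
Definition quasi_gap (d : nat) : R := d.+1%:R * expR (- (2 * a * d%:R)).
Definition mgf_const : R := 1 + (Num.min 1 (a / 4)) ^- 4.

Let a_gt0 : 0 < a.
Proof. by rewrite divr_gt0 // mulr_gt0 // ln_gt0 // ltr1n. Qed.

Lemma quasi_gap_ge0 d : 0 <= quasi_gap d.
Proof. by rewrite mulr_ge0 ?expR_ge0. Qed.

Lemma powR_nice (d : nat) : 2 `^ (- (c * d%:R)) = expR (- (4 * a * d%:R)) :> R.
Proof.
by rewrite /powR pnatr_eq0 /=; congr expR; rewrite /a; field.
Qed.

Lemma powR_nice_le d : 2 `^ (- (c * d%:R)) <= quasi_gap d :> R.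
Proof.
rewrite powR_nice; apply: (@le_trans _ _ (expR (- (2 * a * d%:R)))).
  rewrite ler_expR lerN2 ler_wpM2r // ler_wpM2r ?ler_nat // ltW //.
by rewrite ler_peMl ?expR_ge0 // ler1n.
Qed.

Lemma powR_nice_lt1 d : (0 < d)%N -> 0 <= 2 `^ (- (c * d%:R)) < 1.
Proof.
move=> d0; rewrite powR_ge0 powR_nice /= -[ltRHS]expR0 ltr_expR oppr_lt0.
by apply: mulr_gt0; [apply: mulr_gt0 | rewrite ltr0n].
Qed.

Lemma mgf_error_le d m i (th : R) : (m * i <= d)%N -> (0 < i)%N -> `|th| <= a ->
  mgf_error (quasi_gap d) m i th <= mgf_const.
Proof.
move=> mid i0 tha; rewrite /mgf_error /mgf_const lerD2l /quasi_gap.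
have md : (m <= d)%N by apply: leq_trans mid; rewrite leq_pmulr.
set b := Num.min 1 (a / 4).
have b0 : 0 < b by rewrite lt_min ltr01 divr_gt0.
have b1 : b <= 1 by rewrite ge_min lexx.
have ba : b <= a / 4 by rewrite ge_min lexx orbT.
pose x : R := d.+1%:R; have x0 : 0 <= x by rewrite ler0n.
have E1 : expR `|th| ^+ m <= expR (a * d%:R).
  rewrite -expRM_natl ler_expR mulrC; apply: ler_pM => //.
  by rewrite ler_nat.
(* The fourth power of [b (d + 1) <= 1 + a d / 4 <= expR (a d / 4)]. *)
have E2 : (b * x) ^+ 4 <= expR (a * d%:R).
  have -> : a * d%:R = 4%:R * (a / 4 * d%:R) by field.
  have bx0 : 0 <= b * x by rewrite mulr_ge0 // ltW.
  rewrite expRM_natl lerXn2r ?nnegrE ?expR_ge0 //.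
  apply: le_trans (expR_ge1Dx _).
  rewrite /x -natr1 mulrDr mulr1 addrC lerD // ler_wpM2r //.
apply: (@le_trans _ _ (x * x ^+ 2 * (x * expR (- (2 * a * d%:R))) * expR (a * d%:R))).
  have g0 : 0 <= x * expR (- (2 * a * d%:R)) by rewrite mulr_ge0 ?expR_ge0.
  apply: ler_pM E1; first by apply: mulr_ge0 => //; apply: mulr_ge0.
    by rewrite exprn_ge0 ?expR_ge0.
  apply: ler_wpM2r => //; apply: ler_pM => //; rewrite /x ?ler_nat ?(leqW md) //.
  by rewrite -natrX ler_nat leq_sqr leqW.
have -> : x * x ^+ 2 * (x * expR (- (2 * a * d%:R))) * expR (a * d%:R)
    = x ^+ 4 * expR (- (a * d%:R)).
  have -> : - (2 * a * d%:R) = - (a * d%:R) - a * d%:R by ring.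
  rewrite expRD -[in RHS](mulr1 (expR _)) -[X in _ = _ * (_ * X)](expRxMexpNx_1 (a * d%:R)).
  ring.
rewrite expRN ler_pdivrMr ?expR_gt0 // mulrC ler_pdivlMr ?exprn_gt0 //.
by rewrite -exprMn mulrC.
Qed.

Section Bounds.
Variables (V : finType) (d k i m : nat) (pi : {set V} -> R) (th : R)
  (f : {set V} -> R).
Hypothesis pic : is_complex d pi.
Hypothesis i_gt0 : (0 < i)%N.
Hypothesis ik : (i < k)%N.
Hypothesis kd : (k <= d)%N.
Hypothesis mik : (m * i <= k)%N.
Hypothesis f01 : forall t, 0 <= f t <= 1.
Hypothesis th_a : `|th| <= a.
Hypothesis th_half : `|th| <= 2^-1.

Let d_gt0 : (0 < d)%N. Proof. by apply: leq_trans kd; apply: leq_trans ik. Qed.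
Let i_bounds : (0 < i <= k)%N. Proof. by rewrite i_gt0 ltnW. Qed.

Lemma mgf_quasi_le (C : finType) (P : {ffun C -> V} -> R) (piY : {set V} -> R) :
  is_complex #|C| piY -> realizes P piY -> (d <= #|C|)%N ->
  quasi_independent P d (quasi_gap d) ->
  mgf #|C| piY k i (m%:R * th) f <= mgf_const * expR (4 * (m%:R * th ^+ 2)).
Proof.
move=> piYc Ppi dC Pq.
apply: le_trans (mgf_quasi_independent piYc Ppi (quasi_gap_ge0 d) Pq i_bounds mik
  (leq_trans kd dC) kd f01 th_half) _.
have -> : expR (4 * (m%:R * th ^+ 2)) = expR (2 * th ^+ 2) ^+ m * expR (2 * th ^+ 2) ^+ m.
  by rewrite -!expRM_natl -expRD; congr expR; ring.
rewrite mulrA mulrC ler_wpM2r ?mulr_ge0 ?exprn_ge0 ?expR_ge0 //.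
by apply: mgf_error_le => //; apply: leq_trans kd.
Qed.

Lemma link_cov_le_le e (piY : {set V} -> R) s (g g' : R) : g <= g' ->
  link_cov_le e piY s g -> link_cov_le e piY s g'.
Proof. move=> gg H al be al1 be1; exact: le_trans (H al be al1 be1) gg. Qed.

Lemma mgf_nice1 : nice1 c d pi ->
  mgf d pi k i (m%:R * th) f <= mgf_const * expR (4 * (m%:R * th ^+ 2)).
Proof.
move=> ni; have pic' : is_complex #|'I_d| pi by rewrite card_ord.
have := @mgf_quasi_le 'I_d (order_law pi) pi pic'; rewrite card_ord; apply => //.
  by apply: order_law_realizes => //; rewrite card_ord.
apply: order_law_quasi => //; rewrite ?card_ord ?quasi_gap_ge0 // => s sf sd.
apply: link_cov_le_le (powR_nice_le d) _.
by apply: two_sided_link_cov => //; [apply: powR_nice_lt1 | apply: ni].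
Qed.

Lemma mgf_nice2 : nice2 c d pi ->
  mgf d pi k i (m%:R * th) f <= mgf_const * expR (4 * (m%:R * th ^+ 2)).
Proof.
case=> D [piY [sk [[col colP] lse]]].
case: (sk) => piYc [dD _]; rewrite (mgf_skeleton _ _ sk) // ?(ltnW ik) //.
have piYc' : is_complex #|'I_D| piY by rewrite card_ord.
have piY0 : forall S, 0 <= piY S by case: piYc.
have colI S : piY S != 0 -> {in S &, injective col}.
  by move=> S0; apply: colP; rewrite lt_def S0 piY0.
have D0 : (0 < #|'I_D|)%N by rewrite card_ord; apply: leq_trans dD.
have /andP[l0 l1] := powR_nice_lt1 d_gt0.
(* If [D - d + 1 >= expR (2 a d)], the lower bound of [link_form_ge] is good enough for orderings,
   as [r - 1 >= D - d + 1]. Otherwise [D - 1 <= d + expR (2 a d)], and colors lose only this factor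
   against [expR (- 4 a d)]. *)
have [big|small] := leP (expR (2 * a * d%:R)) (D - d + 1)%N%:R.
  have := @mgf_quasi_le 'I_D (order_law piY) piY piYc'; rewrite card_ord; apply => //.
    exact: order_law_realizes.
  apply: order_law_quasi => //; rewrite ?card_ord ?quasi_gap_ge0 // => s sf sd.
  have sD : (#|s|.+2 <= D)%N by apply: leq_trans dD.
  apply: (@one_sided_link_cov _ _ _ _ _ piYc sf sD (2 `^ (- (c * d%:R)))) => //.
  - exact: powR_nice_le.
  - exact: quasi_gap_ge0.
  - apply: (@le_trans _ _ (expR (- (2 * a * d%:R)) * expR (2 * a * d%:R))).
      by rewrite -expRD addNr expR0.
    apply: ler_pM; rewrite ?expR_ge0 //.
      by rewrite ler_peMl ?expR_ge0 // ler1n.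
    apply: le_trans big _; rewrite lerBrDr natr1 ler_nat; lia.
  - exact: lse.
have := @mgf_quasi_le 'I_D (color_law col piY) piY piYc'; rewrite card_ord; apply => //.
  apply: color_law_realizes => //; last by case: piYc => _ [].
  by move=> S /(complex_card piYc')->.
apply: color_law_quasi => //.
- by move=> S /(complex_card piYc')->.
- exact: quasi_gap_ge0.
move=> s sf sd a1 b1 al be a1s b1s ab al1 be1.
have sD : (#|s|.+2 <= #|'I_D|)%N by rewrite card_ord; apply: leq_trans dD.
have l01 : 0 <= 2 `^ (- (c * d%:R)) < 1 by rewrite l0 l1.
have se : second_eig_le (link_walk piY s) (2 `^ (- (c * d%:R))).
  by apply: lse => //; rewrite card_ord in sD.
apply: le_trans (one_sided_color_cov piYc' colI sf sD l01 se a1s b1s ab al1 be1) _.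
rewrite card_ord powR_nice /quasi_gap.
apply: (@le_trans _ _ (expR (- (4 * a * d%:R)) * (d%:R + expR (2 * a * d%:R)))).
  rewrite ler_wpM2l ?expR_ge0 //; apply: (@le_trans _ _ (D%:R - 1)).
    by rewrite lerD2r ler_nat leq_subr.
  rewrite natrD natrB // in small; lra.
have -> : expR (- (4 * a * d%:R)) = expR (- (2 * a * d%:R)) * expR (- (2 * a * d%:R)).
  by rewrite -expRD; congr expR; ring.
rewrite -mulrA [leRHS]mulrC ler_wpM2l ?expR_ge0 // mulrDr -expRD addNr expR0.
rewrite -[d.+1%:R]natr1 lerD2r.
rewrite ler_piMl // -[leRHS]expR0 ler_expR oppr_le0.
by apply: mulr_ge0 => //; apply: mulr_ge0 => //; apply: ltW; apply: a_gt0.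
Qed.

Lemma mgf_nice3 : `|th| <= c -> `|th| <= 4 -> nice3 c d pi ->
  mgf d pi k i (m%:R * th) f <= expR 3 * expR (4 * (m%:R * th ^+ 2)).
Proof.
move=> thc th4 [D [piY [dD [sk gap]]]].
case: (sk) => piYc [dD' _]; rewrite (mgf_skeleton _ _ sk) // ?(ltnW ik) //.
have kD : (2 * k ^ 2 <= D)%N.
  by apply: leq_trans dD; rewrite leq_mul2l /= leq_sqr.
have thc2 : th ^+ 2 <= 4 * c.
  by rewrite -[leLHS]real_normK ?num_real // expr2; apply: ler_pM.
apply: le_trans (mgf_downup piYc c_gt0 gap i_bounds mik (leq_trans kd dD') kD f01 th_half thc2) _.
rewrite mulrC ler_wpM2l ?expR_ge0 // -expRM_natl ler_expR.
have : 0 <= m%:R * th ^+ 2 by rewrite mulr_ge0 ?sqr_ge0.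
lra.
Qed.

End Bounds.
End Nice.

Theorem mainTheorem1 (R : realType) (c : R) : 0 < c ->
  exists c1 c2 c3 : R, [/\ 0 < c1, 0 < c2, 0 < c3 &
  forall (V : finType) (d k i : nat) (eps : R) (pi : {set V} -> R),
    (0 < i)%N -> (i < k)%N -> (k <= d)%N -> 0 < eps -> is_complex d pi ->
    let beta1 := c1 / eps * expR (- (c2 * eps ^+ 2 * (k%:R / i%:R))) in
    let beta2 := c1 / eps * expR (- (c2 * eps ^+ 8 * (k%:R / i%:R))) in
    ((nice1 c d pi \/ nice3 c d pi) ->
       incl_sampler d pi k i eps beta1 /\
       (d = k -> forall (d' : nat) (piY : {set V} -> R),
          is_skeleton k pi d' piY ->
          forall k' : nat, (k < k' <= d')%N ->
            incl_sampler d' piY k' i eps (c3 * beta1)))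
    /\
    (nice2 c d pi ->
       incl_sampler d pi k i eps beta2 /\
       (d = k -> forall (d' : nat) (piY : {set V} -> R),
          is_skeleton k pi d' piY ->
          forall k' : nat, (k < k' <= d')%N ->
            incl_sampler d' piY k' i eps (c3 * beta2)))].
Proof.
(* The three bounds on [th1] serve the Chernoff optimization, the spectral gap case and
   [mgf_error_le]. *)
move=> c0; pose th1 := Num.min 8^-1 (Num.min c (c * ln 2 / 4)).
pose B := mgf_const c + expR 3.
have ln2 : 0 < ln 2 :> R by rewrite ln_gt0 // ltr1n.
have th1_gt0 : 0 < th1 by rewrite !lt_min c0 invr_gt0 ltr0n divr_gt0 ?mulr_gt0.
have th1_8 : th1 <= 8^-1 by rewrite ge_min lexx.
have th1_c : th1 <= c by rewrite !ge_min lexx orbT.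
have th1_a : th1 <= c * ln 2 / 4 by rewrite !ge_min lexx !orbT.
have K0 : 0 <= mgf_const c.
  rewrite addr_ge0 // invr_ge0 exprn_ge0 // le_min ler01 /=.
  by rewrite !divr_ge0 // mulr_ge0 // ltW.
have B0 : 0 < B by rewrite ltr_wpDl ?expR_gt0.
(* The bound for [k] serves unchanged for [k'], hence the factor 1. *)
exists (2 * B + 1), (th1 / 4), 1; split=> //; [lra | lra |].
move=> V d k i eps pi i0 ik kd eps0 pic beta1 beta2; pose m := (k %/ i)%N.
have mik : (m * i <= k)%N by rewrite leq_trunc_div.
(* Rounding [k / i] down loses at most a factor 2, because the quotient is at least 1. *)
have kmi : (k <= 2 * (m * i))%N.
  have m1 : (0 < m)%N by rewrite divn_gt0 // ltnW.
  rewrite {1}(divn_eq k i) mul2n -addnn leq_add2l.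
  by apply: ltnW; apply: leq_trans (ltn_pmod _ i0) _; rewrite leq_pmull.
(* Any [p >= 2] works for every kind of niceness; [p = 2] and [p = 8] are the two stated
   exponents. *)
have main p : (2 <= p)%N -> [\/ nice1 c d pi, nice2 c d pi | nice3 c d pi] ->
    let beta := (2 * B + 1) / eps * expR (- (th1 / 4 * eps ^+ p * (k%:R / i%:R))) in
    incl_sampler d pi k i eps beta /\
    (d = k -> forall (d' : nat) (piY : {set V} -> R), is_skeleton k pi d' piY ->
      forall k' : nat, (k < k' <= d')%N -> incl_sampler d' piY k' i eps beta).
  move=> p2 ni beta.
  have mgfB (f : {set V} -> R) th : (forall t, 0 <= f t <= 1) -> `|th| <= th1 ->
      mgf d pi k i (m%:R * th) f <= B * expR (4 * (m%:R * th ^+ 2)).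
    move=> f01 thle.
    have tha := le_trans thle th1_a; have thc := le_trans thle th1_c.
    have th8 := le_trans thle th1_8.
    have th2 : `|th| <= 2^-1 by lra.
    have th4 : `|th| <= 4 by lra.
    have E0 := expR_ge0 (4 * (m%:R * th ^+ 2)); have e3 := expR_ge0 (3 : R).
    case: ni => ni.
    - apply: le_trans (mgf_nice1 c0 pic i0 ik kd mik f01 tha th2 ni) _.
      by rewrite ler_wpM2r // lerDl.
    - apply: le_trans (mgf_nice2 c0 pic i0 ik kd mik f01 tha th2 ni) _.
      by rewrite ler_wpM2r // lerDl.
    - apply: le_trans (mgf_nice3 c0 pic i0 ik kd mik f01 th2 thc th4 ni) _.
      by rewrite ler_wpM2r // lerDr.
  have th1b : 0 < th1 <= 8^-1 by rewrite th1_gt0.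
  split; first exact: (sampler_of_mgf p2 pic th1b B0 eps0 i0 kmi mgfB).
  move=> dk d' piY sk k' /andP[kk' k'd']; case: (sk) => piYc [kd' _].
  apply: (sampler_of_mgf p2 piYc th1b B0 eps0 i0 kmi) => f th f01 thle.
  apply: le_trans (mgfB f th f01 thle); rewrite dk in pic *.
  rewrite (mgf_skeleton _ _ sk) // ?(ltnW ik) //.
  by apply: mgf_antitone => //; apply: ltnW.
rewrite !mul1r; split=> [ni|ni]; apply: main => //; last exact: Or32.
by case: ni => ni; [apply: Or31|apply: Or33].
Qed.
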